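(* Let $s\in[1,\infty)$, let $\Omega\subseteq\mathbb{H}^n$ be open and let $f\in W^{1,s}_{\mathcal H}(\Omega)$. Let $A\subseteq\Omega$ be open and such that $\mathrm{dist}(A,\partial\Omega)>0$. Then, for every $w\in\mathbb{H}^n$, $$\lim_{\varepsilon\searrow0}\frac{f(p\cdot\delta_\varepsilon(w))-f(p)}{\varepsilon}=\langle\nabla^{\mathcal H}f(p),w_{\mathcal H}\rangle$$ where the limit is in $L^s(A)$ (as functions of $p$). In addition, if $\varepsilon>0$ and $w\in\mathbb{H}^n$ satisfy $\varepsilon\big(|w_{\mathcal H}|+2\sqrt{|w_N|}\big)<\mathrm{dist}(A,\partial\Omega)$, one has $$\left\|\frac{f(p\cdot\delta_\varepsilon(w))-f(p)}{\varepsilon}\right\|_{L^s(A)}\le\big(|w_{\mathcal H}|+2\sqrt{|w_N|}\big)\big\|\nabla^{\mathcal H}f\big\|_{L^s(\Omega)}.$$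
   Context: $n\ge1$, $N=2n+1$; $\mathbb{H}^n$ is $\mathbb{R}^N=\mathbb{R}^n\times\mathbb{R}^n\times\mathbb{R}$ with group law $(x,y,t)\cdot(x',y',t')=\big(x+x',\,y+y',\,t+t'+2\sum_{j=1}^n(x_j'y_j-x_jy_j')\big)$, dilations $\delta_\lambda(x,y,t)=(\lambda x,\lambda y,\lambda^2t)$, and Lebesgue measure. Left-invariant frame: $Z_j=X_j=\partial_{x_j}+2y_j\partial_t$, $Z_{n+j}=Y_j=\partial_{y_j}-2x_j\partial_t$ ($j=1,\dots,n$), $Z_N=T=\partial_t$. For $w=(w_1,\dots,w_N)$, $w_{\mathcal H}=(w_1,\dots,w_{2n})$ and $|w_{\mathcal H}|$ is its Euclidean norm. $\nabla^{\mathcal H}f=(Z_1f,\dots,Z_{2n}f)$; $\langle\cdot,\cdot\rangle$ is the standard scalar product of components, and $\|\nabla^{\mathcal H}f\|_{L^s}$ is the $L^s$ norm of the pointwise Euclidean norm. $W^{1,s}_{\mathcal H}(\Omega)$ is the space of $u\in L^s(\Omega)$ whose distributional derivatives $Z_ju$, $j=1,\dots,2n$, belong to $L^s(\Omega)$. $\mathrm{dist}$ is computed with the Carnot–Carathéodory distance $d$ ($d(p,q)$ is the infimum of lengths $\int_0^1\sqrt{\langle\dot\gamma,\dot\gamma\rangle}\,d\tau$ of absolutely continuous curves $\gamma:[0,1]\to\mathbb{H}^n$ from $p$ to $q$ with a.e. velocity in $\operatorname{span}(Z_1,\dots,Z_{2n})$, where $\langle\cdot,\cdot\rangle$ is the Riemannian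 metric making $Z_1,\dots,Z_N$ orthonormal); $\mathrm{dist}(A,\emptyset)=\infty$. For $\varepsilon$ as in the smallness condition, $p\cdot\delta_\varepsilon(w)\in\Omega$ for all $p\in A$. *)

(* Defs.v *)
From HB Require Import structures.
From mathcomp Require Import all_boot all_order all_algebra.
From mathcomp Require Import all_classical all_reals all_analysis.

Set Implicit Arguments.
Unset Strict Implicit.
Unset Printing Implicit Defensive.

Import Order.TTheory GRing.Theory Num.Theory.
Import numFieldNormedType.Exports.

Local Open Scope classical_set_scope.
Local Open Scope ring_scope.

(* Row vectors carry the product sigma-algebra, as tuples do in the library;
   over the reals it is the Borel sigma-algebra. *)
Section measurable_row.
Context {d : measure_display} {T : sigmaRingType d} (n : nat).

Let coord (i : 'I_n) (v : 'rV[T]_n) : T := v ord0 i.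

Let row_set0 : g_sigma_preimage coord set0.
Proof. exact: sigma_algebra0. Qed.

Let row_setC A : g_sigma_preimage coord A -> g_sigma_preimage coord (~` A).
Proof. exact: sigma_algebraC. Qed.

Let row_bigcup (F : (set 'rV[T]_n)^nat) :
  (forall i, g_sigma_preimage coord (F i)) ->
  g_sigma_preimage coord (\bigcup_i F i).
Proof. exact: sigma_algebra_bigcup. Qed.

HB.instance Definition _ := @isMeasurable.Build (measure_tuple_display d)
  'rV[T]_n (g_sigma_preimage coord) row_set0 row_setC row_bigcup.

End measurable_row.

Lemma measurable_coord d (T : measurableType d) n (i : 'I_n) :
  measurable_fun [set: 'rV[T]_n] (fun v : 'rV[T]_n => v ord0 i).
Proof.
move=> _ Y mY; rewrite setTI; apply: sub_sigma_algebra => /=.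
rewrite -bigcup_seq/=; exists i => /=; first by rewrite mem_index_enum.
by exists Y => //; rewrite setTI.
Qed.

Lemma measurable_fun_coordP d1 d2 (T1 : measurableType d1)
    (T2 : measurableType d2) n (f : T1 -> 'rV[T2]_n) :
  (forall i, measurable_fun [set: T1] (fun x => f x ord0 i)) ->
  measurable_fun [set: T1] f.
Proof.
move=> mf _ Y mY; rewrite setTI; move: Y mY.
suff : @measurable _ 'rV[T2]_n `<=` [set Y | measurable (f @^-1` Y)].
  by move=> + Y; exact.
apply: smallest_sub => /=.
  split => /=; first by rewrite preimage_set0.
    by move=> A mA; rewrite setTD preimage_setC; exact: measurableC.
  by move=> F mF; rewrite preimage_bigcup; exact: bigcup_measurable.
move=> A; rewrite -bigcup_seq => -[i _ [B mB <-]] /=.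
by rewrite setTI -[X in measurable X]setTI; exact: mf.
Qed.

Section lebesgue_row.
Context {R : realType}.

Section step.
Context {n : nat} (m : {sigma_finite_measure set 'rV[R]_n -> \bar R}).

Let cons (z : measurableTypeR R * 'rV[R]_n) : 'rV[R]_n.+1 :=
  row_mx (z.1 : R)%:M z.2.

Let uncons (v : 'rV[R]_(1 + n)) : measurableTypeR R * 'rV[R]_n :=
  (v ord0 ord0, rsubmx v).

Let consK : cancel cons uncons.
Proof.
move=> [a v]; rewrite /uncons /cons /= row_mxKr; congr (_, _).
rewrite (_ : ord0 = lshift n (ord0 : 'I_1)); last exact: val_inj.
by rewrite row_mxEl mxE eqxx mulr1n.
Qed.

Definition lebesgue_cons : set 'rV[R]_n.+1 -> \bar R :=
  pushforward (@lebesgue_measure R \x m)%E cons.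

Let measurable_cons : measurable_fun setT cons.
Proof.
apply: measurable_fun_coordP => i; rewrite /cons.
case: (@split_ordP 1 n i) => j ->.
  under eq_fun => z do rewrite (@row_mxEl R 1 1 n) (ord1 j) mxE eqxx mulr1n.
  exact: measurable_fst.
under eq_fun => z do rewrite (@row_mxEr R 1 1 n).
exact: measurableT_comp (measurable_coord j) measurable_snd.
Qed.

Let measurable_uncons : measurable_fun setT uncons.
Proof.
apply: measurable_fun_pair; first exact: measurable_coord.
apply: measurable_fun_coordP => i.
under eq_fun => v do rewrite mxE.
exact: measurable_coord.
Qed.

Let image_measure : {measure set 'rV[R]_n.+1 -> \bar R} :=
  measure_function_pushforward__canonical__measure_function_Measure
    (@lebesgue_measure R \x m)%E measurable_cons.

HB.instance Definition _ := isMeasure.Build _ _ _ lebesgue_cons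
  (measure0 image_measure) (measure_ge0 image_measure)
  (@measure_semi_sigma_additive _ _ _ image_measure).

Let sigma_finite_cons : sigma_finite setT lebesgue_cons.
Proof.
have [F TF Foo] : sigma_finite setT (@lebesgue_measure R \x m)%E.
  have /sigma_finiteP[F [TF ndF Foo]] := sigma_finiteT (@lebesgue_measure R).
  have /sigma_finiteP[G [TG ndG Goo]] := sigma_finiteT m.
  exists (fun k => F k `*` G k).
    rewrite -setXTT TF TG predeqE => -[x y]; split.
      move=> [/= [i _ Fix] [j _ Gjy]]; exists (maxn i j) => //; split.
        by move: x Fix; exact/subsetPset/ndF/leq_maxl.
      by move: y Gjy; exact/subsetPset/ndG/leq_maxr.
    by move=> [k _ []/= ? ?]; split; exists k.
  move=> k; have [? ?] := Foo k; have [? ?] := Goo k.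
  split; first exact: measurableX.
  by rewrite product_measure1E// lte_mul_pinfty// ge0_fin_numE.
exists (fun k => uncons @^-1` F k).
  by rewrite -preimage_bigcup -TF preimage_setT.
move=> k; have [mF Fk] := Foo k; split.
  by rewrite -[X in measurable X]setTI; exact: measurable_uncons.
rewrite /lebesgue_cons /pushforward -comp_preimage.
by rewrite (_ : uncons \o cons = id) ?preimage_id//; apply/funext => z /=.
Qed.

HB.instance Definition _ := Measure_isSigmaFinite.Build _ _ _ lebesgue_cons
  sigma_finite_cons.

End step.

Fixpoint lebesgue_row (n : nat) :
    {sigma_finite_measure set 'rV[R]_n -> \bar R} :=
  if n is n'.+1 then lebesgue_cons (lebesgue_row n') else \d_(0 : 'rV[R]_0).

End lebesgue_row.

Section vectors.
Context {R : realType} {m : nat}.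
Implicit Types u v : 'rV[R]_m.

Definition dotp u v : R := \sum_i u ord0 i * v ord0 i.

(* The library's norm on 'rV[R]_m is the sup norm. *)
Definition enorm v : R := Num.sqrt (dotp v v).

End vectors.

(* The coordinates (x, y, t) of a point are the three blocks of a row of length
   n + n + 1. *)
Notation heis R n := 'rV[R]_(n + n + 1).

Section heisenberg.
Context {R : realType} {n : nat}.
Local Notation H := (heis R n).
Local Notation mu := (@lebesgue_row R (n + n + 1)).
Implicit Types (p q w v : H) (Omega A B : set H) (s : R).

Definition heis_pt (x y : 'rV[R]_n) (t : R) : H := row_mx (row_mx x y) t%:M.

Definition hpart w : 'rV[R]_(n + n) := lsubmx w.
Definition xpart w : 'rV[R]_n := lsubmx (hpart w).
Definition ypart w : 'rV[R]_n := rsubmx (hpart w).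
Definition tpart w : R := rsubmx w ord0 ord0.

Definition heis_mul p q : H :=
  heis_pt (xpart p + xpart q) (ypart p + ypart q)
    (tpart p + tpart q +
     2 * \sum_(j < n) (xpart q ord0 j * ypart p ord0 j -
                       xpart p ord0 j * ypart q ord0 j)).

Definition dilation (r : R) p : H :=
  heis_pt (r *: xpart p) (r *: ypart p) (r ^+ 2 * tpart p).

(* The left-invariant frame X_1, ..., X_n, Y_1, ..., Y_n, T. *)
Definition frame (i : 'I_(n + n + 1)) p : H :=
  match fintype.split i with
  | inl k => match fintype.split k with
             | inl j => heis_pt (delta_mx ord0 j) 0 (2 * ypart p ord0 j)
             | inr j => heis_pt 0 (delta_mx ord0 j) (- 2 * xpart p ord0 j)
             end
  | inr _ => heis_pt 0 0 1
  end.

Definition hframe (i : 'I_(n + n)) p : H := frame (lshift 1 i) p.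

(* Components of a tangent vector v at p in the frame:
   v = \sum_i frame_coord p v ord0 i *: frame i p. *)
Definition frame_coord p v : 'rV[R]_(n + n + 1) :=
  v *m invmx (\matrix_i frame i p).

(* The Riemannian metric making the frame orthonormal. *)
Definition metric p v w : R := dotp (frame_coord p v) (frame_coord p w).

Definition horizontal p v : Prop :=
  exists h : 'rV[R]_(n + n), v = \sum_i h ord0 i *: hframe i p.

Definition abs_continuous (a b : R) (gamma : R -> H) : Prop :=
  forall e : R, 0 < e -> exists2 d : R, 0 < d &
    forall (k : nat) (l r : 'I_k -> R),
      (forall i, [/\ a <= l i, l i <= r i & r i <= b]) ->
      (forall i j, i != j -> `]l i, r i[ `&` `]l j, r j[ = set0) ->
      \sum_i (r i - l i) < d -> \sum_i `|gamma (r i) - gamma (l i)| < e.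

Definition horizontal_curve p q (gamma : R -> H) : Prop :=
  [/\ abs_continuous 0 1 gamma, gamma 0 = p, gamma 1 = q &
      {ae @lebesgue_measure R, forall tau, 0 <= tau <= 1 ->
         derivable gamma tau 1 /\ horizontal (gamma tau) (derive1 gamma tau)}].

Definition curve_length (gamma : R -> H) : \bar R :=
  (\int[@lebesgue_measure R]_(tau in `[0%R, 1%R])
     (Num.sqrt (metric (gamma tau) (derive1 gamma tau) (derive1 gamma tau)))%:E)%E.

Definition ccdist p q : \bar R :=
  ereal_inf [set curve_length gamma | gamma in horizontal_curve p q].

(* Equal to +oo when A or B is empty. *)
Definition set_dist A B : \bar R :=
  ereal_inf [set ccdist z.1 z.2 | z in A `*` B].

Definition boundary Omega : set H := closure Omega `\` Omega°.

Fixpoint Ck (k : nat) (phi : H -> R) : Prop :=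
  continuous phi /\
  if k is k'.+1 then
    forall i, (forall p, derivable phi p (delta_mx ord0 i)) /\
              Ck k' ('D_(delta_mx ord0 i) phi)
  else True.

Definition test_function Omega (phi : H -> R) : Prop :=
  [/\ forall k, Ck k phi,
      compact (closure [set p | phi p != 0]) &
      closure [set p | phi p != 0] `<=` Omega].

(* g is the distributional derivative Z_i u on Omega; the fields Z_i are
   divergence free, so that the formal adjoint of Z_i is - Z_i. *)
Definition weak_deriv Omega (i : 'I_(n + n)) (u g : H -> R) : Prop :=
  forall phi, test_function Omega phi ->
    (\int[mu]_(p in Omega) (u p * 'D_(hframe i p) phi p)%:E =
     - \int[mu]_(p in Omega) (g p * phi p)%:E)%E.

(* Functions are defined on the whole space, and only their restriction to the
   set at hand matters; they stand for their classes modulo null sets. *)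
Definition inL s A (u : H -> R) : Prop := (u \_ A) \in Lfun mu s%:E.

Definition Lsnorm s A (u : H -> R) : \bar R :=
  ('N[mu]_(s%:E)[EFin \o (u \_ A)])%E.

Definition horizontal_sobolev s Omega (u : H -> R) : Prop :=
  inL s Omega u /\
  forall i, exists2 g, inL s Omega g & weak_deriv Omega i u g.

(* G is a representative of the horizontal gradient of u, which is unique up to
   null sets. *)
Definition is_hgrad s Omega (u : H -> R) (G : H -> 'rV[R]_(n + n)) : Prop :=
  forall i, inL s Omega (fun p => G p ord0 i) /\
            weak_deriv Omega i u (fun p => G p ord0 i).

Definition diff_quotient (f : H -> R) (w : H) (eps : R) (p : H) : R :=
  (f (heis_mul p (dilation eps w)) - f p) / eps.

End heisenberg.

(* Main.v *)
Require Import Defs.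
From mathcomp Require Import all_boot all_order all_algebra.
From mathcomp Require Import all_classical all_reals all_analysis.
From mathcomp Require Import measurable_realfun ring lra.
Import Order.TTheory GRing.Theory Num.Theory.
Import numFieldNormedType.Exports.
Local Open Scope classical_set_scope.
Local Open Scope ring_scope.
Set Implicit Arguments.
Unset Strict Implicit.
Unset Printing Implicit Defensive.
Import HBNNSimple.

(* A Sobolev function F is absolutely continuous along almost every orbit of
   the flow of a horizontal field v: testing with phi (p exp (-c v)) turns the
   weak derivative into F (p exp v) - F p = \int_0^1 <G (p exp (c v)), v> dc for
   almost every p, G being the horizontal gradient.  The point w is the end of
   the horizontal polygonal path made of its horizontal part followed by a
   commutator of flows of X_j and Y_j, of total length |w_H| + 2 sqrt |w_N|.
   Summing over the segments and using Minkowski's inequality and the invariance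
   of the measure under right translations gives the bound; comparing G along
   the dilated path with G p, the limit follows from the continuity of
   translations in L^s.  The path stays in Omega because a first exit point would
   be a boundary point at distance at most the length of the path. *)

(** * Lebesgue measure on row vectors *)

(** The null set in the identity along the flow depends on the direction, but a path uses only five
    directions. One estimate yields both claims: it compares the gradient along the path with a
    field [cf]; [cf = 0] gives the bound and [cf = G] the limit. The commutator has four sides of
    length at most half of sqrt |w_N|, which explains the constant 2, and they sum to zero, so that
    only w_H enters the limit. The path to the dilated point is the dilated path; it shrinks to the
    origin, and translations need to be continuous only at the identity. The functions are extended
    by 0 outside [Omega], which is harmless because test functions are supported in [Omega].
    Invariance under right translations comes from their form, identity plus a strictly triangular
    map. *)

Section boxes.
Context {R : realType} {m : nat}.
Implicit Types a b c v : 'rV[R]_m.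

Definition box a b : set 'rV[R]_m :=
  [set v | forall i, a ord0 i < v ord0 i < b ord0 i].

Definition cbox a b : set 'rV[R]_m :=
  [set v | forall i, a ord0 i <= v ord0 i <= b ord0 i].

Definition orthant c : set 'rV[R]_m := [set v | forall i, v ord0 i < c ord0 i].

Lemma box_cbox a b : box a b `<=` cbox a b.
Proof. by move=> v vab i; have /andP[/ltW -> /ltW ->] := vab i. Qed.

(** Cutting a box by an orthant only lowers its upper corner. Boxes with a fixed lower corner
    therefore see all orthants, which is what a Dynkin argument inside a box needs. *)
Lemma setI_box_orthant a b c :
  box a b `&` orthant c = box a (\row_i Num.min (b ord0 i) (c ord0 i)).
Proof.
apply/seteqP; split=> [v [vab vc] i|v vabc].
  by have /andP[-> vb] := vab i; rewrite mxE lt_min vb vc.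
by split=> i; have := vabc i; rewrite mxE lt_min => /and3P[h1 h2 h3];
  rewrite ?h1 ?h2 ?h3.
Qed.

Lemma measurable_box a b : measurable (box a b).
Proof.
rewrite (_ : box a b =
    \big[setI/setT]_i ((fun v : 'rV[R]_m => v ord0 i) @^-1`
                       `]a ord0 i, b ord0 i[%classic)).
  apply: bigsetI_measurable => i _.
  by rewrite -[X in measurable X]setTI; apply: measurable_coord.
rewrite -bigcap_seq; apply/seteqP; split=> [v vab i _ /=|v vab i].
  by rewrite /= in_itv; exact: vab.
by have := vab i; rewrite /= in_itv/=; apply; rewrite mem_index_enum.
Qed.

Lemma measurable_cbox a b : measurable (cbox a b).
Proof.
rewrite (_ : cbox a b =
    \big[setI/setT]_i ((fun v : 'rV[R]_m => v ord0 i) @^-1`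
                       `[a ord0 i, b ord0 i]%classic)).
  apply: bigsetI_measurable => i _.
  by rewrite -[X in measurable X]setTI; apply: measurable_coord.
rewrite -bigcap_seq; apply/seteqP; split=> [v vab i _ /=|v vab i].
  by rewrite /= in_itv; exact: vab.
by have := vab i; rewrite /= in_itv/=; apply; rewrite mem_index_enum.
Qed.

Lemma compact_cbox a b : compact (cbox a b).
Proof.
rewrite (_ : cbox a b = [set v : 'rV[R]_m | forall i,
    `[a ord0 i, b ord0 i]%classic (v ord0 i)]).
  by apply: (@rV_compact _ _ (fun i => `[a ord0 i, b ord0 i]%classic)) => i;
    exact: segment_compact.
by apply/seteqP; split=> v vab i; have := vab i; rewrite /= in_itv.
Qed.

Lemma ball_cbox (v : 'rV[R]_m) (e : R) : 0 < e ->
  ball v e = box (v - const_mx e) (v + const_mx e).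
Proof.
move=> e0; apply/seteqP; split=> [u [_ uv] i|u uv].
  have := uv ord0 i; rewrite /ball/= !mxE ltr_distlC.
  by move=> /andP[-> ->].
split=> // i j; have := uv j.
by rewrite (ord1 i) /ball/= !mxE ltr_distlC.
Qed.

(** Each point lies in a small box with rational corners. The closed box is kept inside [O] because
    functions built on a box are supported in its closure; countability of the corners gives
    measurability of open sets and lets almost everywhere statements pass from boxes to open
    sets. *)
Lemma open_bigcup_box (O : set 'rV[R]_m) : open O ->
  O = \bigcup_(z in [set z : 'rV[rat]_m * 'rV[rat]_m |
                    cbox (map_mx ratr z.1) (map_mx ratr z.2) `<=` O])
      box (map_mx ratr z.1) (map_mx ratr z.2).
Proof.
move=> oO; apply/seteqP; split=> [v Ov|v [z/= zO /box_cbox]]; last exact: zO.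
have /nbhs_ballP[e/= e0 eO] := open_nbhs_nbhs (conj oO Ov).
have q1 i : {q : rat | v ord0 i - e < ratr q < v ord0 i}.
  apply/cid; have [|q] := @rat_in_itvoo R (v ord0 i - e) (v ord0 i).
    by rewrite ltrBlDr ltrDl.
  by rewrite in_itv/=; exists q.
have q2 i : {q : rat | v ord0 i < ratr q < v ord0 i + e}.
  apply/cid; have [|q] := @rat_in_itvoo R (v ord0 i) (v ord0 i + e).
    by rewrite ltrDl.
  by rewrite in_itv/=; exists q.
exists (\row_i sval (q1 i), \row_i sval (q2 i)) => /=.
  apply: subset_trans eO; rewrite ball_cbox// => u uq i.
  have := uq i; rewrite !mxE.
  have /andP[q11 _] := svalP (q1 i); have /andP[_ q22] := svalP (q2 i).
  by move=> /andP[/(lt_le_trans q11) -> /le_lt_trans/(_ q22) ->].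
move=> i; rewrite !mxE.
by have /andP[_ ->] := svalP (q1 i); have /andP[-> _] := svalP (q2 i).
Qed.

Lemma open_measurable_row (O : set 'rV[R]_m) : open O -> measurable O.
Proof.
move=> /open_bigcup_box ->.
rewrite bigcup_mkcond; apply: countable_bigcupT_measurable => [|z].
  exact: countableP.
by case: ifPn => // _; exact: measurable_box.
Qed.

Lemma open_box a b : open (box a b).
Proof.
rewrite (_ : box a b =
    \big[setI/setT]_i ((fun v : 'rV[R]_m => v ord0 i) @^-1`
                       `]a ord0 i, b ord0 i[%classic)).
  apply: big_ind => [|? ?|i _]; [exact: openT|exact: openI|].
  apply: open_comp; last exact: interval_open.
  by move=> v _; exact: coord_continuous.
rewrite -bigcap_seq; apply/seteqP; split=> [v vab i _ /=|v vab i].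
  by rewrite /= in_itv; exact: vab.
by have := vab i; rewrite /= in_itv/=; apply; rewrite mem_index_enum.
Qed.

Lemma setI_closed_orthant : setI_closed (range orthant).
Proof.
move=> _ _ [c _ <-] [d _ <-].
exists (\row_i Num.min (c ord0 i) (d ord0 i)) => //.
apply/seteqP; split=> [v vcd|v [vc vd] i].
  by split=> i; have := vcd i; rewrite mxE lt_min => /andP[].
by rewrite mxE lt_min vc vd.
Qed.

Lemma measurable_orthant c : measurable (orthant c).
Proof.
rewrite (_ : orthant c =
    \big[setI/setT]_i ((fun v : 'rV[R]_m => v ord0 i) @^-1`
                       `]-oo, c ord0 i[%classic)).
  apply: bigsetI_measurable => i _.
  by rewrite -[X in measurable X]setTI; apply: measurable_coord.
rewrite -bigcap_seq; apply/seteqP; split=> [v vab i _ /=|v vab i].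
  by rewrite /= in_itv; exact: vab.
by have := vab i; rewrite /= in_itv/=; apply; rewrite mem_index_enum.
Qed.

(** The half-space [v_i < x] is the union over [k] of the orthants with bound [x] in coordinate [i]
    and [k] in the others, so the orthants, stable under intersection, generate. *)
Lemma measurable_row_orthant :
  @measurable _ 'rV[R]_m = <<s range orthant >>.
Proof.
apply/seteqP; split; last first.
  apply: smallest_sub; first exact: sigma_algebra_measurable.
  by move=> _ [c _ <-]; exact: measurable_orthant.
apply: smallest_sub; first exact: smallest_sigma_algebra.
move=> A; rewrite -bigcup_seq => -[i _ [B mB <-]] /=; rewrite setTI.
pose S := [set B : set R | <<s range orthant >>
   ((fun v : 'rV[R]_m => v ord0 i) @^-1` B)].
have sS : sigma_algebra setT S.
  have [s0 sC sU] := @smallest_sigma_algebra _ setT (range orthant).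
  split => [|C SC|F SF]; rewrite /S/=.
  - by rewrite preimage_set0; exact: s0.
  - by have := sC _ SC; rewrite !setTD preimage_setC.
  - by rewrite preimage_bigcup; exact: sU.
suff : @measurable _ (measurableTypeR R) `<=` S by apply.
rewrite RGenInftyO.measurableE; apply: smallest_sub => // _ [x ->]/=.
rewrite /S/= (_ : _ @^-1` _ =
  \bigcup_k orthant (\row_j if j == i then x else k%:R)); last first.
  apply/seteqP; split=> [v/= vx|v [k _ /(_ i)]]; last first.
    by rewrite mxE eqxx /= in_itv.
  exists (Num.bound (\big[Num.max/0]_j `|v ord0 j|)) => // j; rewrite mxE.
  case: eqP => [->|_]; first by move: vx; rewrite in_itv.
  apply: le_lt_trans (ler_norm _) _.
  apply: le_lt_trans (archi_boundP _); first exact: le_bigmax.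
  exact: bigmax_ge_id.
have [_ _ sU] := @smallest_sigma_algebra _ setT (range orthant).
by apply: sU => k; apply: sub_gen_smallest; exists (\row_j if j == i then x else k%:R).
Qed.

Lemma row_dynkin_induction (P : set_system 'rV[R]_m) :
  P setT -> (forall c, P (orthant c)) ->
  (forall D, measurable D -> P D -> P (~` D)) ->
  (forall F : (set 'rV[R]_m)^nat, (forall k, measurable (F k)) ->
    trivIset setT F -> (forall k, P (F k)) -> P (\bigcup_k F k)) ->
  forall D, measurable D -> P D.
Proof.
move=> PT PO PC PU D mD.
apply: (dynkin_induction measurable_row_orthant setI_closed_orthant PT) => //.
  by move=> _ [c _ <-].
by rewrite -measurable_row_orthant.
Qed.

End boxes.

(** * Invariance of Lebesgue measure under translations and shears *)

Section lebesgue_row_theory.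
Context {R : realType}.
Local Open Scope ereal_scope.

Lemma measurable_cons_row m : measurable_fun setT
  (fun z : measurableTypeR R * 'rV[R]_m =>
    row_mx (z.1 : R)%:M z.2 : 'rV[R]_m.+1).
Proof.
apply: measurable_fun_coordP => i.
case: (@split_ordP 1 m i) => j ->.
  under eq_fun => z do rewrite (@row_mxEl R 1 1 m) (ord1 j) mxE eqxx mulr1n.
  exact: measurable_fst.
under eq_fun => z do rewrite (@row_mxEr R 1 1 m).
exact: measurableT_comp (measurable_coord j) measurable_snd.
Qed.

Lemma ge0_integral_lebesgue_rowS m (F : 'rV[R]_m.+1 -> \bar R) :
  measurable_fun setT F -> (forall v, 0 <= F v) ->
  \int[lebesgue_row m.+1]_v F v =
  \int[lebesgue_measure]_x \int[lebesgue_row m]_u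
     F (row_mx (x : R)%:M u : 'rV[R]_(1 + m)).
Proof.
move=> mF F0.
rewrite [LHS](_ : _ = \int[lebesgue_cons (lebesgue_row m)]_v F v)//.
rewrite (@ge0_integral_pushforward _ _ _ _ _ _ (@measurable_cons_row m))//.
rewrite preimage_setT fubini_tonelli1//=.
exact: measurableT_comp (@measurable_cons_row m).
Qed.

(** The translated measure agrees with Lebesgue measure on half-open intervals, and these determine
    it. *)
Lemma lebesgue_measure_addr (c : R) (A : set R) :
  @measurable _ (measurableTypeR R) A ->
  @lebesgue_measure R ((fun x => x + c)%R @^-1` A) = lebesgue_measure A.
Proof.
move=> mA.
have madd : measurable_fun setT
    ((fun x => x + c)%R : measurableTypeR R -> measurableTypeR R).
  exact: measurable_funD.
apply/esym; transitivity (pushforward (@lebesgue_measure R)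
  ((fun x => x + c)%R : measurableTypeR R -> measurableTypeR R) A) => //.
pose mu' : {measure set (measurableTypeR R) -> \bar R} :=
  measure_function_pushforward__canonical__measure_function_Measure
    (@lebesgue_measure R) madd.
apply: (@lebesgue_measure_unique R mu') => // X [[a b] _ <-] /=.
rewrite /mu'/= /pushforward.
rewrite (_ : _ @^-1` _ = `]a - c, b - c]%classic)%R; last first.
  by apply/seteqP; split=> x /=; rewrite !in_itv/= ltrBlDr lerBrDr.
rewrite !lebesgue_measure_itv/= !lte_fin ltrD2r; case: ifP => // _.
by rewrite -!EFinB; congr (_%:E); ring.
Qed.

Lemma ge0_integral_lebesgue_addr (c : R) (F : R -> \bar R) :
  measurable_fun setT (F : measurableTypeR R -> \bar R) ->
  (forall x, 0 <= F x) ->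
  \int[lebesgue_measure]_x F (x + c)%R = \int[lebesgue_measure]_x F x.
Proof.
move=> mF F0.
have madd : measurable_fun setT
    ((fun x => x + c)%R : measurableTypeR R -> measurableTypeR R).
  exact: measurable_funD.
rewrite [RHS](_ : _ = \int[pushforward (@lebesgue_measure R)
  ((fun x => x + c)%R : measurableTypeR R -> measurableTypeR R)]_x F x).
  by rewrite ge0_integral_pushforward// preimage_setT.
by apply: eq_measure_integral => A mA _; exact/esym/lebesgue_measure_addr.
Qed.

(** Strict triangularity leaves the first coordinate a pure translation; the others undergo a map of
    the same form in one dimension less, whose constant depends on the first coordinate. *)
Lemma row_mx_shear m (x : R) (u : 'rV[R]_m) (c : 'rV[R]_(1 + m))
    (N : 'M[R]_(1 + m)) :
  (forall i j : 'I_(1 + m), (j <= i)%N -> N i j = 0%R) ->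
  (row_mx x%:M u + c + row_mx x%:M u *m N =
   row_mx (x + c ord0 ord0)%:M
     (u + (rsubmx c + x *: ursubmx N) + u *m drsubmx N))%R.
Proof.
move=> N0; rewrite -[in LHS](submxK N) -[in LHS](hsubmxK c).
have -> : ulsubmx N = 0%R.
  by apply/matrixP => i j; rewrite !mxE N0//= (ord1 i) (ord1 j).
have -> : dlsubmx N = 0%R.
  by apply/matrixP => i j; rewrite !mxE N0//= (ord1 j).
rewrite mul_row_block !mulmx0 !add0r !add_row_mx addr0 mul_scalar_mx.
congr row_mx; last by rewrite !addrA.
apply/rowP => i; rewrite (ord1 i) !mxE eqxx !mulr1n; congr (_ + c _ _)%R.
exact: val_inj.
Qed.

(** Induction on the dimension by Tonelli: with the first coordinate frozen, the induction
    hypothesis handles the others, and the first is then translated on the line. No determinant or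
    general change of variables enters. *)
Lemma ge0_integral_lebesgue_row_shear m (c : 'rV[R]_m) (N : 'M[R]_m)
    (F : 'rV[R]_m -> \bar R) :
  (forall i j : 'I_m, (j <= i)%N -> N i j = 0%R) ->
  measurable_fun setT F -> (forall v, 0 <= F v) ->
  \int[lebesgue_row m]_v F (v + c + v *m N)%R = \int[lebesgue_row m]_v F v.
Proof.
elim: m c N F => [|m IH] c N F N0 mF F0.
  by apply: eq_integral => v _; congr (F _); apply/rowP => -[].
rewrite (ge0_integral_lebesgue_rowS mF)//.
have mS : measurable_fun setT (fun v : 'rV[R]_m.+1 => v + c + v *m N)%R.
  apply: measurable_fun_coordP => i.
  under eq_fun => v do rewrite !mxE.
  apply: measurable_funD.
    by apply: measurable_funD => //; exact: measurable_coord.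
  apply: measurable_sum => j; apply: measurable_funM => //.
  exact: measurable_coord.
pose FS v := F (v + c + v *m N)%R.
have mFS : measurable_fun setT FS by exact: measurableT_comp mF mS.
rewrite -[LHS]/(\int[lebesgue_row m.+1]_v FS v) (ge0_integral_lebesgue_rowS mFS (fun v => F0 _)).
have mFx (x : R) : measurable_fun setT
    (fun u : 'rV[R]_m => F (row_mx x%:M u : 'rV[R]_(1 + m))).
  exact: (measurableT_comp mF (measurableT_comp (@measurable_cons_row m)
    (pair1_measurable x))).
pose Gx (x : R) := \int[lebesgue_row m]_u F (row_mx x%:M u : 'rV[R]_(1 + m)).
transitivity (\int[lebesgue_measure]_x Gx (x + c ord0 ord0)%R); last first.
  apply: (@ge0_integral_lebesgue_addr _ Gx) => [|x]; last exact: integral_ge0.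
  apply: (measurable_fun_fubini_tonelli_F
    (fun z : measurableTypeR R * 'rV[R]_m =>
       F (row_mx (z.1 : R)%:M z.2 : 'rV[R]_m.+1))) => //.
  exact: measurableT_comp (@measurable_cons_row m).
apply: eq_integral => x _; rewrite /Gx.
pose N' : 'M[R]_(1 + m) := N.
pose c' : 'rV[R]_(1 + m) := c.
rewrite -(IH (rsubmx c' + x *: ursubmx N')%R (drsubmx N')
  (fun u => F (row_mx (x + c ord0 ord0)%:M u : 'rV[R]_(1 + m))))//; last first.
  by move=> i j ij; rewrite !mxE N0//= !add1n ltnS.
apply: eq_integral => u _; rewrite /FS; congr (F _); exact: (row_mx_shear _ _ _ N0).
Qed.

Lemma lebesgue_row_cbox_lty m (a b : 'rV[R]_m) :
  lebesgue_row m (cbox a b) < +oo.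
Proof.
elim: m a b => [|m IH] a b.
  by rewrite /= diracE ltry.
pose a' : 'rV[R]_(1 + m) := a; pose b' : 'rV[R]_(1 + m) := b.
rewrite [ltLHS](_ : _ = (@lebesgue_measure R \x lebesgue_row m)%E
  (`[a ord0 ord0, b ord0 ord0]%classic `*` cbox (rsubmx a') (rsubmx b'))).
  rewrite product_measure1E//; last exact: measurable_cbox.
  rewrite lte_mul_pinfty// ?ge0_fin_numE// ?lebesgue_measure_itv/=.
  exact: compact_finite_measure (@segment_compact _ _ _).
rewrite /=/lebesgue_cons/pushforward/=; congr (_ _).
apply/seteqP; split=> [[x u]/= xu|[x u]/= [xab uab]].
  split.
    have := xu ord0; rewrite (_ : ord0 = lshift m (ord0 : 'I_1)); last exact: val_inj.
    by rewrite (@row_mxEl R 1 1 m) mxE in_itv.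
  by move=> i; have := xu (rshift 1 i); rewrite (@row_mxEr R 1 1 m) !mxE.
move=> i; case: (@split_ordP 1 m i) => j ->.
  rewrite (@row_mxEl R 1 1 m) (ord1 j) mxE eqxx mulr1n.
  move: xab; rewrite in_itv/=.
  by rewrite (_ : lshift m (0%R : 'I_1) = (ord0 : 'I_m.+1))//; exact: val_inj.
by rewrite (@row_mxEr R 1 1 m); have := uab j; rewrite !mxE.
Qed.

End lebesgue_row_theory.

(** * The Heisenberg group *)

Section heisenberg_group.
Context {R : realType} {n : nat}.
Local Notation H := (heis R n).
Implicit Types (p q w : H) (h : 'rV[R]_(n + n)).

Definition tidx : 'I_(n + n + 1) := rshift (n + n) ord0.

Lemma tpartE p : tpart p = p ord0 tidx.
Proof. by rewrite /tpart mxE. Qed.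

Lemma xpart_pt x y t : xpart (@heis_pt R n x y t) = x.
Proof. by rewrite /xpart /hpart /heis_pt !row_mxKl. Qed.

Lemma ypart_pt x y t : ypart (@heis_pt R n x y t) = y.
Proof. by rewrite /ypart /hpart /heis_pt row_mxKl row_mxKr. Qed.

Lemma tpart_pt x y t : tpart (@heis_pt R n x y t) = t.
Proof. by rewrite /tpart /heis_pt row_mxKr mxE eqxx mulr1n. Qed.

Lemma heis_ptK p : heis_pt (xpart p) (ypart p) (tpart p) = p.
Proof.
rewrite /heis_pt /xpart /ypart hsubmxK -[RHS]hsubmxK; congr row_mx.
by apply/rowP => i; rewrite (ord1 i) [LHS]mxE eqxx mulr1n.
Qed.

Lemma heisP p q : xpart p = xpart q -> ypart p = ypart q ->
  tpart p = tpart q -> p = q.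
Proof. by move=> xpq ypq tpq; rewrite -(heis_ptK p) xpq ypq tpq heis_ptK. Qed.

(** The standard symplectic form on horizontal coordinates, up to sign convention; of the point [p]
    only the horizontal part is read. The group law adds twice this form to the last coordinate. *)
Definition sympl (h : 'rV[R]_(n + n)) p : R :=
  \sum_(j < n) (h ord0 (lshift n j) * p ord0 (lshift 1 (rshift n j)) -
                p ord0 (lshift 1 (lshift n j)) * h ord0 (rshift n j)).

Lemma symplE p q : sympl (hpart q) p =
  \sum_(j < n) (xpart q ord0 j * ypart p ord0 j -
                xpart p ord0 j * ypart q ord0 j).
Proof. by apply: eq_bigr => j _; rewrite !mxE. Qed.

Lemma symplDr h p q : sympl h (p + q) = sympl h p + sympl h q.
Proof.
rewrite /sympl -big_split/=; apply: eq_bigr => j _; rewrite !mxE; ring.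
Qed.

Lemma symplZr h c p : sympl h (c *: p) = c * sympl h p.
Proof.
rewrite /sympl mulr_sumr; apply: eq_bigr => j _; rewrite !mxE; ring.
Qed.

Lemma symplDl h1 h2 p : sympl (h1 + h2) p = sympl h1 p + sympl h2 p.
Proof.
rewrite /sympl -big_split/=; apply: eq_bigr => j _; rewrite !mxE; ring.
Qed.

Lemma symplZl h c p : sympl (c *: h) p = c * sympl h p.
Proof.
rewrite /sympl mulr_sumr; apply: eq_bigr => j _; rewrite !mxE; ring.
Qed.

Lemma sympl_hpart h p : sympl h p = sympl h (row_mx (hpart p) 0).
Proof. by apply: eq_bigr => j _; rewrite !row_mxEl !mxE. Qed.

Lemma sympl_anti p q : sympl (hpart p) q = - sympl (hpart q) p.
Proof.
rewrite /sympl -sumrN; apply: eq_bigr => j _; rewrite !mxE; ring.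
Qed.

Lemma hpartD p q : hpart (p + q) = hpart p + hpart q.
Proof. by rewrite /hpart raddfD. Qed.

Lemma hpart_row h (t : 'rV[R]_1) : hpart (row_mx h t) = h.
Proof. by rewrite /hpart row_mxKl. Qed.

Lemma heis_mulE p q :
  heis_mul p q = p + q + row_mx 0 (2 * sympl (hpart q) p)%:M.
Proof.
apply: heisP.
- by rewrite xpart_pt /xpart !hpartD hpart_row addr0; apply/rowP => j; rewrite !mxE.
- by rewrite ypart_pt /ypart !hpartD hpart_row addr0; apply/rowP => j; rewrite !mxE.
- rewrite tpart_pt symplE !tpartE [RHS]mxE row_mxEr.
  by rewrite [X in _ = X + _]mxE [X in _ = _ + X]mxE eqxx mulr1n.
Qed.

Lemma hpart_mul p q : hpart (heis_mul p q) = hpart p + hpart q.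
Proof. by rewrite heis_mulE !hpartD hpart_row addr0. Qed.

Lemma heis_mulA p q w :
  heis_mul p (heis_mul q w) = heis_mul (heis_mul p q) w.
Proof.
have E a b (c : R) : sympl a (b + row_mx 0 c%:M) = sympl a b.
  rewrite symplDr [X in _ + X](_ : _ = 0) ?addr0//.
  by rewrite /sympl big1// => j _; rewrite !row_mxEl !mxE mulr0 mul0r subr0.
rewrite (heis_mulE p) hpart_mul (heis_mulE q) (heis_mulE _ w) (heis_mulE p q).
rewrite E symplDr symplDl; apply/rowP => i; rewrite !mxE.
case: (fintype.split i) => j; rewrite !mxE; first ring.
by case: eqP => _; rewrite ?mulr1n ?mulr0n; ring.
Qed.

Lemma heis_mulr0 p : heis_mul p 0 = p.
Proof.
rewrite heis_mulE addr0 [sympl _ _]big1 ?mulr0 => [|j _].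
  by rewrite (_ : row_mx _ _ = 0) ?addr0// raddf0 row_mx0.
by rewrite !mxE mulr0 mul0r subr0.
Qed.

Lemma heis_mul0r p : heis_mul 0 p = p.
Proof.
rewrite heis_mulE add0r [sympl _ _]big1 ?mulr0 => [|j _].
  by rewrite (_ : row_mx _ _ = 0) ?addr0// raddf0 row_mx0.
by rewrite !mxE mulr0 mul0r subr0.
Qed.

Lemma heis_mulrN p : heis_mul p (- p) = 0.
Proof.
rewrite heis_mulE subrr add0r [sympl _ _]big1 ?mulr0 => [|j _].
  by rewrite raddf0 row_mx0.
by rewrite !mxE; ring.
Qed.

Lemma heis_mulNr p : heis_mul (- p) p = 0.
Proof. by rewrite -{2}(opprK p) heis_mulrN. Qed.

(** The exponential of the left-invariant field with components [h] in the horizontal frame;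
    [hvec h p] below is that field at [p]. *)
Definition hpt h : H := row_mx h 0.

Definition hvec h p : H := row_mx h (2 * sympl h p)%:M.

Lemma hpartK h : hpart (hpt h) = h. Proof. exact: hpart_row. Qed.

Lemma hpart_hvec h p : hpart (hvec h p) = h. Proof. exact: hpart_row. Qed.

Lemma heis_mul_hpt p h : heis_mul p (hpt h) = p + hvec h p.
Proof. by rewrite heis_mulE hpartK -addrA add_row_mx addr0 add0r. Qed.

Lemma hvecZ c h p : hvec (c *: h) p = c *: hvec h p.
Proof.
rewrite /hvec symplZl scale_row_mx; congr row_mx.
by rewrite scale_scalar_mx; congr (_%:M); ring.
Qed.

(* The horizontal vector fields of constant coefficients have straight lines
   as integral curves. *)
Lemma hvec_line h p (c : R) : hvec h (p + c *: hvec h p) = hvec h p.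
Proof.
rewrite /hvec symplDr symplZr; congr (row_mx _ (_%:M)).
suff -> : sympl h (hvec h p) = 0 by rewrite mulr0 addr0.
by rewrite /sympl big1// => j _; rewrite !row_mxEl; ring.
Qed.

Lemma heis_mul_hptZ p (c : R) h : heis_mul p (hpt (c *: h)) = p + c *: hvec h p.
Proof. by rewrite heis_mul_hpt hvecZ. Qed.

Lemma heis_mul_hptD p (c d : R) h :
  heis_mul (heis_mul p (hpt (c *: h))) (hpt (d *: h)) =
  heis_mul p (hpt ((c + d) *: h)).
Proof. by rewrite !heis_mul_hptZ hvec_line scalerDl addrA. Qed.

Lemma hframeE i p : hframe i p = hvec (delta_mx ord0 i) p.
Proof.
rewrite /hframe /frame (unsplitK (inl i)).
case: (split_ordP i) => j ij.
  rewrite ij /heis_pt /hvec; congr row_mx.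
    by apply/rowP => k; case: (@split_ordP n n k) => l ->; 
    rewrite ?row_mxEl ?row_mxEr !mxE ?eq_lshift ?eq_rlshift ?eq_lrshift ?eq_rshift.
  congr (_%:M); rewrite /sympl (bigD1 j)//= big1 ?addr0 => [|k kj].
    by rewrite !mxE !eqxx /= eq_rlshift mulr0 subr0 mul1r.
  by rewrite !mxE !eqxx /= eq_rlshift eq_lshift (negbTE kj) mulr0 mul0r subr0.
rewrite ij /heis_pt /hvec; congr row_mx.
  by apply/rowP => k; case: (@split_ordP n n k) => l ->; 
    rewrite ?row_mxEl ?row_mxEr !mxE ?eq_lshift ?eq_rlshift ?eq_lrshift ?eq_rshift.
congr (_%:M); rewrite /sympl (bigD1 j)//= big1 ?addr0 => [|k kj].
  by rewrite !mxE !eqxx /= eq_lrshift mul0r sub0r mulr1; ring.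
by rewrite !mxE !eqxx /= eq_lrshift eq_rshift (negbTE kj) mulr0 mul0r subr0.
Qed.

Lemma hvec_sum h p : hvec h p = \sum_i h ord0 i *: hframe i p.
Proof.
rewrite (eq_bigr (fun i => hvec (h ord0 i *: delta_mx ord0 i) p)); last first.
  by move=> i _; rewrite hframeE hvecZ.
rewrite {1}(row_sum_delta h); elim/big_ind2: _ => //.
- rewrite /hvec [sympl _ _]big1 ?mulr0 => [|j _].
    by rewrite raddf0 row_mx0.
  by rewrite !mxE mulr0 mul0r subr0.
- move=> h1 _ h2 _ <- <-; rewrite /hvec symplDl add_row_mx mulrDr.
  by congr row_mx; rewrite raddfD.
Qed.

Lemma dilationE r p : dilation r p = row_mx (r *: hpart p) (r ^+ 2 * tpart p)%:M.
Proof.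
rewrite /dilation /heis_pt; congr row_mx.
by rewrite -scale_row_mx hsubmxK.
Qed.

Lemma dilation_mul r p q :
  dilation r (heis_mul p q) = heis_mul (dilation r p) (dilation r q).
Proof.
apply: heisP; rewrite /dilation /heis_mul ?xpart_pt ?ypart_pt ?tpart_pt ?scalerDr//.
rewrite !mulrDr; congr (_ + _); rewrite mulrCA; congr (_ * _).
by rewrite mulr_sumr; apply: eq_bigr => j _; rewrite !mxE; ring.
Qed.

Lemma dilation_hpt r h : dilation r (hpt h) = hpt (r *: h).
Proof.
by rewrite dilationE hpartK tpartE row_mxEr mxE mulr0 raddf0.
Qed.

(** The bilinear part of the group law, as a linear map of the left factor. Only the last column is
    nonzero and its last entry vanishes, so the matrix is strictly upper triangular. *)
Definition shear q : 'M[R]_(n + n + 1) :=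
  block_mx 0 (col_mx (- 2 *: (ypart q)^T) (2 *: (xpart q)^T)) 0 0.

Lemma heis_mul_shear p q : heis_mul p q = p + q + p *m shear q.
Proof.
rewrite heis_mulE; congr (_ + _).
rewrite -{2}(hsubmxK p) -(hsubmxK (lsubmx p)) mul_row_block !mulmx0 !addr0.
congr row_mx; rewrite mul_row_col; apply/rowP => i; rewrite (ord1 i) !mxE eqxx mulr1n.
rewrite /sympl mulr_sumr -big_split/=; apply: eq_bigr => j _; rewrite !mxE; ring.
Qed.

Lemma shear_strict q (i j : 'I_(n + n + 1)) : (j <= i)%N -> shear q i j = 0.
Proof.
case: (split_ordP j) => k ->.
  by case: (split_ordP i) => l -> _; rewrite ?block_mxEul ?block_mxEdl mxE.
case: (split_ordP i) => l ->; last by rewrite block_mxEdr mxE.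
by rewrite /= (ord1 k) addn0 leqNgt (ltn_ord l).
Qed.

End heisenberg_group.

(** * Continuity and measurability of maps into row vectors and of the group law *)

Section row_maps.
Context {R : realType} {m : nat}.

Lemma continuous_row (T : topologicalType) (F : T -> 'rV[R]_m) :
  (forall i, continuous (fun x => F x ord0 i)) -> continuous F.
Proof.
move=> cF x A [P nP sPA]; apply: filterS (sPA) _ => /=.
have : \forall y \near x, forall i, P ord0 i (F y ord0 i).
  apply: filter_forall => i; exact: (cF i x _ (nP ord0 i)).
by apply: filterS => y Py i j; rewrite (ord1 i).
Qed.

Lemma continuous_sum_fun (T : topologicalType) k (F : 'I_k -> T -> R) :
  (forall i, continuous (F i)) -> continuous (fun x => \sum_i F i x).
Proof.
move=> cF x; elim: k F cF => [|k IH] F cF.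
  under eq_fun do rewrite big_ord0.
  exact: cvg_cst.
under eq_fun do rewrite big_ord_recl.
exact: (continuousD (cF ord0 x) (IH _ (fun i => cF (lift ord0 i)))).
Qed.

Lemma continuous_coord (i : 'I_m) : continuous (fun v : 'rV[R]_m => v ord0 i).
Proof. exact: coord_continuous. Qed.

Lemma continuous_coordf (T : topologicalType) (F : T -> 'rV[R]_m) i :
  continuous F -> continuous (fun x => F x ord0 i).
Proof.
move=> cF x.
exact: (@continuous_comp _ _ _ F (fun v => v ord0 i) x (cF x)
  (@continuous_coord i (F x))).
Qed.

Lemma norm_coord_le (v : 'rV[R]_m) i : `|v ord0 i| <= `|v|.
Proof.
rewrite [leRHS]/Num.norm /= mx_normrE.
by apply/bigmax_geP; right => /=; exists (ord0, i).
Qed.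

(** Otherwise each ball of radius [1/(k+1)] would contain a counterexample, and these would tend to
    0. Limits in [q] are thus reduced to sequences, for which dominated convergence is available. *)
Lemma near0_seq (P : set 'rV[R]_m) :
  (forall u : nat -> 'rV[R]_m, u @ \oo --> (0 : 'rV[R]_m) ->
     exists k, P (u k)) ->
  \forall q \near (0 : 'rV[R]_m), P q.
Proof.
move=> seqP; apply: contrapT => nP.
have u k : {q : 'rV[R]_m | `|q| < k.+1%:R^-1 /\ ~ P q}.
  apply/cid; apply: contrapT => nq; apply: nP.
  apply/nbhs_norm0P; exists k.+1%:R^-1; first by rewrite /= invr_gt0.
  by move=> q qk; apply: contrapT => nPq; apply: nq; exists q.
have [|k] := seqP (fun k => sval (u k)); last by have [] := svalP (u k).
apply/cvgr0Pnorm_lt => e e0; near=> k.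
have [uk _] := svalP (u k); apply: (lt_trans uk).
near: k; exact: near_infty_natSinv_lt (PosNum e0).
Unshelve. all: by end_near. Qed.

End row_maps.

Section heisenberg_maps.
Context {R : realType} {n : nat}.
Local Notation H := (heis R n).
Local Notation mu := (@lebesgue_row R (n + n + 1)).
Implicit Types (p q w : H) (h : 'rV[R]_(n + n)).

Lemma heis_mul_coord p q i : heis_mul p q ord0 i =
  p ord0 i + q ord0 i +
  (if i == @tidx n then
     2 * \sum_(j < n) (q ord0 (lshift 1 (lshift n j)) *
                       p ord0 (lshift 1 (rshift n j)) -
                       p ord0 (lshift 1 (lshift n j)) *
                       q ord0 (lshift 1 (rshift n j)))
   else 0).
Proof.
rewrite heis_mulE [LHS]mxE [X in X + _ = _]mxE; congr (_ + _).
case: (split_ordP i) => j ->; first by rewrite row_mxEl mxE eq_lrshift.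
rewrite row_mxEr (ord1 j) mxE !eqxx mulr1n; congr (_ * _).
by apply: eq_bigr => k _; rewrite !mxE.
Qed.

Lemma continuous_heis_mul (T : topologicalType) (F G : T -> H) :
  continuous F -> continuous G -> continuous (fun x => heis_mul (F x) (G x)).
Proof.
move=> cF cG.
have cf i : continuous (fun x => F x ord0 i).
  exact: continuous_coordf.
have cg i : continuous (fun x => G x ord0 i).
  exact: continuous_coordf.
apply: continuous_row => i; under eq_fun do rewrite heis_mul_coord.
pose S x := \sum_(j < n) (G x ord0 (lshift 1 (lshift n j)) *
   F x ord0 (lshift 1 (rshift n j)) - F x ord0 (lshift 1 (lshift n j)) *
   G x ord0 (lshift 1 (rshift n j))).
have cS : continuous S.
  apply: continuous_sum_fun => j x.
  exact: (continuousB (continuousM (cg _ x) (cf _ x))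
                      (continuousM (cf _ x) (cg _ x))).
have c0 : continuous (fun x => if i == tidx then 2 * S x else 0 : R).
  case: (i == tidx) => x; last exact: cvg_cst.
  by apply: cvgM; [exact: cvg_cst|exact: cS].
move=> x; exact: (continuousD (continuousD (cf i x) (cg i x)) (c0 x)).
Qed.

Lemma measurable_heis_mul d (T : measurableType d) (F G : T -> H) :
  measurable_fun setT F -> measurable_fun setT G ->
  measurable_fun setT (fun x => heis_mul (F x) (G x)).
Proof.
move=> mF mG.
have mf i : measurable_fun setT (fun x => F x ord0 i).
  exact: measurableT_comp (measurable_coord i) mF.
have mg i : measurable_fun setT (fun x => G x ord0 i).
  exact: measurableT_comp (measurable_coord i) mG.
apply: measurable_fun_coordP => i; under eq_fun do rewrite heis_mul_coord.
apply: measurable_funD; first exact: measurable_funD.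
case: (i == tidx); last exact: measurable_cst.
apply: measurable_funM; first exact: measurable_cst.
by apply: measurable_sum => j; apply: measurable_funB; exact: measurable_funM.
Qed.

Lemma continuous_mulr q : continuous (fun p => heis_mul p q).
Proof. apply: (@continuous_heis_mul _ id (fun=> q)) => x A; first exact.
exact: (@cst_continuous H H q x A). Qed.

Lemma continuous_mull p : continuous (heis_mul p).
Proof. apply: (@continuous_heis_mul _ (fun=> p) id) => x A; last exact.
exact: (@cst_continuous H H p x A). Qed.

Lemma measurable_mulr q : measurable_fun setT (fun p : H => heis_mul p q : H).
Proof. by apply: measurable_heis_mul. Qed.

Lemma measurable_row_scale d (T : measurableType d) m (c : T -> R)
    (F : T -> 'rV[R]_m) :
  measurable_fun setT c -> measurable_fun setT F ->
  measurable_fun setT (fun x => c x *: F x).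
Proof.
move=> mc mF; apply: measurable_fun_coordP => i.
under eq_fun do rewrite mxE.
by apply: measurable_funM => //; exact: measurableT_comp (measurable_coord i) mF.
Qed.

Lemma measurable_hpt d (T : measurableType d) (F : T -> 'rV[R]_(n + n)) :
  measurable_fun setT F -> measurable_fun setT (fun x => hpt (F x)).
Proof.
move=> mF; apply: measurable_fun_coordP => i.
case: (split_ordP i) => j ->.
  under eq_fun do rewrite row_mxEl.
  exact: measurableT_comp (measurable_coord j) mF.
under eq_fun do rewrite row_mxEr mxE.
exact: measurable_cst.
Qed.

Lemma continuous_hptZ h : continuous (fun c : R => hpt (c *: h)).
Proof.
apply: continuous_row => i.
case: (split_ordP i) => j ->.
  under eq_fun do rewrite row_mxEl mxE.
  by move=> x; apply: continuousM => //; exact: cst_continuous.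
under eq_fun do rewrite row_mxEr mxE.
by move=> x; exact: cst_continuous.
Qed.

Lemma open_mulr_preimage q (O : set H) : open O ->
  open ((fun p => heis_mul p q) @^-1` O).
Proof. by move=> oO; apply: open_comp => // p _; exact: continuous_mulr. Qed.

Lemma measurable_mulr_preimage q (D : set H) : measurable D ->
  measurable ((fun p => heis_mul p q) @^-1` D).
Proof.
by move=> mD; rewrite -[X in measurable X]setTI; exact: measurable_mulr.
Qed.

Local Open Scope ereal_scope.

Lemma ge0_integral_mulr q (F : H -> \bar R) :
  measurable_fun setT F -> (forall p, 0 <= F p) ->
  \int[mu]_p F (heis_mul p q) = \int[mu]_p F p.
Proof.
move=> mF F0.
rewrite -[RHS](ge0_integral_lebesgue_row_shear q (@shear_strict _ _ q) mF F0).
by apply: eq_integral => p _; rewrite heis_mul_shear.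
Qed.

Lemma integral_mulr q (F : H -> \bar R) : measurable_fun setT F ->
  \int[mu]_p F (heis_mul p q) = \int[mu]_p F p.
Proof.
move=> mF; rewrite integralE [RHS]integralE.
congr (_ - _).
  rewrite -(ge0_integral_mulr q (measurable_funepos mF))//.
  apply: eq_integral => p _.
  exact: (congr1 (fun f => f p) (funepos_comp F (fun p => heis_mul p q))).
rewrite -(ge0_integral_mulr q (measurable_funeneg mF) (funeneg_ge0 F)).
apply: eq_integral => p _.
exact: (congr1 (fun f => f p) (funeneg_comp F (fun p => heis_mul p q))).
Qed.

Lemma measure_mulr_preimage q (D : set H) : measurable D ->
  mu ((fun p => heis_mul p q) @^-1` D) = mu D.
Proof.
move=> mD.
rewrite -[X in mu X = _]setIT -[X in _ = mu X]setIT.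
rewrite -!integral_indic//; last exact: measurable_mulr_preimage.
rewrite -[RHS](ge0_integral_mulr q)//.
by apply/measurable_EFinP; exact: measurable_indic.
Qed.

End heisenberg_maps.

(** * Continuity of right translations in L^s *)

Section translation_continuity.
Context {R : realType} {n : nat}.
Local Notation H := (heis R n).
Local Notation mu := (@lebesgue_row R (n + n + 1)).
Local Open Scope ereal_scope.

Let out (D : set H) q := D `\` ((fun p => heis_mul p q) @^-1` D).

Let mout D q : measurable D -> measurable (out D q).
Proof. by move=> mD; apply: measurableD => //; exact: measurable_mulr_preimage. Qed.

(** [D] and its preimage have the same finite measure, so each exceeds their intersection by the
    same amount: one half of the symmetric difference controls the other. *)
Let out_sym D q : measurable D -> mu D < +oo ->
  mu (((fun p => heis_mul p q) @^-1` D) `\` D) = mu (out D q).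
Proof.
move=> mD Dfin; have mDq := measurable_mulr_preimage q mD.
have Dqfin : mu ((fun p => heis_mul p q) @^-1` D) < +oo.
  by rewrite measure_mulr_preimage.
rewrite /out !measureD//; congr (_ - _); first exact: measure_mulr_preimage.
by rewrite setIC.
Qed.

Let small D := forall e : R, (0 < e)%R ->
  \forall q \near (0%R : H), mu (out D q) <= e%:E.

(** A point of an open set stays in it under small translations, so the indicators of [out O (u k)]
    tend to 0 pointwise, dominated by that of [O]. *)
Let small_open O : open O -> mu O < +oo -> small O.
Proof.
move=> oO Ofin e e0; have mO := open_measurable_row oO.
apply: near0_seq => u u0.
have : \int[mu]_p (\1_(out O (u k)) p)%:E @[k --> \oo] --> \int[mu]_p (cst 0 p : \bar R).
  apply: (@dominated_cvg _ _ _ mu setT measurableT _ _ (EFin \o \1_O)) => //.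
  - move=> k; apply/measurable_EFinP; by apply: measurable_indic; exact: mout.
  - move=> p _; have [Op|nOp] := pselect (O p); last first.
      apply: cvg_near_cst; apply: nearW => k; rewrite indicE memNset//.
      by case.
    have pO : \forall k \near \oo, O (heis_mul p (u k)).
      have : heis_mul p (u k) @[k --> \oo] --> p.
        rewrite -[X in _ --> X]heis_mulr0.
        exact: (cvg_comp _ _ u0 (@continuous_mull _ _ p 0%R)).
      by apply; exact: open_nbhs_nbhs.
    apply: cvg_near_cst; apply: filterS pO => k Ok; rewrite indicE memNset//.
    by case.
  - apply/integrableP; split.
      by apply/measurable_EFinP; exact: measurable_indic.
    under eq_integral do rewrite /= ger0_norm//.
    by rewrite integral_indic// setIT.
  - move=> k p _; rewrite /= ger0_norm// lee_fin !indicE.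
    by case: (boolP (p \in out _ _)) => // /set_mem[Op _]; rewrite mem_set.
rewrite integral0 => /fine_cvgP[_ /cvgr0Pnorm_le/(_ _ e0)] h.
have [k [kfin ke]] : exists k, mu (out O (u k)) \is a fin_num /\
   (`|fine (\int[mu]_p (\1_(out O (u k)) p)%:E)| <= e)%R.
  near \oo => k; exists k; split; last by near: k.
  rewrite ge0_fin_numE//; apply: le_lt_trans Ofin.
  by apply: le_measure; rewrite ?inE//; [exact: mout|exact: subDsetl].
exists k; rewrite integral_indic ?setIT in ke; last exact: mout.
by rewrite -(fineK kfin) lee_fin (le_trans _ ke)// ler_norm.
Unshelve. all: by end_near. Qed.

(** Dynkin induction on [D], starting from orthants, whose intersection with the box is open. The
    box keeps all measures finite for the complement and union steps. *)
Let small_meas (D : set H) a b : measurable D -> small (D `&` box a b).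
Proof.
move: D; pose K := box a b.
have mK : measurable K by exact: measurable_box.
have Kfin : mu K < +oo.
  apply: le_lt_trans (lebesgue_row_cbox_lty a b).
  by apply: le_measure; rewrite ?inE//; [exact: measurable_cbox|exact: box_cbox].
have DKfin D : measurable D -> mu (D `&` K) < +oo.
  move=> mD; apply: le_lt_trans Kfin.
  by apply: le_measure; rewrite ?inE//; exact: measurableI.
have smallK : small K by apply: small_open => //; exact: open_box.
apply: row_dynkin_induction.
- by rewrite setTI.
- move=> c; rewrite setIC setI_box_orthant; apply: small_open; first exact: open_box.
  rewrite -setI_box_orthant setIC; apply: DKfin; exact: measurable_orthant.
- move=> D mD sD e e0; have e20 : (0 < e / 2)%R by rewrite divr_gt0.
  near=> q.
  have mDK := measurableI _ _ mD mK.
  (* A point of [K] outside [D] loses this property by leaving [K] or by entering the intersection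
     of [D] and [K] from outside it. *)
  apply: (@le_trans _ _ (mu (out K q) +
      mu (((fun p => heis_mul p q) @^-1` (D `&` K)) `\` (D `&` K)))).
    apply: le_trans (measureU2 _ _ _); last 2 first.
      exact: mout.
      by apply: measurableD => //; exact: measurable_mulr_preimage.
    apply: le_measure; rewrite ?inE.
    - by apply: mout; apply: measurableI => //; exact: measurableC.
    - apply: measurableU; first exact: mout.
      by apply: measurableD => //; exact: measurable_mulr_preimage.
    - move=> p [[nDp Kp] npq]; have [Kpq|nKpq] := pselect (K (heis_mul p q)).
        right; split; last by case.
        by split => //; apply: contrapT => nD; apply: npq.
      by left.
  rewrite out_sym//; last exact: DKfin.
  rewrite (splitr e) EFinD; apply: leeD.
    by near: q; exact: smallK.
  by near: q; exact: sD.
- move=> F mF tF sF e e0; have e20 : (0 < e / 2)%R by rewrite divr_gt0.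
  (* [T k] is what the first [k] sets leave uncovered. It decreases to the empty set, so for some
     [N] it has small measure and only finitely many [F i] have to be translated. *)
  pose T k := (\bigcup_i F i `&` K) `\` \bigcup_(i < k) (F i).
  have mT k : measurable (T k).
    apply: measurableD; last by apply: bigcup_measurable.
    by apply: measurableI => //; exact: bigcup_measurable.
  have T0 : mu (T k) @[k --> \oo] --> 0.
    rewrite -(measure0 mu) (_ : set0 = \bigcap_k T k); last first.
      apply/esym/seteqP; split=> // p Tp.
      have [[[i _ Fip] _] _] := Tp 0%N I.
      by have [_ []] := Tp i.+1 I; exists i => //=.
    apply: nonincreasing_cvg_mu => //.
    - apply: le_lt_trans Kfin.
      by apply: le_measure; rewrite ?inE// => p [[]].
    - exact: bigcapT_measurable.
    - move=> i j ij; apply/subsetPset => p [? nF]; split=> // -[k /= ki Fk].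
      by apply: nF; exists k => //=; exact: leq_trans ki ij.
  have [N TN] : exists N, mu (T N) <= (e / 2)%:E.
    move/fine_cvgP: T0 => [Tfin /cvgr0Pnorm_le/(_ _ e20)] h.
    near \oo => N; exists N; have TfinN : mu (T N) \is a fin_num by near: N.
    rewrite -(fineK TfinN) lee_fin; apply: (le_trans (ler_norm _)).
    by near: N.
  have mFK i := measurableI _ _ (mF i) mK.
  have : \forall q \near (0%R : H), \sum_(i < N) mu (out (F i `&` K) q) <= (e / 2)%:E.
    clear -sF e20; move: (e / 2)%R e20 => {}e e0.
    elim: N e e0 => [|N IH] e e0.
      by near=> q; rewrite big_ord0 lee_fin ltW.
    have e20 : (0 < e / 2)%R by rewrite divr_gt0.
    near=> q; rewrite big_ord_recr/= (splitr e) EFinD leeD//.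
      by near: q; exact: IH.
    by near: q; exact: sF.
  apply: filterS => q qN; rewrite (splitr e) EFinD.
  apply: le_trans (leeD qN TN).
  apply: (@le_trans _ _ (mu (\big[setU/set0]_(i < N) out (F i `&` K) q `|` T N))).
    apply: le_measure; rewrite ?inE.
    - by apply: mout; apply: measurableI => //; exact: bigcup_measurable.
    - apply: measurableU => //; apply: bigsetU_measurable => i _; exact: mout.
    - move=> p [[[i _ Fip] Kp] npq]; have [iN|Ni] := ltnP i N.
        left; rewrite -(bigcup_mkord N (fun i => out (F i `&` K) q)).
        exists i => //; split=> // -[Fpq Kpq].
        by apply: npq; split=> //; exists i.
      have [[j /= jN Fjp]|nj] := pselect (exists2 j, (j < N)%N & F j p).
        left; rewrite -(bigcup_mkord N (fun i => out (F i `&` K) q)).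
        exists j => //; split=> // -[Fpq Kpq].
        by apply: npq; split=> //; exists j.
      right; split; first by split=> //; exists i.
      by move=> [j /= jN Fjp]; apply: nj; exists j.
  apply: le_trans (measureU2 _ _ _) _ => //.
    by apply: bigsetU_measurable => i _; exact: mout.
  rewrite leeD2r//.
  apply: (@Boole_inequality _ _ _ mu (fun i => out (F i `&` K) q)) => i _.
  exact: mout.
Unshelve. all: by end_near. Qed.

Variable s : R.
Hypothesis s1 : (1 <= s)%R.
Let s0 : (0 < s)%R. Proof. exact: lt_le_trans s1. Qed.

Local Notation LN g := ('N[mu]_(s%:E)[EFin \o g]).

Lemma LnormE (g : H -> R) : LN g = (\int[mu]_p (`|g p| `^ s)%:E) `^ s^-1.
Proof. by rewrite unlock. Qed.

Lemma measurable_norm_powR (g : H -> R) : measurable_fun setT g ->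
  measurable_fun setT (fun p : H => (`|g p| `^ s)%:E).
Proof.
move=> mg; apply/measurable_EFinP; apply: (measurableT_comp (measurable_powR _)).
exact: measurableT_comp.
Qed.

Lemma Lnorm_le_powR (g : H -> R) (e : R) : (0 <= e)%R ->
  (LN g <= e%:E) = (\int[mu]_p (`|g p| `^ s)%:E <= (e `^ s)%:E).
Proof.
move=> e0; have i0 : 0 <= \int[mu]_p (`|g p| `^ s)%:E.
  by apply: integral_ge0 => p _; rewrite lee_fin powR_ge0.
rewrite LnormE.
apply/idP/idP => h.
  have := gt0_ler_poweR (ltW s0) _ _ h.
  rewrite -poweRrM mulVf ?gt_eqF// poweRe1// poweR_EFin; apply;
    by rewrite in_itv/= leey ?lee_fin ?e0 ?poweR_ge0.
have := @gt0_ler_poweR _ s^-1 _ _ _ _ _ h.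
rewrite poweR_EFin -powRrM mulfV ?gt_eqF// powRr1//; apply.
- by rewrite invr_ge0 ltW.
- by rewrite in_itv/= leey i0.
- by rewrite in_itv/= leey lee_fin powR_ge0.
Qed.

Lemma Lnorm_mulr (g : H -> R) q : measurable_fun setT g ->
  LN (fun p => g (heis_mul p q)) = LN g.
Proof.
move=> mg; rewrite !LnormE.
rewrite (ge0_integral_mulr q (F := fun p => (`|g p| `^ s)%:E))//.
exact: measurable_norm_powR.
Qed.

Lemma Lnorm_scale (g : H -> R) (c : R) : measurable_fun setT g ->
  LN (fun p => c * g p)%R = `|c|%:E * LN g.
Proof.
move=> mg; rewrite !LnormE.
under eq_integral do rewrite normrM powRM// EFinM.
rewrite ge0_integralZl//; last exact: measurable_norm_powR.
rewrite poweRM ?lee_fin ?powR_ge0//; last first.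
  by apply: integral_ge0 => p _; rewrite lee_fin powR_ge0.
by rewrite poweR_EFin -powRrM mulfV ?gt_eqF// powRr1.
Qed.

Lemma ge0_Lnorm_le (g1 g2 : H -> R) :
  measurable_fun setT g1 -> measurable_fun setT g2 ->
  (forall p, `|g1 p| <= `|g2 p|)%R -> LN g1 <= LN g2.
Proof.
move=> m1 m2 g12; rewrite !LnormE; apply: gt0_ler_poweR.
- by rewrite invr_ge0 ltW.
- by rewrite in_itv/= leey integral_ge0// => p _; rewrite lee_fin powR_ge0.
- by rewrite in_itv/= leey integral_ge0// => p _; rewrite lee_fin powR_ge0.
apply: ge0_le_integral => //.
- exact: measurable_norm_powR.
- exact: measurable_norm_powR.
- by move=> p _; rewrite lee_fin ge0_ler_powR// ?nnegrE// ltW.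
Qed.

Definition translation_continuous (g : H -> R) := forall e : R, (0 < e)%R ->
  \forall q \near (0%R : H), LN (fun p => g (heis_mul p q) - g p)%R <= e%:E.

Local Notation trc := translation_continuous.

(** The two indicators differ on the symmetric difference, whose measure is twice that of [out E q];
    hence the tolerance, half of [e] to the power [s]. *)
Let trc_indic D a b : measurable D -> trc (\1_(D `&` box a b)).
Proof.
move=> mD e e0; set E := D `&` box a b.
have mE : measurable E by apply: measurableI => //; exact: measurable_box.
have Efin : mu E < +oo.
  apply: le_lt_trans (lebesgue_row_cbox_lty a b).
  apply: le_measure; rewrite ?inE//; first exact: measurable_cbox.
  by apply: subset_trans (@box_cbox _ _ _ _) => p [].
have e20 : (0 < (e `^ s) / 2)%R by rewrite divr_gt0// powR_gt0.
apply: filterS (small_meas a b mD e20) => q qe.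
have mEq := measurable_mulr_preimage q mE.
rewrite Lnorm_le_powR; last exact: ltW.
rewrite (eq_integral (fun p => (\1_(out E q) p)%:E +
    (\1_(((fun p => heis_mul p q) @^-1` E) `\` E) p)%:E)); last first.
  move=> p _; rewrite !indicE.
  have -> : (p \in out E q) = (p \in E) && (heis_mul p q \notin E).
    apply/idP/andP => [/set_mem[Ep nE]|[/set_mem Ep /negP nE]].
      by split; [exact: mem_set|apply/negP => /set_mem].
    by apply/mem_set; split => // Epq; apply: nE; exact: mem_set.
  have -> : (p \in ((fun p => heis_mul p q) @^-1` E) `\` E) =
      (heis_mul p q \in E) && (p \notin E).
    apply/idP/andP => [/set_mem[Ep nE]|[/set_mem Ep /negP nE]].
      by split; [exact: mem_set|apply/negP => /set_mem].
    by apply/mem_set; split => // Epq; apply: nE; exact: mem_set.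
  case: (p \in E); case: (heis_mul p q \in E) => /=;
    rewrite ?subrr ?subr0 ?sub0r ?normrN ?normr0 ?normr1 ?powR0 ?powR1 ?adde0 ?add0e//;
    by rewrite gt_eqF.
rewrite ge0_integralD//.
- rewrite !integral_indic ?setIT//; [|exact: measurableD|exact: mout].
  apply: (@le_trans _ _ (mu (out E q) + mu (out E q))); last first.
    by rewrite [in leRHS](splitr (e `^ s)) EFinD leeD.
  apply: leeD => //; rewrite le_eqVlt; apply/orP; left; apply/eqP.
  exact: out_sym.
- by apply/measurable_EFinP; apply: measurable_indic; exact: mout.
- by apply/measurable_EFinP; apply: measurable_indic; exact: measurableD.
Qed.

Let trcD (g1 g2 : H -> R) : measurable_fun setT g1 -> measurable_fun setT g2 ->
  trc g1 -> trc g2 -> trc (fun p => g1 p + g2 p)%R.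
Proof.
move=> m1 m2 t1 t2 e e0; have e20 : (0 < e / 2)%R by rewrite divr_gt0.
have msub (g : H -> R) q : measurable_fun setT g ->
    measurable_fun setT (fun p : H => g (heis_mul p q) - g p)%R.
  by move=> mg; apply: measurable_funB => //; exact: measurableT_comp (measurable_mulr q).
near=> q.
have -> : (fun p => g1 (heis_mul p q) + g2 (heis_mul p q) - (g1 p + g2 p))%R =
    ((fun p => g1 (heis_mul p q) - g1 p) \+ (fun p => g2 (heis_mul p q) - g2 p))%R.
  by apply/funext => p /=; ring.
apply: le_trans (minkowski_EFin _ (msub _ _ m1) (msub _ _ m2) s1) _.
rewrite (splitr e) EFinD leeD//.
  by near: q; exact: t1.
by near: q; exact: t2.
Unshelve. all: by end_near. Qed.

Let trcZ (g : H -> R) (c : R) : measurable_fun setT g -> trc g -> trc (fun p => c * g p)%R.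
Proof.
move=> mg tg e e0.
have c0 : (0 < e / (`|c| + 1))%R by rewrite divr_gt0// ltr_wpDl.
apply: filterS (tg _ c0) => q qe.
have -> : (fun p => c * g (heis_mul p q) - c * g p)%R =
    (fun p => c * (g (heis_mul p q) - g p))%R.
  by apply/funext => p /=; ring.
rewrite Lnorm_scale; last first.
  by apply: measurable_funB => //; exact: measurableT_comp (measurable_mulr q).
apply: le_trans (lee_wpmul2l _ qe) _; first by rewrite lee_fin.
by rewrite -EFinM lee_fin mulrCA ler_piMr ?(ltW e0)// ler_pdivrMr ?ltr_wpDl// mul1r lerDl.
Qed.

(** Three-epsilon argument: right translation preserves the norm, so [g] and its approximation [h]
    stay equally close when both are translated. *)
Let trc_lim (g : H -> R) : measurable_fun setT g ->
  (forall e : R, (0 < e)%R -> exists h : H -> R, [/\ measurable_fun setT h,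
     trc h & LN (fun p => g p - h p)%R <= e%:E]) -> trc g.
Proof.
move=> mg happ e e0; have e30 : (0 < e / 3)%R by rewrite divr_gt0.
have [h [mh th gh]] := happ _ e30.
have mgh : measurable_fun setT (fun p : H => g p - h p)%R by exact: measurable_funB.
have mr (f : H -> R) q : measurable_fun setT f ->
    measurable_fun setT (fun p : H => f (heis_mul p q)).
  by move=> mf; exact: measurableT_comp (measurable_mulr q).
apply: filterS (th _ e30) => q qe.
have -> : (fun p => g (heis_mul p q) - g p)%R =
  ((fun p => g (heis_mul p q) - h (heis_mul p q)) \+
   ((fun p => h (heis_mul p q) - h p) \+ (fun p => (-1) * (g p - h p))))%R.
  by apply/funext => p /=; ring.
have -> : e = (e / 3 + (e / 3 + e / 3))%R by field.
rewrite !EFinD.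
apply: le_trans (minkowski_EFin _ (mr _ _ mgh) _ s1) _.
  apply: measurable_funD; last exact: measurable_funM.
  by apply: measurable_funB => //; exact: mr.
apply: leeD; first by rewrite (Lnorm_mulr q mgh).
apply: le_trans (minkowski_EFin _ _ _ s1) _.
- by apply: measurable_funB => //; exact: mr.
- exact: measurable_funM.
by rewrite leeD// Lnorm_scale// normrN1 mul1e.
Qed.

(** Simple functions increasing to [g], cut off to growing cubes, converge to [g] in the norm by
    dominated convergence, and they are finite combinations of indicators of sets inside a box. *)
Let trc_ge0 (g : H -> R) : (forall p, 0 <= g p)%R -> measurable_fun setT g ->
  LN g < +oo -> trc g.
Proof.
move=> g0 mg gfin; apply: trc_lim => // e e0.
have mEg : measurable_fun setT (EFin \o g) by exact/measurable_EFinP.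
pose f_ := nnsfun_approx measurableT mEg.
pose c (k : nat) : 'rV[R]_(n + n + 1) := const_mx k%:R.
pose h k p := (f_ k p * \1_(box (- c k) (c k)) p)%R.
have mh k : measurable_fun setT (h k).
  apply: measurable_funM => //; apply: measurable_indic; exact: measurable_box.
have f_cvg p : f_ k p @[k --> \oo] --> g p.
  have /fine_cvgP[_] := @cvg_nnsfun_approx _ _ _ _ measurableT _ mEg
    (fun x _ => g0 x : 0 <= (g x)%:E) p I.
  exact.
have f_le k p : (f_ k p <= g p)%R.
  rewrite -(cvg_lim _ (f_cvg p))//; apply: nondecreasing_cvgn_le.
    by move=> i j ij; exact/lefP/nd_nnsfun_approx.
  by apply/cvg_ex; exists (g p); exact: f_cvg.
have h0 k p : (0 <= h k p)%R by rewrite mulr_ge0.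
have h_le k p : (h k p <= g p)%R.
  by rewrite (le_trans _ (f_le k p))// ler_piMr// indicE; case: (_ \in _).
have th k : trc (h k).
  have [t [N fE]] : exists (t : seq R) (N : nat), forall p,
      f_ k p = (\sum_(i < N) (t`_i * \1_(f_ k @^-1` [set t`_i]) p))%R.
    by do 2 eexists; exact: fimfunEord.
  have -> : h k = (fun p => \sum_(i < N)
      (t`_i * \1_(f_ k @^-1` [set t`_i] `&` box (- c k) (c k)) p))%R.
    apply/funext => p; rewrite /h fE mulr_suml.
    by apply: eq_bigr => i _; rewrite -mulrA indicI.
  clear fE.
  elim: N => [|N IH].
    move=> d d0; near=> q; under eq_fun do rewrite !big_ord0 subrr.
    by rewrite Lnorm0 ?lee_fin ?ltW// eqe gt_eqF.
  under eq_fun do rewrite big_ord_recr/=.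
  have mt i : measurable (f_ k @^-1` [set t`_i]).
    by rewrite -[X in measurable X]setTI; exact: measurable_funP.
  apply: trcD => //.
  - apply: measurable_sum => i; apply: measurable_funM => //.
    by apply: measurable_indic; apply: measurableI => //; exact: measurable_box.
  - apply: measurable_funM => //.
    by apply: measurable_indic; apply: measurableI => //; exact: measurable_box.
  - apply: trcZ; last exact: trc_indic.
    by apply: measurable_indic; apply: measurableI => //; exact: measurable_box.
have gint : mu.-integrable setT (fun p => (`|g p| `^ s)%:E).
  apply: Lfun_integrable => //; rewrite inE; apply/andP; split; rewrite inE//.
have : \int[mu]_p (`|g p - h k p| `^ s)%:E @[k --> \oo] -->
       \int[mu]_p (cst 0 p : \bar R).
  apply: (@dominated_cvg _ _ _ mu setT measurableT _ _ (fun p => (`|g p| `^ s)%:E)) => //.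
  - move=> k; apply/measurable_EFinP; apply: (measurableT_comp (measurable_powR _)).
    by apply: measurableT_comp => //; exact: measurable_funB.
  - move=> p _; apply/fine_cvgP; split; first exact: nearW.
    apply/cvgr0Pnorm_le => d d0.
    have ds0 : (0 < d `^ s^-1)%R by rewrite powR_gt0.
    have /cvgrPdist_le/(_ _ ds0) fd := f_cvg p.
    near=> k; rewrite /= ger0_norm ?powR_ge0//.
    (* Once [k] exceeds the sup norm of [p], the cut-off is 1 at [p]. *)
    have -> : h k p = f_ k p.
      have pk : (`|p| < k%:R)%R by near: k; exact: nbhs_infty_gtr.
      rewrite /h indicE mem_set ?mulr1// => i; rewrite !mxE -ltr_norml.
      exact: le_lt_trans (norm_coord_le _ _) pk.
    rewrite [leRHS](_ : d = (d `^ s^-1) `^ s)%R; last first.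
      by rewrite -powRrM mulVf ?gt_eqF// powRr1// ltW.
    rewrite ge0_ler_powR ?nnegrE// ?(ltW s0)// ?(ltW ds0)//.
    by near: k; exact: fd.
  - move=> k p _; rewrite /= lee_fin ger0_norm ?powR_ge0// ge0_ler_powR ?nnegrE//.
      exact: ltW.
    by rewrite !ger0_norm ?subr_ge0// gerDl oppr_le0.
rewrite integral0 => /fine_cvgP[hfin /cvgr0Pnorm_le/(_ _ (powR_gt0 s e0)) he].
near \oo => k; exists (h k); split => //.
rewrite Lnorm_le_powR; last exact: ltW.
have fk : \int[mu]_p (`|g p - h k p| `^ s)%:E \is a fin_num by near: k.
rewrite -(fineK fk) lee_fin (le_trans (ler_norm _))//.
by near: k.
Unshelve. all: by end_near. Qed.

Lemma Lfun_translation_continuous (g : H -> R) :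
  g \in Lfun mu s%:E -> translation_continuous g.
Proof.
move=> gL; have mg : measurable_fun setT g.
  by have := sub_Lfun_mfun gL; rewrite inE.
have gfin : LN g < +oo by have := sub_Lfun_finLfun gL; rewrite inE.
pose gp p := Num.max (g p) 0%R; pose gn p := Num.max (- g p)%R 0%R.
have mgp : measurable_fun setT gp by exact: measurable_maxr.
have mgn : measurable_fun setT gn.
  by apply: measurable_maxr => //; exact: measurable_funN.
have -> : g = (fun p => gp p + -1 * gn p)%R.
  apply/funext => p; rewrite /gp /gn !maxEle oppr_le0.
  by have [g0|g0] := leP (g p) 0%R; case: ifP; lra.
apply: trcD => //; first exact: measurable_funM.
  apply: trc_ge0 => // [p|]; first by rewrite /gp le_max lexx orbT.
  apply: le_lt_trans gfin; apply: ge0_Lnorm_le => // p.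
  by rewrite /gp maxEle; case: ifP; rewrite ?normr0.
apply: trcZ => //; apply: trc_ge0 => // [p|]; first by rewrite /gn le_max lexx orbT.
apply: le_lt_trans gfin; apply: ge0_Lnorm_le => // p.
by rewrite /gn maxEle; case: ifP; rewrite ?normr0 ?normrN.
Qed.

End translation_continuity.

(** * Smooth bump functions *)

Section theta.
Context {R : realType}.

(* The derivatives of exp (- 1 / x) extended by 0 to x <= 0 are linear
   combinations of these functions. *)
Definition theta (k : nat) (x : R) : R :=
  if 0 < x then (x^-1) ^+ k * expR (- x^-1) else 0.

Lemma theta_ge0 k x : 0 <= theta k x.
Proof.
rewrite /theta; case: ifPn => // x0.
by rewrite mulr_ge0 ?expR_ge0// exprn_ge0// invr_ge0 ltW.
Qed.

Lemma theta0_le1 x : theta 0 x <= 1.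
Proof.
rewrite /theta; case: ifPn => // x0.
by rewrite expr0 mul1r -expR0 ler_expR oppr_le0 invr_ge0 ltW.
Qed.

(** With [z = y / (k+1)], this is [z <= exp z] raised to the power [k+1]. *)
Lemma exprn_expRN_le (y : R) k : 0 <= y ->
  y ^+ k.+1 * expR (- y) <= k.+1%:R ^+ k.+1.
Proof.
move=> y0; rewrite expRN ler_pdivrMr ?expR_gt0//.
have -> : y = k.+1%:R * (y / k.+1%:R) by rewrite mulrC divfK.
set z := y / _; have z0 : 0 <= z by rewrite divr_ge0.
rewrite exprMn ler_wpM2l ?exprn_ge0// mulrC expRM_natr.
rewrite lerXn2r ?nnegrE ?expR_ge0// (le_trans _ (expR_ge1Dx _))//.
by rewrite lerDr.
Qed.

(** The preceding bound at [y = 1/x]; this linear control is what differentiability at 0 rests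
    on. *)
Lemma theta_le k x : 0 <= x -> theta k x <= k.+1%:R ^+ k.+1 * x.
Proof.
rewrite /theta; case: ifPn => [x0 _|_ x0]; last by rewrite mulr_ge0// exprn_ge0.
rewrite -ler_pdivrMr//; apply: le_trans (exprn_expRN_le k _).
  by rewrite mulrAC -exprSr.
by rewrite invr_ge0 ltW.
Qed.

Global Instance is_derive_theta k (x : R) : is_derive x 1 (theta k)
  (theta k.+2 x - k%:R * theta k.+1 x).
Proof.
case: (ltgtP 0 x) => [x0|x0|<-].
- have x0' : x != 0 by rewrite gt_eqF.
  pose g (y : R) := y^-1.
  have dg : is_derive x 1 g (- x ^- 2 *: 1).
    exact: (is_deriveV (f := id)).
  pose f := g ^+ k * (expR \o (- g)).
  have df : is_derive x 1 f (theta k.+2 x - k%:R * theta k.+1 x).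
    apply: is_derive_eq (is_deriveM (is_deriveX k dg)
      (is_derive1_comp (is_derive_expR _) (is_deriveN dg))) _.
    rewrite /theta x0 /g /= !scaler1 -exprVn -[(_ ^+ k) x]/((g ^+ k) x).
    have -> : (g ^+ k) x = x^-1 ^+ k by rewrite fctE.
    set y := x^-1; set e := expR _; rewrite /GRing.scale/= opprK.
    clear f dg; clearbody y e.
    by case: k => [|k]; rewrite ?mul0r ?expr0 ?exprS/=; ring.
  apply: near_eq_is_derive df.
  near=> y; have y0 : 0 < y by near: y; exact: lt_nbhsr.
  rewrite /theta y0 /f fctE /=; congr (_ * _).
  by rewrite fctE.
- have -> : theta k.+2 x - k%:R * theta k.+1 x = 0.
    by rewrite /theta ltNge (ltW x0)/= mulr0 subr0.
  apply: (near_eq_is_derive _ (is_derive_cst (0 : R) x 1)).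
  near=> y; have y0 : y < 0 by near: y; exact: lt_nbhsl.
  by rewrite /theta ltNge (ltW y0).
- have -> : theta k.+2 0 - k%:R * theta k.+1 0 = 0.
    by rewrite /theta ltxx mulr0 subr0.
  have c0 : h^-1 *: ((theta k \o shift 0) (h *: 1) - theta k 0)
      @[h --> (0 : R)^'] --> (0 : R).
    apply/cvgr0Pnorm_le => e e0.
    pose C : R := k.+2%:R ^+ k.+2.
    have C0 : 0 < C by rewrite exprn_gt0.
    near=> h; rewrite /= addr0 [h *: 1]mulr1 [X in _ - X](_ : _ = 0) ?subr0; last first.
      by rewrite /theta ltxx.
    have [h0|h0] := leP h 0.
      by rewrite /theta ltNge h0/= scaler0 normr0 ltW.
    (* The difference quotient at 0 is again a function of the family, and the linear bound sends it
       to 0. *)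
    have -> : h^-1 *: theta k h = theta k.+1 h.
      by rewrite /theta h0 exprS -mulrA.
    rewrite ger0_norm ?theta_ge0// (le_trans (theta_le _ (ltW h0)))//.
    rewrite mulrC -ler_pdivlMr// (le_trans (ler_norm _))//.
    near: h; apply: dnbhs0_le; exact: divr_gt0.
  by apply: DeriveDef; [apply/cvg_ex; exists 0|exact: cvg_lim c0].
Unshelve. all: by end_near. Qed.

Lemma continuous_theta k : continuous (theta k).
Proof.
move=> x; apply: differentiable_continuous; apply/derivable1_diffP.
by have Dx := is_derive_theta k x; apply: ex_derive.
Qed.

Lemma theta0_cvg1 (y : R) : 0 < y -> theta 0 (y / k.+1%:R^-1) @[k --> \oo] --> (1 : R).
Proof.
move=> y0.
have -> : (fun k => theta 0 (y / k.+1%:R^-1)) = (fun k => expR (- (y^-1 * k.+1%:R^-1))).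
  apply/funext => k; rewrite /theta divr_gt0 ?invr_gt0// expr0 mul1r.
  by rewrite invfM invrK.
rewrite [X in _ --> X](_ : 1 = expR (- (y^-1 * 0))); last by rewrite mulr0 oppr0 expR0.
apply: continuous_cvg; first exact: continuous_expR.
apply: cvgN; apply: cvgM; first exact: cvg_cst.
exact: cvg_harmonic.
Qed.

End theta.

(** * Smooth test functions supported in boxes *)

Section smooth_functions.
Context {R : realType} {m : nat}.
Local Notation V := 'rV[R]_m.
Implicit Types (f g : V -> R) (p v : V).

(* A class of functions which is stable under partial derivatives, hence made
   of smooth functions, and rich enough to contain bumps supported in boxes. *)
Inductive smooth : (V -> R) -> Prop :=
| smooth_cst c : smooth (fun=> c)
| smooth_theta k c (a : 'cV[R]_m) :
    smooth (fun p => theta k (c + (p *m a) ord0 ord0))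
| smoothD f g : smooth f -> smooth g -> smooth (fun p => f p + g p)
| smoothM f g : smooth f -> smooth g -> smooth (fun p => f p * g p).

Lemma continuous_affine (c : R) (a : 'cV[R]_m) :
  continuous (fun p => c + (p *m a) ord0 ord0).
Proof.
have -> : (fun p => c + (p *m a) ord0 ord0) =
    (fun p => c + \sum_i p ord0 i * a i ord0) by apply/funext => p; rewrite mxE.
have cS : continuous (fun p : V => \sum_i p ord0 i * a i ord0).
  apply: continuous_sum_fun => i p.
  exact: (continuousM (@continuous_coord R m i p)
    (fun A => @cst_continuous V R (a i ord0) p A)).
move=> p.
exact: (continuousD (fun A => @cst_continuous V R c p A) (cS p)).
Qed.

Lemma smooth_continuous f : smooth f -> continuous f.
Proof.
elim=> {f} [c p|k c a p|f g _ cf _ cg p|f g _ cf _ cg p].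
- by move=> A; exact: (@cst_continuous V R c p A).
- by move=> A /(@continuous_theta R k (c + (p *m a) ord0 ord0))/(@continuous_affine c a p).
- exact: (continuousD (cf p) (cg p)).
- exact: (continuousM (cf p) (cg p)).
Qed.

Lemma is_derive_theta_affine k c (a : 'cV[R]_m) p v :
  is_derive p v (fun p => theta k (c + (p *m a) ord0 ord0))
    (\sum_i v ord0 i * (a i ord0 *
       (theta k.+2 (c + (p *m a) ord0 ord0) -
        k%:R * theta k.+1 (c + (p *m a) ord0 ord0)))).
Proof.
set l := c + _; set D := theta k.+2 l - _.
pose b := (v *m a) ord0 ord0.
have -> : \sum_i v ord0 i * (a i ord0 * D) = b *: D.
  rewrite /b mxE [RHS]mulr_suml; apply: eq_bigr => i _; exact: mulrA.
have dl : differentiable (theta k) l.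
  by have Dl := is_derive_theta k l; apply/derivable1_diffP; apply: ex_derive.
have E : (fun h : R => h^-1 *: (((fun p => theta k (c + (p *m a) ord0 ord0))
      \o shift p) (h *: v) - theta k l)) =
    (fun h : R => h^-1 *: ((theta k \o shift l) (h *: b) - theta k l)).
  apply/funext => h; congr (_ *: (theta k _ - _)).
  have -> : (shift p (h *: v) *m a) ord0 ord0 = h * b + (p *m a) ord0 ord0.
    by rewrite /shift mulmxDl -scalemxAl [LHS]mxE; congr (_ + _); rewrite [LHS]mxE.
  by rewrite addrCA.
have Db : derivable (theta k) l b by exact: diff_derivable.
split; first by rewrite /derivable E.
rewrite /derive E -/(derive (theta k) l b) (deriveE b dl) -{1}(mulr1 b).
rewrite -[b * 1]/(b *: (1 : R)) linearZ/= -deriveE//.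
by congr (_ *: _); have Dl := is_derive_theta k l; exact: derive_val.
Qed.

(** All directions are treated at once, not only the axes: the fields along which test functions are
    differentiated vary with the point, so linearity in the direction is needed. *)
Lemma smooth_grad f : smooth f -> exists df : 'I_m -> V -> R,
  (forall i, smooth (df i)) /\
  forall p v, is_derive p v f (\sum_i v ord0 i * df i p).
Proof.
elim=> {f} [c|k c a|f g sf [df [sdf Df]] sg [dg [sdg Dg]]|
            f g sf [df [sdf Df]] sg [dg [sdg Dg]]].
- exists (fun _ _ => 0); split=> [i|p v]; first exact: smooth_cst.
  rewrite big1 => [|i _]; last by rewrite mulr0.
  exact: is_derive_cst.
- exists (fun i p => a i ord0 * (theta k.+2 (c + (p *m a) ord0 ord0) +
      - k%:R * theta k.+1 (c + (p *m a) ord0 ord0))); split=> [i|p v].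
    apply: smoothM (smooth_cst _) _; apply: smoothD (smooth_theta _ _ _) _.
    exact: smoothM (smooth_cst _) (smooth_theta _ _ _).
  under eq_bigr do rewrite mulNr.
  exact: is_derive_theta_affine.
- exists (fun i p => df i p + dg i p); split=> [i|p v]; first exact: smoothD.
  apply: is_derive_eq (is_deriveD (Df p v) (Dg p v)) _.
  by rewrite -big_split/=; apply: eq_bigr => i _; rewrite mulrDr.
- exists (fun i p => f p * dg i p + g p * df i p); split=> [i|p v].
    by apply: smoothD; exact: smoothM.
  apply: is_derive_eq (is_deriveM (Df p v) (Dg p v)) _.
  rewrite /GRing.scale/= !mulr_sumr -big_split/=; apply: eq_bigr => i _.
  by rewrite mulrDr; congr (_ + _); rewrite mulrCA.
Qed.

End smooth_functions.

Section smooth_theory.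
Context {R : realType} {m : nat}.
Local Notation V := 'rV[R]_m.
Implicit Types (f g : V -> R) (p v : V).

Lemma smooth_derivable f p v : smooth f -> derivable f p v.
Proof. by move=> /smooth_grad[df [_ Df]]; have Dp := Df p v; apply: ex_derive. Qed.

Lemma smooth_derive f v : smooth f -> smooth ('D_v f).
Proof.
move=> /smooth_grad[df [sdf Df]].
have -> : 'D_v f = (fun p => \sum_i v ord0 i * df i p).
  by apply/funext => p; exact: derive_val.
elim: (index_enum _) => [|i t IH].
  by under eq_fun do rewrite big_nil; exact: smooth_cst.
under eq_fun do rewrite big_cons.
by apply: smoothD => //; apply: smoothM => //; exact: smooth_cst.
Qed.

Lemma smooth_deriveD f p v (I : Type) (t : seq I) (c : I -> R) (w : I -> V) :
  smooth f -> 'D_(\sum_(i <- t) c i *: w i) f p = \sum_(i <- t) c i * 'D_(w i) f p.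
Proof.
move=> /smooth_grad[df [_ Df]].
have E u : 'D_u f p = \sum_j u ord0 j * df j p by exact: derive_val.
rewrite E (eq_bigr (fun i => \sum_j c i * (w i ord0 j * df j p))); last first.
  by move=> i _; rewrite E mulr_sumr.
rewrite exchange_big/=; apply: eq_bigr => j _.
rewrite summxE mulr_suml; apply: eq_bigr => i _; by rewrite mxE mulrA.
Qed.

Lemma continuous_measurable_row f : continuous f -> measurable_fun setT f.
Proof.
move=> cf; apply: (measurability _ (RGenOpens.measurableE R)).
move=> _ [_ [a [b ->]] <-]; rewrite setTI; apply: open_measurable_row.
by apply: open_comp => [p _|]; [exact: cf|exact: interval_open].
Qed.

(** An affine substitution turns a generator into a generator with another [c] and [a]; right
    translations of the group are of this form. *)
Lemma smooth_affine f (q : V) (N : 'M[R]_m) :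
  smooth f -> smooth (fun p => f (p + q + p *m N)).
Proof.
elim=> {f} [c|k c a|f g _ sf _ sg|f g _ sf _ sg].
- exact: smooth_cst.
- have -> : (fun p => theta k (c + ((p + q + p *m N) *m a) ord0 ord0)) =
    (fun p => theta k ((c + (q *m a) ord0 ord0) + (p *m (a + N *m a)) ord0 ord0)).
    apply/funext => p; rewrite !mulmxDl mulmxDr mulmxA; congr (theta k _).
    rewrite [X in c + X]mxE [X in c + (X + _)]mxE [X in _ = _ + X]mxE; ring.
  exact: smooth_theta.
- exact: smoothD.
- exact: smoothM.
Qed.

(** One factor for each face of the box: for every [e > 0] the product vanishes outside the open
    box, and it tends to the indicator of the box as [e] tends to 0. *)
Definition bump (a b : V) (e : R) (p : V) : R :=
  \prod_i (theta 0 ((p ord0 i - a ord0 i) / e) *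
            theta 0 ((b ord0 i - p ord0 i) / e)).

Lemma smooth_bump a b e : smooth (bump a b e).
Proof.
rewrite /bump; elim: (index_enum _) => [|i t IH].
  by under eq_fun do rewrite big_nil; exact: smooth_cst.
under eq_fun do rewrite big_cons.
apply: smoothM => //; apply: smoothM.
- have -> : (fun p : V => theta 0 ((p ord0 i - a ord0 i) / e)) =
    (fun p : V => theta 0 (- (a ord0 i / e) +
       (p *m (e^-1 *: (delta_mx i ord0 : 'cV[R]_m))) ord0 ord0)).
    apply/funext => p; congr (theta 0 _); rewrite -scalemxAr mxE -colE mxE; ring.
  exact: smooth_theta.
- have -> : (fun p : V => theta 0 ((b ord0 i - p ord0 i) / e)) =
    (fun p : V => theta 0 ((b ord0 i / e) +
       (p *m (- e^-1 *: (delta_mx i ord0 : 'cV[R]_m))) ord0 ord0)).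
    apply/funext => p; congr (theta 0 _); rewrite -scalemxAr mxE -colE mxE; ring.
  exact: smooth_theta.
Qed.

Lemma bump_ge0 a b e p : 0 <= bump a b e p.
Proof. by apply: prodr_ge0 => i _; rewrite mulr_ge0 ?theta_ge0. Qed.

Lemma bump_le1 a b e p : bump a b e p <= 1.
Proof.
apply: prodr_ile1 => i _; rewrite mulr_ge0 ?theta_ge0//=.
by rewrite mulr_ile1 ?theta_ge0 ?theta0_le1.
Qed.

Lemma bump_out a b e p : 0 < e -> ~ box a b p -> bump a b e p = 0.
Proof.
move=> e0 /existsNP[i]; rewrite /bump (bigD1 i)//= => /negP.
rewrite negb_and -!leNgt => h; rewrite (_ : _ * theta _ _ = 0) ?mul0r//.
apply/eqP; rewrite mulf_eq0; case/orP: h => h; apply/orP; [left|right].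
  by rewrite /theta ifF//; apply/negbTE; rewrite -leNgt pmulr_lle0 ?invr_gt0// subr_le0.
by rewrite /theta ifF//; apply/negbTE; rewrite -leNgt pmulr_lle0 ?invr_gt0// subr_le0.
Qed.

Lemma bump_cvg a b p :
  bump a b k.+1%:R^-1 p @[k --> \oo] --> (\1_(box a b) p : R).
Proof.
have [pab|npab] := pselect (box a b p); last first.
  rewrite indicE memNset//; apply: cvg_near_cst; apply: nearW => k.
  by apply: bump_out => //; rewrite invr_gt0.
suff : bump a b k.+1%:R^-1 p @[k --> \oo] --> (1 : R) by rewrite indicE mem_set.
rewrite /bump; have pi i : theta 0 ((p ord0 i - a ord0 i) / k.+1%:R^-1) *
   theta 0 ((b ord0 i - p ord0 i) / k.+1%:R^-1) @[k --> \oo] --> (1 * 1 : R).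
  have /andP[pa pb] := pab i.
  by apply: cvgM; apply: theta0_cvg1; rewrite subr_gt0.
elim: (index_enum _) => [|i t IH].
  by under eq_fun do rewrite big_nil; exact: cvg_cst.
under eq_fun do rewrite big_cons.
have H := cvgM (pi i) IH; rewrite !mulr1 in H; exact: H.
Qed.

End smooth_theory.

Section heisenberg_test_functions.
Context {R : realType} {n : nat}.
Local Notation H := (heis R n).

Lemma smooth_Ck k (f : H -> R) : smooth f -> Ck k f.
Proof.
elim: k f => [|k IH] f sf; split => //; try exact: smooth_continuous.
move=> i; split=> [p|]; first exact: smooth_derivable.
by apply: IH; exact: smooth_derive.
Qed.

Lemma smooth_mulr (f : H -> R) q : smooth f -> smooth (fun p => f (heis_mul p q)).
Proof.
move=> sf; under eq_fun do rewrite heis_mul_shear.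
exact: smooth_affine.
Qed.

(** The support lies in the translate of the closed box by [- q], the group inverse of [q], which is
    compact as a continuous image. *)
Lemma test_function_bump (Omega : set H) (a b : H) e q : 0 < e ->
  (forall p, cbox a b (heis_mul p q) -> Omega p) ->
  test_function Omega (fun p => bump a b e (heis_mul p q)).
Proof.
move=> e0 abO.
have cK : compact ((fun p => heis_mul p q) @^-1` cbox a b).
  have -> : (fun p => heis_mul p q) @^-1` cbox a b =
      (fun p => heis_mul p (- q)) @` cbox a b.
    apply/seteqP; split=> [p pab|_ [p pab <-]].
      by exists (heis_mul p q) => //; rewrite -heis_mulA heis_mulrN heis_mulr0.
    by rewrite /= -heis_mulA heis_mulNr heis_mulr0.
  apply: continuous_compact; last exact: compact_cbox.
  by apply: continuous_subspaceT; exact: continuous_mulr.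
have clK := compact_closed (@norm_hausdorff _ _) cK.
have sub : closure [set p | bump a b e (heis_mul p q) != 0] `<=`
    (fun p => heis_mul p q) @^-1` cbox a b.
  rewrite [X in _ `<=` X](closure_id _).1//; apply: closure_subset => p /=.
  move=> pb; apply: box_cbox; apply: contrapT => npb.
  by move/eqP: pb; apply; exact: bump_out.
split.
- by move=> k; apply: smooth_Ck; apply: smooth_mulr; exact: smooth_bump.
- by apply: (subclosed_compact _ cK sub); exact: closed_closure.
- by move=> p /sub; exact: abO.
Qed.

End heisenberg_test_functions.

(** * Sobolev functions along horizontal segments *)

Section fundamental_lemma.
Context {R : realType} {m : nat}.
Local Notation V := 'rV[R]_m.
Local Notation mu := (@lebesgue_row R m).
Local Open Scope ereal_scope.

(** Bumps tend to indicators of boxes; taking for [b'] the coordinatewise minimum of [b] and [c]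
    makes these the intersections of [box a b] with orthants. The integral of [u] then vanishes over
    every orthant, and by Dynkin's lemma over every measurable set. *)
Lemma bump_integral_eq0 (a b : V) (u : V -> R) :
  mu.-integrable setT (EFin \o u) ->
  (forall p, ~ box a b p -> u p = 0%R) ->
  (forall (b' : V) (e : R), (0 < e)%R -> (forall i, b' ord0 i <= b ord0 i)%R ->
     \int[mu]_p (u p * bump a b' e p)%:E = 0) ->
  {ae mu, forall p, u p = 0%R}.
Proof.
move=> iu u0 ub.
have mu' : measurable_fun setT u by apply/measurable_EFinP; exact: measurable_int iu.
have orthant0 c : \int[mu]_(p in orthant c) (u p)%:E = 0.
  pose b' : V := (\row_i Num.min (b ord0 i) (c ord0 i))%R.
  have cv : \int[mu]_p (u p * bump a b' k.+1%:R^-1 p)%:E @[k --> \oo] -->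
      \int[mu]_p (u p * \1_(box a b') p)%:E.
    apply: (@dominated_cvg _ _ _ mu setT measurableT _ _ (fun p => `|u p|%:E)) => //.
    - move=> k; apply/measurable_EFinP; apply: measurable_funM => //.
      by apply: continuous_measurable_row; apply: smooth_continuous; exact: smooth_bump.
    - move=> p _; apply: cvg_EFin; first exact: nearW.
      by apply: cvgM; [exact: cvg_cst|exact: bump_cvg].
    - by have := integrable_abse iu.
    - move=> k p _; rewrite lee_fin normrM ler_piMr//.
      by rewrite ger0_norm ?bump_ge0// bump_le1.
  have E : (fun k => \int[mu]_p (u p * bump a b' k.+1%:R^-1 p)%:E) = cst 0.
    by apply/funext => k; rewrite ub ?invr_gt0// => i; rewrite mxE ge_min lexx.
  have := @cvg_lim _ (@ereal_hausdorff R) _ _ _ _ _ cv.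
  rewrite E lim_cst// => E0; rewrite [RHS]E0; rewrite [LHS]integral_mkcond.
  apply: eq_integral => p _.
  rewrite /b' -setI_box_orthant patchE indicE.
  have [pc|npc] := pselect (orthant c p); last first.
    by rewrite !memNset ?mulr0//; case.
  have [pb|npb] := pselect (box a b p); first by rewrite !mem_set ?mulr1.
  by rewrite mem_set// u0// mul0r.
have all0 D : measurable D -> \int[mu]_(p in D) (u p)%:E = 0.
  have intT : \int[mu]_p (u p)%:E = 0.
    rewrite -[RHS](orthant0 b) [RHS]integral_mkcond; apply: eq_integral => p _.
    rewrite patchE; case: ifPn => // /negP npb; rewrite u0// => pab; apply: npb.
    by apply/mem_set => i; have /andP[] := pab i.
  move: D; apply: row_dynkin_induction => //.
  - move=> D mD D0.
    have := integral_setU mu mD (measurableC mD) (f := EFin \o u).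
    rewrite setUv /= D0 add0e intT => <- //; first exact/measurable_EFinP.
    by apply/disj_setPS => p [].
  - move=> F mF tF F0; rewrite integral_bigcup//; last first.
      by apply: integrableS iu => //; exact: bigcup_measurable.
    by apply: eseries0 => k _ _; exact: F0.
have : ae_eq mu setT (EFin \o u) (cst 0).
  apply: integral_ae_eq => // E _ mE; rewrite all0// integral0//.
by apply: filterS => p /(_ I)[].
Qed.

End fundamental_lemma.

(** * Averages over the unit interval *)

Section uniform_average.
Context {R : realType}.
Local Open Scope ereal_scope.

(** Averaging over [0,1] becomes integration over the whole line against a probability, so Fubini
    and Hoelder apply without restricted domains. *)
Definition unif : probability (measurableTypeR R) R := uniform_prob (@ltr01 R).

Lemma integral_unif (f : R -> \bar R) :
  measurable_fun setT (f : measurableTypeR R -> \bar R) ->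
  \int[unif]_x f x = \int[lebesgue_measure]_(x in `[0%R, 1%R]) f x.
Proof.
move=> mf; rewrite integralE [RHS]integralE; congr (_ - _).
  by rewrite integral_uniform ?subr0 ?invr1 ?mul1e//; exact: measurable_funepos.
by rewrite integral_uniform ?subr0 ?invr1 ?mul1e//; exact: measurable_funeneg.
Qed.

Lemma eq_integral_unif (f g : R -> \bar R) :
  measurable_fun setT (f : measurableTypeR R -> \bar R) ->
  measurable_fun setT (g : measurableTypeR R -> \bar R) ->
  (forall x, (0 <= x <= 1)%R -> f x = g x) ->
  \int[unif]_x f x = \int[unif]_x g x.
Proof.
move=> mf mg fg; rewrite !integral_unif//; apply: eq_integral => x.
by rewrite inE/= in_itv/=; exact: fg.
Qed.

Lemma integral_unif_le (f : R -> \bar R) (M : \bar R) :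
  measurable_fun setT (f : measurableTypeR R -> \bar R) ->
  (forall x, 0 <= f x) -> 0 <= M ->
  (forall x, (0 <= x <= 1)%R -> f x <= M) ->
  \int[unif]_x f x <= M.
Proof.
move=> mf f0 M0 fM; rewrite integral_unif//.
apply: (@le_trans _ _ (\int[lebesgue_measure]_(x in `[0%R, 1%R]) cst M x)).
  by apply: ge0_le_integral => //; exact: measurable_funTS.
rewrite integral_cst//= lebesgue_measure_itv/= lte_fin ltr01.
by rewrite oppr0 adde0 mule1.
Qed.

(** Jensen's inequality for the power [s], from Hoelder's inequality against the constant 1, whose
    norm is 1 for a probability. For [s = 1] there is no finite conjugate exponent and both sides
    agree. *)
Lemma powR_integral_unif_le (s : R) (f : R -> R) : (1 <= s)%R ->
  measurable_fun setT (f : measurableTypeR R -> R) ->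
  (\int[unif]_x `|f x|%:E) `^ s <= \int[unif]_x (`|f x| `^ s)%:E.
Proof.
move=> s1 mf; have s0 : (0 < s)%R by exact: lt_le_trans s1.
rewrite -[leRHS]/(\int[unif]_x (`|(EFin \o f) x| `^ s)).
rewrite -poweR_Lnorm ?gt_eqF//.
apply: gt0_ler_poweR; first exact: ltW.
- by rewrite in_itv/= leey integral_ge0.
- by rewrite in_itv/= leey Lnorm_ge0.
rewrite -[leLHS]/(\int[unif]_x `|(EFin \o f) x|) -Lnorm1.
move: s1; rewrite le_eqVlt => /predU1P[<-//|s1].
pose q := ((1 - s^-1)^-1)%R.
have q0 : (0 < q)%R by rewrite invr_gt0 subr_gt0 invf_lt1.
have := @hoelder _ _ _ unif f (cst 1%R) s q mf (measurable_cst _) s0 q0.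
rewrite /q invrK addrC subrK => /(_ erefl).
have -> : 'N[unif]_((1 - s^-1)^-1)%:E[EFin \o cst 1%R] = 1.
  apply: etrans (Lnorm_cst1 unif _) _; rewrite -[RHS](poweR1r (((1 - s^-1)^-1)^-1)%R).
  by congr (poweR _ _); exact: probability_setT.
rewrite mule1.
by under eq_Lnorm do rewrite /= mulr1.
Qed.

End uniform_average.

(** * Differentiation along horizontal flows *)

Section horizontal_derivative.
Context {R : realType} {n : nat}.
Local Notation H := (heis R n).
Local Notation mu := (@lebesgue_row R (n + n + 1)).
Implicit Types (p q : H) (v : 'rV[R]_(n + n)) (phi : H -> R).

Definition hderive v phi p : R := 'D_(hvec v p) phi p.

Lemma hvec_coord v p j : hvec v p ord0 j = heis_mul p (hpt v) ord0 j - p ord0 j.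
Proof. by rewrite heis_mul_hpt [in RHS]mxE addrAC subrr add0r. Qed.

Lemma continuous_hderive v phi : smooth phi -> continuous (hderive v phi).
Proof.
move=> /smooth_grad[df [sdf Df]].
have -> : hderive v phi = fun p => \sum_i hvec v p ord0 i * df i p.
  by apply/funext => p; have Dp := Df p (hvec v p); exact: derive_val.
apply: continuous_sum_fun => i p.
apply: continuousM; last by apply: smooth_continuous.
have -> : (fun p => hvec v p ord0 i) =
    (fun p => heis_mul p (hpt v) ord0 i - p ord0 i).
  by apply/funext => x; rewrite hvec_coord.
exact: (continuousB (@continuous_coordf _ _ _ _ i (@continuous_mulr R n (hpt v)) p)
  (@continuous_coord _ _ i p)).
Qed.

Lemma smooth_deriveN phi p w : smooth phi -> 'D_(- w) phi p = - 'D_w phi p.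
Proof.
move=> /smooth_grad[df [_ Df]].
have E u : 'D_u phi p = \sum_j u ord0 j * df j p.
  by have Du := Df p u; exact: derive_val.
by rewrite !E -sumrN; apply: eq_bigr => i _; rewrite mxE mulNr.
Qed.

(** A left-invariant field does not commute with all right translations, but it commutes with its
    own flow, which is right translation by [hpt (c *: v)]. *)
Lemma hderive_mulr v phi p (c : R) :
  hderive v (fun p => phi (heis_mul p (hpt (c *: v)))) p =
  hderive v phi (heis_mul p (hpt (c *: v))).
Proof.
set q := heis_mul p _.
have E : (fun h : R => h^-1 *: (((fun p => phi (heis_mul p (hpt (c *: v)))) \o shift p)
      (h *: hvec v p) - phi q)) =
    (fun h : R => h^-1 *: ((phi \o shift q) (h *: hvec v q) - phi q)).
  apply/funext => h /=; congr (_ *: (phi _ - _)).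
  rewrite /q addrC -heis_mul_hptZ heis_mul_hptD addrC -heis_mul_hptD.
  by rewrite heis_mul_hptZ addrC.
by rewrite /hderive /derive E.
Qed.

Lemma is_derive_flow v phi p (c : R) : smooth phi ->
  is_derive c 1 (fun c : R => phi (heis_mul p (hpt (- c *: v))))
    (- hderive v phi (heis_mul p (hpt (- c *: v)))).
Proof.
move=> sphi; set y := heis_mul p _.
have E : (fun h : R => h^-1 *: (((fun c : R => phi (heis_mul p (hpt (- c *: v))))
     \o shift c) (h *: 1) - phi y)) =
   (fun h : R => h^-1 *: ((phi \o shift y) (h *: - hvec v y) - phi y)).
  apply/funext => h /=; congr (_ *: (phi _ - _)).
  rewrite opprD addrC -heis_mul_hptD -/y heis_mul_hptZ addrC; congr (_ + _).
  by rewrite [h *: 1]mulr1 scalerN scaleNr.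
have D : derivable phi y (- hvec v y) by exact: smooth_derivable.
split; first by rewrite /derivable E.
by rewrite /derive E -/(derive phi y (- hvec v y)) smooth_deriveN.
Qed.

Lemma flow_FTC v phi p : smooth phi ->
  (phi (heis_mul p (hpt (- v))) - phi p)%:E =
  (\int[unif]_c (- hderive v phi (heis_mul p (hpt (- c *: v))))%:E)%E.
Proof.
move=> sphi; pose x c := phi (heis_mul p (hpt (- c *: v))).
pose dx c := - hderive v phi (heis_mul p (hpt (- c *: v))).
have cdx : continuous dx.
  move=> c; apply: cvgN.
  have cN : continuous (fun c : R => heis_mul p (hpt (- c *: v))).
    apply: (@continuous_heis_mul _ _ _ (fun=> p)); first by move=> ? A; exact: cst_continuous.
    move=> z; apply: (@continuous_comp _ _ _ (fun c : R => - c) (fun c => hpt (c *: v))).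
      exact: opp_continuous.
    exact: continuous_hptZ.
  exact: (@continuous_comp _ _ _ (fun c : R => heis_mul p (hpt (- c *: v)))
    (hderive v phi) c (cN c) (@continuous_hderive v phi sphi _)).
have Dx (c : R) : is_derive c 1 x (dx c) by exact: is_derive_flow.
have cx : continuous x.
  move=> c; apply: differentiable_continuous; apply/derivable1_diffP.
  by have := Dx c => Dxc; apply: ex_derive.
rewrite integral_unif; last first.
  by apply/measurable_EFinP; exact: continuous_measurable_fun.
rewrite (@continuous_FTC2 _ dx x 0 1)//.
- by rewrite /x scaleN1r oppr0 scale0r [hpt 0]row_mx0 heis_mulr0 EFinB.
- exact: continuous_subspaceT.
- split=> [c _||]; first by have := Dx c => Dxc; apply: ex_derive.
  + exact/cvg_at_right_filter/cx.
  + exact/cvg_at_left_filter/cx.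
- by move=> c _; rewrite derive1E; have := Dx c => Dxc; exact: derive_val.
Qed.

Lemma hderive_out v phi p (K : set H) : closed K ->
  (forall q, ~ K q -> phi q = 0) -> ~ K p -> hderive v phi p = 0.
Proof.
move=> clK phi0 nKp; rewrite /hderive.
rewrite -(@derive_cst _ _ _ 0 p (hvec v p)); apply: near_eq_derive.
have oK : open (~` K) by exact: closed_openC.
have : \forall q \near p, (~` K) q by apply: open_nbhs_nbhs.
by apply: filterS => q /phi0.
Qed.

Lemma compact_support_bounded (phi : H -> R) (K : set H) : compact K ->
  continuous phi -> (forall p, ~ K p -> phi p = 0) ->
  exists M, forall p, `|phi p| <= M.
Proof.
move=> cK cphi phi0.
have [M [_ HM]] : bounded_set (phi @` K).
  apply: compact_bounded; apply: continuous_compact => //.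
  exact: continuous_subspaceT.
exists (`|M| + 1) => p; have [Kp|nKp] := pselect (K p).
  by apply: HM; [rewrite ltr_pwDr// ler_norm|exists p].
by rewrite phi0// normr0 addr_ge0.
Qed.

End horizontal_derivative.

#[local] Opaque lebesgue_row heis_mul.

(** * Increments of a Sobolev function as averages of its gradient *)

Section segments.
Context {R : realType} {n : nat}.
Local Notation H := (heis R n).
Local Notation mu := (@lebesgue_row R (n + n + 1)).
Variables (s : R) (v : 'rV[R]_(n + n)).
Hypothesis s1 : 1 <= s.
Local Notation flow p c := (heis_mul p (hpt (c *: v))).
Implicit Types (X psi : H -> R) (K : set H).
Local Open Scope ereal_scope.

Let s0 : (0 < s)%R. Proof. exact: lt_le_trans s1. Qed.

Lemma flowK p (c : R) : flow (flow p (- c)) c = p.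
Proof. by rewrite heis_mul_hptD addNr scale0r /hpt row_mx0 heis_mulr0. Qed.

Lemma flowNK p (c : R) : flow (flow p c) (- c) = p.
Proof. by rewrite heis_mul_hptD subrr scale0r /hpt row_mx0 heis_mulr0. Qed.

Lemma Lfun_measurable X : X \in Lfun mu s%:E -> measurable_fun setT X.
Proof. by move=> /sub_Lfun_mfun; rewrite inE. Qed.

Lemma Lfun_powR_lty X : X \in Lfun mu s%:E -> \int[mu]_p (`|X p| `^ s)%:E < +oo.
Proof.
move=> /(Lfun_integrable s1)/integrableP[_]; apply: le_lt_trans.
by rewrite le_eqVlt; apply/orP; left; apply/eqP; apply: eq_integral => p _;
  rewrite gee0_abs// lee_fin powR_ge0.
Qed.

Lemma measurable_flow (sg : R) : measurable_fun setT
  (fun z : H * measurableTypeR R => flow z.1 (sg * z.2)%R).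
Proof.
apply: measurable_heis_mul; first exact: measurable_fst.
apply: measurable_hpt; apply: measurable_row_scale; last exact: measurable_cst.
by apply: measurable_funM => //; exact: measurable_snd.
Qed.

(** From [x <= 1 + x^s] for [x >= 0] and [s >= 1], applied on [K]. The bound does not depend on [q],
    so it survives averaging along a flow. *)
Lemma integral_mul_bounded_le X psi K (M : R) q :
  measurable_fun setT X -> measurable_fun setT psi -> measurable K ->
  (forall p, `|psi p| <= M)%R -> (forall p, ~ K p -> psi p = 0%R) ->
  \int[mu]_p `|X (heis_mul p q) * psi p|%:E <=
    M%:E * (mu K + \int[mu]_p (`|X p| `^ s)%:E).
Proof.
move=> mX mpsi mK psiM psi0.
have M0 : (0 <= M)%R by exact: le_trans (psiM 0%R).
have mXq : measurable_fun setT (fun p : H => X (heis_mul p q)).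
  exact: measurableT_comp (measurable_mulr q).
have mS : measurable_fun setT
    (fun p : H => (\1_K p)%:E + (`|X (heis_mul p q)| `^ s)%:E).
  apply: emeasurable_funD; last exact: (measurable_norm_powR s mXq).
  by apply/measurable_EFinP; exact: measurable_indic.
have nS p : 0 <= (\1_K p)%:E + (`|X (heis_mul p q)| `^ s)%:E.
  by rewrite adde_ge0// lee_fin powR_ge0.
apply: (@le_trans _ _ (\int[mu]_p (M%:E *
    ((\1_K p)%:E + (`|X (heis_mul p q)| `^ s)%:E)))).
  apply: ge0_le_integral => //.
  - apply/measurable_EFinP; apply: measurableT_comp => //; exact: measurable_funM.
  - exact: measurable_funeM.
  - move=> p _; rewrite -EFinD -EFinM lee_fin normrM mulrC.
    have [Kp|nKp] := pselect (K p); last first.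
      by rewrite psi0// normr0 mul0r mulr_ge0// addr_ge0// powR_ge0.
    rewrite ler_pM//; set x := `|_|%R; have x0 : (0 <= x)%R by exact: normr_ge0.
    rewrite indicE mem_set//; have [x1|x1] := leP x 1%R.
      by rewrite (le_trans x1)// lerDl powR_ge0.
    by rewrite (le_trans (le1r_powR (ltW x1) s1))// lerDr.
have m1K : measurable_fun setT (fun p : H => (\1_K p)%:E : \bar R).
  by apply/measurable_EFinP; exact: measurable_indic.
have mXs := measurable_norm_powR s mXq.
rewrite (ge0_integralZl mu measurableT mS (fun p _ => nS p))//.
rewrite (ge0_integralD mu measurableT _ m1K _ mXs)//.
rewrite (integral_indic mu measurableT mK) setIT.
rewrite (ge0_integral_mulr q (F := fun p => (`|X p| `^ s)%:E))//.
exact: (measurable_norm_powR s mX).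
Qed.

Lemma integrable_mul_bounded X psi K (M : R) q :
  X \in Lfun mu s%:E -> measurable_fun setT psi -> measurable K -> mu K < +oo ->
  (forall p, `|psi p| <= M)%R -> (forall p, ~ K p -> psi p = 0%R) ->
  mu.-integrable setT (fun p => (X (heis_mul p q) * psi p)%:E).
Proof.
move=> LX mpsi mK Kfin psiM psi0; have mX := Lfun_measurable LX.
apply/integrableP; split.
  apply/measurable_EFinP; apply: measurable_funM => //.
  exact: measurableT_comp (measurable_mulr q).
apply: le_lt_trans (integral_mul_bounded_le q mX mpsi mK psiM psi0) _.
rewrite lte_mul_pinfty//; first by rewrite lee_fin (le_trans _ (psiM 0%R)).
by rewrite lte_add_pinfty// Lfun_powR_lty.
Qed.

(** Replacing [p] by [flow p c] preserves the integral and moves the flow from [psi] to [X], the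
    case already treated. *)
Lemma integrable_mul_flow X psi K (M : R) (c : R) :
  X \in Lfun mu s%:E -> measurable_fun setT psi -> measurable K -> mu K < +oo ->
  (forall p, `|psi p| <= M)%R -> (forall p, ~ K p -> psi p = 0%R) ->
  mu.-integrable setT (fun p => (X p * psi (flow p (- c)))%:E).
Proof.
move=> LX mpsi mK Kfin psiM psi0; have mX := Lfun_measurable LX.
have mf : measurable_fun setT (fun p : H => X p * psi (flow p (- c)))%R.
  apply: measurable_funM => //; apply: (measurableT_comp mpsi).
  exact: measurable_mulr.
apply/integrableP; split; first exact/measurable_EFinP.
rewrite -(ge0_integral_mulr (hpt (c *: v)) (F := fun p => `|(X p * psi (flow p (- c)))%:E|))//.
  under eq_integral do rewrite flowNK.
  by move/integrableP : (integrable_mul_bounded (hpt (c *: v)) LX mpsi mK Kfin psiM psi0) => [].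
by apply: measurableT_comp => //; exact/measurable_EFinP.
Qed.

(** The joint integrability required by Fubini; by Tonelli a bound on the integral over [p], uniform
    in [c], is enough. *)
Lemma integrable_flow1 X psi K (M : R) :
  X \in Lfun mu s%:E -> measurable_fun setT psi -> measurable K -> mu K < +oo ->
  (forall p, `|psi p| <= M)%R -> (forall p, ~ K p -> psi p = 0%R) ->
  (mu \x unif).-integrable setT
    (fun z : H * measurableTypeR R => (X (flow z.1 z.2) * psi z.1)%:E).
Proof.
move=> LX mpsi mK Kfin psiM psi0; have mX := Lfun_measurable LX.
have mf : measurable_fun setT
    (fun z : H * measurableTypeR R => (X (flow z.1 z.2) * psi z.1)%:E).
  apply/measurable_EFinP; apply: measurable_funM.
    apply: (measurableT_comp mX); have := measurable_flow 1.
    by under eq_fun do rewrite mul1r.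
  exact: measurableT_comp mpsi measurable_fst.
apply/integrable21ltyP => //.
apply: (@le_lt_trans _ _ (M%:E * (mu K + \int[mu]_p (`|X p| `^ s)%:E))); last first.
  rewrite lte_mul_pinfty//; first by rewrite lee_fin (le_trans _ (psiM 0%R)).
  by rewrite lte_add_pinfty// Lfun_powR_lty.
have M0 : (0 <= M)%R by exact: le_trans (psiM 0%R).
apply: integral_unif_le.
- apply: (measurable_fun_fubini_tonelli_G
    (fun z : H * measurableTypeR R => `|(X (flow z.1 z.2) * psi z.1)%:E|)) => //.
  exact: measurableT_comp.
- by move=> c; exact: integral_ge0.
- by rewrite mule_ge0// adde_ge0// integral_ge0// => p _; rewrite lee_fin powR_ge0.
- by move=> c _; exact: (integral_mul_bounded_le (hpt (c *: v)) mX mpsi mK psiM psi0).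
Qed.

Lemma integrable_flow2 X psi K (M : R) :
  X \in Lfun mu s%:E -> measurable_fun setT psi -> measurable K -> mu K < +oo ->
  (forall p, `|psi p| <= M)%R -> (forall p, ~ K p -> psi p = 0%R) ->
  (mu \x unif).-integrable setT
    (fun z : H * measurableTypeR R => (X z.1 * psi (flow z.1 (- z.2)))%:E).
Proof.
move=> LX mpsi mK Kfin psiM psi0; have mX := Lfun_measurable LX.
have mf : measurable_fun setT
    (fun z : H * measurableTypeR R => (X z.1 * psi (flow z.1 (- z.2)))%:E).
  apply/measurable_EFinP; apply: measurable_funM.
    exact: measurableT_comp mX measurable_fst.
  apply: (measurableT_comp mpsi); have := measurable_flow (-1).
  by under eq_fun do rewrite mulN1r.
apply/integrable21ltyP => //.
apply: (@le_lt_trans _ _ (M%:E * (mu K + \int[mu]_p (`|X p| `^ s)%:E))); last first.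
  rewrite lte_mul_pinfty//; first by rewrite lee_fin (le_trans _ (psiM 0%R)).
  by rewrite lte_add_pinfty// Lfun_powR_lty.
have M0 : (0 <= M)%R by exact: le_trans (psiM 0%R).
apply: integral_unif_le.
- apply: (measurable_fun_fubini_tonelli_G
    (fun z : H * measurableTypeR R => `|(X z.1 * psi (flow z.1 (- z.2)))%:E|)) => //.
  exact: measurableT_comp.
- by move=> c; exact: integral_ge0.
- by rewrite mule_ge0// adde_ge0// integral_ge0// => p _; rewrite lee_fin powR_ge0.
- move=> c _.
  rewrite -(ge0_integral_mulr (hpt (c *: v))
    (F := fun p => `|X p * psi (flow p (- c))|%:E))//.
    under eq_integral do rewrite flowNK.
    exact: (integral_mul_bounded_le (hpt (c *: v)) mX mpsi mK psiM psi0).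
  apply/measurable_EFinP; apply: measurableT_comp => //.
  apply: measurable_funM => //; apply: (measurableT_comp mpsi).
  exact: measurable_mulr.
Qed.

Variables (Omega : set H) (F Gv : H -> R).
Hypotheses (LF : F \in Lfun mu s%:E) (LG : Gv \in Lfun mu s%:E).
Hypothesis weakF : forall phi, smooth phi -> test_function Omega phi ->
  \int[mu]_p (F p * hderive v phi p)%:E = - \int[mu]_p (Gv p * phi p)%:E.

Section one_box.
Variables (a b b' : H) (e : R).
Hypothesis e0 : (0 < e)%R.
Hypothesis b'b : forall i, (b' ord0 i <= b ord0 i)%R.
Hypothesis abO : forall p (c : R), cbox a b p -> (0 <= c <= 1)%R -> Omega (flow p c).
Let phi := bump a b' e.
Let K := cbox a b.

Let mK : measurable K. Proof. exact: measurable_cbox. Qed.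
Let Kfin : mu K < +oo. Proof. exact: lebesgue_row_cbox_lty. Qed.
Let sphi : smooth phi. Proof. exact: smooth_bump. Qed.
Let cb'b : cbox a b' `<=` K.
Proof.
by move=> p pb i; have /andP[-> /le_trans ->] := pb i.
Qed.
Let phi_out p : ~ K p -> phi p = 0%R.
Proof. by move=> nKp; apply: bump_out => // /box_cbox/cb'b. Qed.
Let phi_le p : (`|phi p| <= 1)%R.
Proof. by rewrite ger0_norm ?bump_ge0// bump_le1. Qed.
Let mphi : measurable_fun setT phi.
Proof. by apply: continuous_measurable_row; exact: smooth_continuous. Qed.
Let clK : closed K.
Proof. by have clK := compact_closed (@norm_hausdorff _ _) (@compact_cbox _ _ a b). Qed.

(* Both sides compute the derivative of [c |-> \int F(p) phi(p exp(-cv)) dp],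
   which the weak derivative of [F] evaluates. *)
Lemma integral_flow_bump :
  \int[mu]_p ((F (flow p 1) - F p) * phi p)%:E =
  \int[mu]_p \int[unif]_c (Gv (flow p c) * phi p)%:E.
Proof.
pose psi := hderive v phi.
have cpsi : continuous psi by exact: continuous_hderive.
have mpsi : measurable_fun setT psi by exact: continuous_measurable_row.
have psi_out p : ~ K p -> psi p = 0%R by exact: hderive_out.
have [M psiM] := compact_support_bounded (@compact_cbox _ _ a b) cpsi psi_out.
have I1 : mu.-integrable setT (fun p => (F (flow p 1) * phi p)%:E).
  exact: integrable_mul_bounded LF mphi mK Kfin phi_le phi_out.
have I2 : mu.-integrable setT (fun p => (F p * phi p)%:E).
  have := integrable_mul_bounded 0%R LF mphi mK Kfin phi_le phi_out.
  by under eq_fun do rewrite heis_mulr0.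
have mF := Lfun_measurable LF; have mG := Lfun_measurable LG.
have I3 := integrable_mul_flow 1 LF mphi mK Kfin phi_le phi_out.
(* The flow preserves [mu], so it can be transferred from [F], which has no pointwise regularity, to
   the bump. *)
have E1 : \int[mu]_p (F (flow p 1) * phi p)%:E = \int[mu]_p (F p * phi (flow p (-1)))%:E.
  rewrite -[RHS](integral_mulr (hpt (1 *: v))).
    by apply: eq_integral => p _; rewrite flowNK.
  apply/measurable_EFinP; apply: measurable_funM => //.
  by apply: (measurableT_comp mphi); exact: measurable_mulr.
transitivity (\int[mu]_p (F p * (phi (flow p (-1)) - phi p))%:E).
  under eq_integral do rewrite mulrBl EFinB.
  rewrite (integralB_EFin measurableT I1 I2) E1 -(integralB_EFin measurableT I3 I2).
  by apply: eq_integral => p _; rewrite -EFinB mulrBr.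
have I4 := integrable_flow2 LF mpsi mK Kfin psiM psi_out.
have I4' : (mu \x unif).-integrable setT
    (fun z : H * measurableTypeR R => (- (F z.1 * psi (flow z.1 (- z.2))))%:E).
  by have := integrableN I4; apply: eq_integrable.
(* For fixed [p] the bump obeys the fundamental theorem of calculus along the flow. *)
transitivity (\int[mu]_p \int[unif]_c (- (F p * psi (flow p (- c))))%:E).
  apply: eq_integral => p _.
  rewrite EFinM scaleN1r (flow_FTC v p sphi).
  have mpsip : measurable_fun setT (fun c : measurableTypeR R =>
      - hderive v phi (flow p (- c)))%R.
    apply: measurable_funN; apply: (measurableT_comp mpsi).
    have := measurableT_comp (measurable_flow (-1)) (pair1_measurable p).
    by rewrite /comp/=; under eq_fun do rewrite mulN1r.
  have ipsi : unif.-integrable setT (fun c : measurableTypeR R =>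
      (- hderive v phi (flow p (- c)))%:E).
    have unifT : unif [set: measurableTypeR R] < +oo.
      by rewrite [ltLHS](probability_setT unif) ltry.
    apply: (measurable_bounded_integrable measurableT unifT mpsip).
    exists M; split; first exact: num_real.
    by move=> y My c _ /=; rewrite normrN (le_trans (psiM _))// ltW.
  rewrite -(integralZl measurableT ipsi).
  by apply: eq_integral => c _; rewrite -EFinM mulrN.
rewrite (Fubini I4').
have I5 := integrable_flow1 LG mphi mK Kfin phi_le phi_out.
rewrite (Fubini I5).
apply: eq_integral_unif.
- exact: measurable_fubini_G I4'.
- exact: measurable_fubini_G I5.
move=> c c01.
transitivity (\int[mu]_p (Gv p * phi (flow p (- c)))%:E); last first.
  rewrite -[LHS](integral_mulr (hpt (c *: v))).
    by apply: eq_integral => p _; rewrite flowNK.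
  apply/measurable_EFinP; apply: measurable_funM => //.
  by apply: (measurableT_comp mphi); exact: measurable_mulr.
(* By [abO] the bump transported up to time [c] still has its support in [Omega], so the weak
   derivative may be tested with it. *)
have tphi : test_function Omega (fun p => phi (flow p (- c))).
  apply: test_function_bump => // p /cb'b/abO => /(_ _ c01).
  by rewrite flowK.
have := weakF (smooth_mulr _ sphi) tphi => W.
apply: oppe_inj; rewrite -W; transitivity (\int[mu]_p (F p * psi (flow p (- c)))%:E).
  have I6 := integrable_mul_flow c LF mpsi mK Kfin psiM psi_out.
  rewrite -[RHS]oppeK; congr (- _).
  rewrite -[RHS]mulN1e -(integralZl measurableT I6).
  by apply: eq_integral => p _; rewrite -EFinM mulN1r.
by apply: eq_integral => p _; rewrite hderive_mulr.
Qed.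

End one_box.

(** The difference [u] of the two sides, set to 0 off the box, has zero integral against all bumps
    with lower corner [a] inside the box; hence it vanishes almost everywhere. *)
Lemma ae_flow_box (a b : H) :
  (forall p (c : R), cbox a b p -> (0 <= c <= 1)%R -> Omega (flow p c)) ->
  {ae mu, forall p, box a b p ->
    unif.-integrable setT (fun c : measurableTypeR R => (Gv (flow p c))%:E) /\
    (F (flow p 1) - F p)%:E = \int[unif]_c (Gv (flow p c))%:E}.
Proof.
move=> abO; have mF := Lfun_measurable LF.
have mB : measurable (box a b) by exact: measurable_box.
have Bfin : mu (box a b) < +oo.
  apply: le_lt_trans (lebesgue_row_cbox_lty a b).
  by apply: le_measure; rewrite ?inE//; [exact: measurable_cbox|exact: box_cbox].
(* This factor makes every term integrable on the whole space and leaves products with bumps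
   supported in the box unchanged. *)
pose chi : H -> R := \1_(box a b).
have mchi : measurable_fun setT chi by exact: measurable_indic.
have chi1 p : (`|chi p| <= 1)%R.
  by rewrite /chi indicE; case: (_ \in _); rewrite ?normr1 ?normr0.
have chi_in p : box a b p -> chi p = 1%R by move=> Bp; rewrite /chi indicE mem_set.
have chi_out p : ~ box a b p -> chi p = 0%R by move=> Bp; rewrite /chi indicE memNset.
have Ih := integrable_flow1 LG mchi mB Bfin chi1 chi_out.
pose W p := \int[unif]_c (Gv (flow p c) * chi p)%:E.
have IW : mu.-integrable setT W by exact: integrable_fubini_F Ih.
have W_out p : ~ box a b p -> W p = 0.
  by move=> nBp; rewrite /W; under eq_integral do rewrite chi_out// mulr0; rewrite integral0.
have aeI := ae_integrable1 Ih.
have J1 := integrable_mul_bounded (hpt (1 *: v)) LF mchi mB Bfin chi1 chi_out.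
have J2 := integrable_mul_bounded 0%R LF mchi mB Bfin chi1 chi_out.
(* [W] is finite only almost everywhere; [fine] sets its infinite values to 0. *)
have J3 : mu.-integrable setT (fun p => (fine (W p))%:E).
  apply: le_integrable (IW) => //.
    apply/measurable_EFinP; apply: measurableT_comp => //.
    exact: measurable_int IW.
  by move=> p _; case: (W p) => [r| |] //=; rewrite normr0 leey.
pose u p := ((F (flow p 1) * chi p - F (heis_mul p 0) * chi p) - fine (W p))%R.
have Iu : mu.-integrable setT (EFin \o u).
  have := integrableB measurableT (integrableB measurableT J1 J2) J3.
  by apply: eq_integrable => // p _; rewrite /u /= !EFinB.
have u_out p : ~ box a b p -> u p = 0%R.
  by move=> nBp; rewrite /u chi_out// W_out// !mulr0 !subr0.
have u0 : {ae mu, forall p, u p = 0%R}.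
  apply: (bump_integral_eq0 Iu u_out) => b' e e0 b'b.
  pose phi := bump a b' e.
  have mphi : measurable_fun setT phi.
    by apply: continuous_measurable_row; apply: smooth_continuous; exact: smooth_bump.
  have phi1 p : (`|phi p| <= 1)%R by rewrite ger0_norm ?bump_ge0// bump_le1.
  have phi_out p : ~ box a b p -> phi p = 0%R.
    move=> nBp; apply: bump_out => // pb; apply: nBp => i.
    by have /andP[-> /lt_le_trans ->] := pb i.
  have chiphi p : (chi p * phi p = phi p)%R.
    have [Bp|nBp] := pselect (box a b p); first by rewrite chi_in// mul1r.
    by rewrite phi_out// mulr0.
  have I1 := integrable_mul_bounded (hpt (1 *: v)) LF mphi mB Bfin phi1 phi_out.
  have I2 := integrable_mul_bounded 0%R LF mphi mB Bfin phi1 phi_out.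
  have I3 : mu.-integrable setT (fun p => (fine (W p) * phi p)%:E).
    apply: le_integrable (J3) => //.
      apply/measurable_EFinP; apply: measurable_funM => //.
      by apply/measurable_EFinP; exact: measurable_int J3.
    by move=> p _; rewrite /= lee_fin normrM ler_piMr.
  have I4 : mu.-integrable setT (fun p => ((F (flow p 1) - F p) * phi p)%:E).
    have := integrableB measurableT I1 I2.
    by apply: eq_integrable => // p _; rewrite heis_mulr0 mulrBl EFinB.
  transitivity (\int[mu]_p (((F (flow p 1) - F p) * phi p)%:E - (fine (W p) * phi p)%:E)).
    apply: eq_integral => p _; rewrite /u heis_mulr0 -EFinB; congr (_%:E).
    by rewrite mulrBl; congr (_ - _)%R; rewrite -mulrBl -mulrA chiphi.
  rewrite (integralB_EFin measurableT I4 I3).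
  rewrite (integral_flow_bump e0 b'b abO).
  suff -> : \int[mu]_p \int[unif]_c (Gv (flow p c) * phi p)%:E =
      \int[mu]_p (fine (W p) * phi p)%:E.
    by rewrite subee//; exact: integrable_fin_num I3.
  have I5 := integrable_flow1 LG mphi mB Bfin phi1 phi_out.
  apply: ae_eq_integral => //.
  - exact: measurable_fubini_F I5.
  - exact: measurable_int I3.
  apply: filterS aeI => p Ip _.
  have Wfin : W p \is a fin_num by exact: integrable_fin_num Ip.
  rewrite EFinM fineK// muleC -(integralZl measurableT Ip).
  by apply: eq_integral => c _; rewrite /= -EFinM mulrCA (mulrC (phi p)) chiphi.
apply: filterS2 aeI u0 => p Ip u0p Bp.
have E : (fun c : measurableTypeR R => (Gv (flow (p, c).1 (p, c).2) * chi (p, c).1)%:E) =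
    (fun c : measurableTypeR R => (Gv (flow p c))%:E).
  by apply/funext => c /=; rewrite chi_in// mulr1.
have Wfin : W p \is a fin_num by exact: integrable_fin_num Ip.
split; first by rewrite -E.
have -> : \int[unif]_c (Gv (flow p c))%:E = W p.
  by apply: eq_integral => c _; rewrite chi_in// mulr1.
rewrite -(fineK Wfin); congr (_%:E).
by move/eqP: u0p; rewrite /u chi_in// !mulr1 heis_mulr0 subr_eq0 => /eqP.
Qed.

(** The rational boxes with closure in [B] are countably many; enumerating them by [unpickle] leaves
    a single null set. *)
Lemma ae_flow (B : set H) : open B ->
  (forall p (c : R), B p -> (0 <= c <= 1)%R -> Omega (flow p c)) ->
  {ae mu, forall p, B p ->
    unif.-integrable setT (fun c : measurableTypeR R => (Gv (flow p c))%:E) /\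
    (F (flow p 1) - F p)%:E = \int[unif]_c (Gv (flow p c))%:E}.
Proof.
move=> oB BO; pose P p :=
  unif.-integrable setT (fun c : measurableTypeR R => (Gv (flow p c))%:E) /\
    (F (flow p 1) - F p)%:E = \int[unif]_c (Gv (flow p c))%:E.
pose ra (z : 'rV[rat]_(n + n + 1) * 'rV[rat]_(n + n + 1)) : H := map_mx ratr z.1.
pose rb (z : 'rV[rat]_(n + n + 1) * 'rV[rat]_(n + n + 1)) : H := map_mx ratr z.2.
have aeP (k : nat) : {ae mu, forall p, forall z, unpickle k = Some z ->
    cbox (ra z) (rb z) `<=` B -> box (ra z) (rb z) p -> P p}.
  case: (unpickle k) => [z|]; last by apply: aeW => p z.
  have [zB|nzB] := pselect (cbox (ra z) (rb z) `<=` B); last first.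
    by apply: aeW => p _ [<-] /nzB.
  have := @ae_flow_box (ra z) (rb z) (fun p c pz c01 => BO p c (zB p pz) c01).
  by apply: filterS => p Pp _ [<-] _; exact: Pp.
have := ae_foralln aeP; apply: filterS => p Pp.
rewrite {1}(open_bigcup_box oB) => -[z zB pz].
exact: (Pp (pickle z) z (pickleK z) zB pz).
Qed.

End segments.

(** * Horizontal polygonal paths *)

Section euclidean.
Context {R : realType} {m : nat}.
Implicit Types u v : 'rV[R]_m.

Lemma dotpC u v : dotp u v = dotp v u.
Proof. by apply: eq_bigr => i _; rewrite mulrC. Qed.

Lemma dotpDl u1 u2 v : dotp (u1 + u2) v = dotp u1 v + dotp u2 v.
Proof. by rewrite -big_split/=; apply: eq_bigr => i _; rewrite mxE mulrDl. Qed.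

Lemma dotpZl c u v : dotp (c *: u) v = c * dotp u v.
Proof. by rewrite /dotp mulr_sumr; apply: eq_bigr => i _; rewrite mxE mulrA. Qed.

Lemma dotpDr u v1 v2 : dotp u (v1 + v2) = dotp u v1 + dotp u v2.
Proof. by rewrite dotpC dotpDl !(dotpC u). Qed.

Lemma dotpZr c u v : dotp u (c *: v) = c * dotp u v.
Proof. by rewrite dotpC dotpZl dotpC. Qed.

Lemma dotp0r u : dotp u 0 = 0.
Proof. by rewrite /dotp big1// => i _; rewrite mxE mulr0. Qed.

Lemma dotpp_ge0 u : 0 <= dotp u u.
Proof. by apply: sumr_ge0 => i _; rewrite -expr2 sqr_ge0. Qed.

Lemma enorm_ge0 u : 0 <= enorm u. Proof. exact: sqrtr_ge0. Qed.

Lemma enormZ c u : enorm (c *: u) = `|c| * enorm u.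
Proof. by rewrite /enorm dotpZl dotpZr mulrA -expr2 sqrtrM ?sqr_ge0// sqrtr_sqr. Qed.

Lemma enorm_eq0 u : enorm u = 0 -> u = 0.
Proof.
move=> /eqP; rewrite sqrtr_eq0 => u0.
have /eqP : dotp u u = 0 by apply/eqP; rewrite eq_le u0 dotpp_ge0.
rewrite psumr_eq0 => [/allP uu|i _]; last by rewrite -expr2 sqr_ge0.
apply/rowP => i; rewrite mxE; apply/eqP.
by have := uu i (mem_index_enum i); rewrite -expr2 sqrf_eq0.
Qed.

(** Cauchy-Schwarz, from the nonnegativity of the square of [u - t v] at the minimising [t]. *)
Lemma dotp_le_enorm u v : `|dotp u v| <= enorm u * enorm v.
Proof.
have [v0|v0] := eqVneq (dotp v v) 0.
  have -> : v = 0 by apply: enorm_eq0; rewrite /enorm v0 sqrtr0.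
  by rewrite dotp0r normr0 mulr_ge0 ?enorm_ge0.
have vv : 0 < dotp v v by rewrite lt0r v0 dotpp_ge0.
rewrite -(sqrtr_sqr (dotp u v)) -sqrtrM ?dotpp_ge0// ler_wsqrtr//.
set t := dotp u v / dotp v v.
have := dotpp_ge0 (u + (- t) *: v).
rewrite dotpDl !dotpDr !dotpZl !dotpZr (dotpC v u).
have -> : dotp u u + - t * dotp u v + (- t * dotp u v + - t * (- t * dotp v v)) =
    dotp u u - dotp u v ^+ 2 / dotp v v by rewrite /t; field.
by rewrite subr_ge0 ler_pdivrMr.
Qed.

Lemma enorm_le_sum u :
  enorm u <= \sum_i `|u ord0 i|.
Proof.
have S0 : 0 <= \sum_i `|u ord0 i| by apply: sumr_ge0.
rewrite -(ger0_norm S0) -sqrtr_sqr ler_wsqrtr// expr2 mulr_suml ler_sum// => i _.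
rewrite -[leLHS]ger0_norm -?expr2 ?sqr_ge0// expr2 normrM ler_wpM2l//.
by rewrite (bigD1 i)//= lerDl sumr_ge0.
Qed.

End euclidean.

(** * L^s norms on a subset *)

Section Lsnorm.
Context {R : realType} {n : nat}.
Local Notation H := (heis R n).
Local Notation mu := (@lebesgue_row R (n + n + 1)).
Variables (s : R) (A : set H).
Hypotheses (s1 : 1 <= s) (mA : measurable A).
Local Open Scope ereal_scope.

Let s0 : (0 < s)%R. Proof. exact: lt_le_trans s1. Qed.

Lemma measurable_patch (u : H -> R) : measurable_fun setT u ->
  measurable_fun setT (u \_ A).
Proof.
by move=> mu'; apply/(measurable_restrictT _ mA); exact: measurable_funTS.
Qed.

Lemma Lsnorm_le_powR (u : H -> R) (e : R) : (0 <= e)%R ->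
  (Lsnorm s A u <= e%:E) = (\int[mu]_(p in A) (`|u p| `^ s)%:E <= (e `^ s)%:E).
Proof.
move=> e0; rewrite [LHS](Lnorm_le_powR s1 _ e0).
congr (_ <= _); transitivity (\int[mu]_p ((fun p => (`|u p| `^ s)%:E) \_ A) p); last first.
  exact/esym/(integral_mkcond A).
apply: eq_integral => p _; rewrite !patchE.
by case: ifP => // _; rewrite normr0 powR0// gt_eqF.
Qed.

Lemma LsnormD (u1 u2 : H -> R) :
  measurable_fun setT u1 -> measurable_fun setT u2 ->
  Lsnorm s A (fun p => u1 p + u2 p)%R <= Lsnorm s A u1 + Lsnorm s A u2.
Proof.
move=> m1 m2; have := minkowski_EFin mu (measurable_patch m1) (measurable_patch m2) s1.
rewrite /Lsnorm; apply: le_trans; rewrite le_eqVlt; apply/orP; left; apply/eqP.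
apply: eq_Lnorm => p /=; rewrite !patchE; case: ifP => // _.
by rewrite addr0.
Qed.

Lemma Lsnorm_scale (u : H -> R) (c : R) : measurable_fun setT u ->
  Lsnorm s A (fun p => c * u p)%R = `|c|%:E * Lsnorm s A u.
Proof.
move=> m1; rewrite /Lsnorm -(Lnorm_scale s1 c (measurable_patch m1)).
apply: eq_Lnorm => p /=; rewrite !patchE; case: ifP => // _.
by rewrite mulr0.
Qed.

Lemma eq_Lsnorm (u1 u2 : H -> R) : (forall p, A p -> u1 p = u2 p) ->
  Lsnorm s A u1 = Lsnorm s A u2.
Proof.
move=> u12; apply: eq_Lnorm => p /=; rewrite !patchE.
by case: ifP => // /set_mem/u12 ->.
Qed.

Lemma Lsnorm0 : Lsnorm s A (cst 0%R) = 0.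
Proof.
rewrite -(@Lnorm0 _ _ _ mu s%:E) ?eqe ?gt_eqF//.
by apply: eq_Lnorm => p /=; rewrite patchE; case: ifP.
Qed.

Lemma Lsnorm_le (u1 u2 : H -> R) :
  measurable_fun setT u1 -> measurable_fun setT u2 ->
  (forall p, A p -> `|u1 p| <= `|u2 p|)%R -> Lsnorm s A u1 <= Lsnorm s A u2.
Proof.
move=> m1 m2 u12; apply: (ge0_Lnorm_le s1); [exact: measurable_patch..|].
by move=> p; rewrite !patchE; case: ifP => [/set_mem/u12//|_]; rewrite normr0.
Qed.

End Lsnorm.

Lemma ae_mulr {R : realType} {n : nat} (q : heis R n) (P : heis R n -> Prop) :
  {ae @lebesgue_row R (n + n + 1), forall p, P p} ->
  {ae @lebesgue_row R (n + n + 1), forall p, P (heis_mul p q)}.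
Proof.
move=> [N [mN N0 PN]].
exists ((fun p => heis_mul p q) @^-1` N); split.
- exact: measurable_mulr_preimage.
- by have := measure_mulr_preimage q mN; rewrite N0.
- by move=> p /= nPp; exact: PN.
Qed.

Section horizontal_paths.
Context {R : realType} {n : nat}.
Local Notation H := (heis R n).
Implicit Types (q : H) (vs : seq 'rV[R]_(n + n)) (Q : set H).

(* vs encodes the concatenation of the segments c |-> q' exp (c v), v \in vs,
   starting from q. *)
Definition hend q vs : H := foldl (fun q v => heis_mul q (hpt v)) q vs.

Fixpoint hpath Q q vs : Prop :=
  if vs is v :: vs' then
    (forall c : R, 0 <= c <= 1 -> Q (heis_mul q (hpt (c *: v)))) /\
    hpath Q (heis_mul q (hpt v)) vs'
  else True.

Lemma sub_hpath Q1 Q2 q vs : Q1 `<=` Q2 -> hpath Q1 q vs -> hpath Q2 q vs.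
Proof.
move=> Q12; elim: vs q => [|v vs IH] q //= [Qv Qvs]; split; last exact: IH.
by move=> c c01; apply: Q12; exact: Qv.
Qed.

Lemma hpathI Q1 Q2 q vs : hpath Q1 q vs -> hpath Q2 q vs -> hpath (Q1 `&` Q2) q vs.
Proof.
elim: vs q => [|v vs IH] q //= [Q1v Q1vs] [Q2v Q2vs]; split; last exact: IH.
by move=> c c01; split; [exact: Q1v|exact: Q2v].
Qed.

(** By associativity, left translation carries paths to paths. Conditions on all translated paths
    become a condition on one path, uniform in [p]. *)
Lemma hpath_mull (A : set H) Q q vs : (forall p, A p -> hpath Q (heis_mul p q) vs) ->
  hpath [set q' | forall p, A p -> Q (heis_mul p q')] q vs.
Proof.
elim: vs q => [|v vs IH] q //= AQ; split.
  by move=> c c01 p Ap; rewrite heis_mulA; have [+ _] := AQ p Ap; exact.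
by apply: IH => p Ap; rewrite heis_mulA; have [] := AQ p Ap.
Qed.

(** Boundedness makes the path shrink uniformly to the origin under small dilations. *)
Lemma hpath_bounded q vs : exists B, hpath [set q' | `|q'| <= B] q vs.
Proof.
elim: vs q => [|v vs IH] q; first by exists 0.
have [B QB] := IH (heis_mul q (hpt v)).
exists (Num.max B (`|q| + `|hvec v q|)); split; last first.
  by apply: sub_hpath QB => q' /= q'B; rewrite le_max q'B.
move=> c /andP[c0 c1] /=; rewrite heis_mul_hptZ le_max; apply/orP; right.
rewrite (le_trans (ler_normD _ _))// lerD2l normrZ ger0_norm//.
by rewrite ler_piMl.
Qed.

Lemma hpath_dilation (e : R) Q q vs : hpath Q q vs ->
  hpath (dilation e @` Q) (dilation e q) [seq e *: v | v <- vs].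
Proof.
elim: vs q => [|v vs IH] q //= [Qv Qvs]; split.
  move=> c c01; exists (heis_mul q (hpt (c *: v))); first exact: Qv.
  by rewrite dilation_mul dilation_hpt !scalerA mulrC.
by rewrite -dilation_hpt -dilation_mul; exact: IH.
Qed.

(** The last coordinate is scaled by the square of [e], which is at most [e] on [0,1]. *)
Lemma norm_dilation_le (e : R) q : 0 <= e <= 1 -> `|dilation e q| <= e * `|q|.
Proof.
move=> /andP[e0 e1]; rewrite [leLHS]/Num.norm /= mx_normrE.
apply/bigmax_leP; split=> [|[i j] _ /=]; first by rewrite mulr_ge0.
rewrite (ord1 i) dilationE; case: (split_ordP j) => k ->.
  rewrite row_mxEl !mxE normrM ger0_norm// ler_wpM2l//.
  exact: norm_coord_le.
rewrite row_mxEr (ord1 k) mxE eqxx mulr1n normrM expr2 ger0_norm ?mulr_ge0//.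
rewrite -mulrA ler_wpM2l// tpartE -[leRHS]mul1r ler_pM//.
exact: norm_coord_le.
Qed.

Lemma hpathT Q q vs : (forall q', Q q') -> hpath Q q vs.
Proof. by move=> QT; elim: vs q => [|v vs IH] q //=. Qed.

(** The empty list imposes no condition, so the starting point is assumed in [Q] separately. *)
Lemma hpath_hend Q q vs : Q q -> hpath Q q vs -> Q (hend q vs).
Proof.
elim: vs q => [|v vs IH] q //= Qq [Qv]; apply: IH.
by have := Qv 1; rewrite scale1r ler01 lexx; exact.
Qed.

Section polygonal.
Variable j : 'I_n.

Let ex : 'rV[R]_(n + n) := delta_mx ord0 (lshift n j).
Let ey : 'rV[R]_(n + n) := delta_mx ord0 (rshift n j).

(* The vertical displacement t is produced by a commutator of exp (a X_j) and
   exp (b Y_j), whose t-coordinate is - 4 a b. *)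
Definition polygonal (w : H) : seq 'rV[R]_(n + n) :=
  let a := Num.sqrt `|tpart w| / 2 in
  let b := - Num.sg (tpart w) * a in
  [:: hpart w; a *: ex; b *: ey; - a *: ex; - b *: ey].

(** Opposite sides of the commutator cancel: it moves the end point but contributes nothing to the
    first-order term. *)
Lemma sum_polygonal w : \sum_(v <- polygonal w) v = hpart w.
Proof.
rewrite /polygonal !big_cons big_nil addr0 !scaleNr.
by rewrite -[RHS]addr0; congr (_ + _); rewrite -opprD addrA subrr.
Qed.

Lemma enorm_delta (i : 'I_(n + n)) : enorm (delta_mx ord0 i : 'rV[R]_(n + n)) = 1.
Proof.
rewrite /enorm /dotp (bigD1 i)//= big1 => [|k ki]; rewrite !mxE ?eqxx/=.
  by rewrite mulr1 addr0 sqrtr1.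
by rewrite (negbTE ki) mulr0.
Qed.

Lemma enorm_polygonal w :
  \sum_(v <- polygonal w) enorm v <= enorm (hpart w) + 2 * Num.sqrt `|tpart w|.
Proof.
rewrite /polygonal !big_cons big_nil addr0 lerD2l !enormZ !enorm_delta !mulr1.
set a : R := _ / 2; set b : R := - _ * a.
have a0 : 0 <= a by rewrite divr_ge0 ?sqrtr_ge0.
have -> : `|- a| = a by rewrite normrN ger0_norm.
have -> : `|- b| = `|Num.sg (tpart w)| * a.
  by rewrite normrN normrM normrN (ger0_norm a0).
have -> : `|b| = `|Num.sg (tpart w)| * a by rewrite normrM normrN (ger0_norm a0).
rewrite (ger0_norm a0).
have : `|Num.sg (tpart w)| <= 1 by rewrite normr_sg; case: (_ != 0).
move=> /(ler_wpM2r a0); rewrite mul1r => h.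
have : Num.sqrt `|tpart w| = a * 2 by rewrite /a mulfVK.
lra.
Qed.

(** The horizontal parts cancel, so the commutator is vertical; antisymmetry of the symplectic form
    collects the vertical terms. *)
Lemma hpt_commutator (u v : 'rV[R]_(n + n)) :
  heis_mul (heis_mul (heis_mul (hpt u) (hpt v)) (hpt (- u))) (hpt (- v)) =
  row_mx 0 (4 * sympl v (hpt u))%:M.
Proof.
have uv := sympl_anti (hpt u) (hpt v); rewrite !hpartK in uv.
have vv := sympl_anti (hpt v) (hpt v); rewrite !hpartK in vv.
have uu := sympl_anti (hpt u) (hpt u); rewrite !hpartK in uu.
have N x p : sympl (- x) p = - sympl x p by rewrite -scaleN1r symplZl mulN1r.
have E x y p : sympl x (hvec y p) = sympl x (hpt y).
  by rewrite sympl_hpart hpart_hvec.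
have EN x y : sympl x (hpt (- y)) = - sympl x (hpt y).
  by rewrite -mulN1r -symplZr /hpt scale_row_mx scaler0 scaleN1r.
rewrite !heis_mul_hpt; pose p1 := hpt u + hvec v (hpt u).
pose p2 := p1 + hvec (- u) p1; rewrite -/p1 -/p2.
have E1 x : sympl x p1 = sympl x (hpt u) + sympl x (hpt v).
  by rewrite /p1 symplDr E.
have E2 x : sympl x p2 = sympl x (hpt v).
  by rewrite /p2 symplDr E E1 EN; ring.
rewrite {1}/p2 {1}/p1 /hvec /hpt !add_row_mx; congr row_mx.
  by rewrite (addrC u) addrK subrr.
by apply/rowP => i; rewrite (ord1 i) !mxE eqxx !mulr1n !N E1 E2; lra.
Qed.

Lemma hend_polygonal w : hend 0 (polygonal w) = w.
Proof.
rewrite /hend /polygonal /=; set a := _ / 2; set b := _ * a.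
(* [a * a] is a quarter of the absolute value of [tpart w], and [b] has the opposite sign to
   [tpart w]. *)
have ab : - 4 * (a * b) = tpart w.
  have aa : a * a = `|tpart w| / 4.
    have e := sqr_sqrtr (normr_ge0 (tpart w)); rewrite -[in RHS]e /a.
    by field.
  rewrite [RHS]numEsg (_ : - 4 * (a * b) = Num.sg (tpart w) * (4 * (a * a))).
    by rewrite aa; field.
  by rewrite /b; ring.
rewrite heis_mul0r !scaleNr.
rewrite -(heis_mulA (hpt (hpart w))) -(heis_mulA (hpt (hpart w))).
rewrite -(heis_mulA (hpt (hpart w))) hpt_commutator symplZl.
have -> : hpt (a *: ex) = a *: hpt ex by rewrite /hpt scale_row_mx scaler0.
have -> : sympl ey (a *: hpt ex) = - a.
  rewrite symplZr /sympl (bigD1 j)//= big1 => [|k kj]; rewrite !row_mxEl !mxE.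
    by rewrite !eqxx/= eq_rlshift eq_lrshift/=; ring.
  by rewrite !eq_lshift !eq_rshift eq_lrshift eq_rlshift (negbTE kj) !andbF; ring.
rewrite (_ : 4 * (b * - a) = tpart w); last by rewrite -ab; ring.
rewrite heis_mulE hpart_row [sympl _ _]big1 => [|k _]; last by rewrite !mxE; ring.
rewrite mulr0 raddf0 row_mx0 addr0 /hpt add_row_mx add0r addr0.
rewrite -[RHS]hsubmxK; congr row_mx.
by apply/rowP => i; rewrite (ord1 i) [LHS]mxE eqxx mulr1n.
Qed.

(** The square root in the sides undoes the quadratic scaling of the last coordinate. *)
Lemma polygonal_dilation (e : R) w : 0 < e ->
  polygonal (dilation e w) = [seq e *: v | v <- polygonal w].
Proof.
move=> e0; rewrite /polygonal dilationE hpart_row.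
have -> : tpart (row_mx (e *: hpart w) (e ^+ 2 * tpart w)%:M : H) = e ^+ 2 * tpart w.
  by rewrite tpartE row_mxEr mxE eqxx mulr1n.
rewrite normrM (ger0_norm (sqr_ge0 e)) sqrtrM ?sqr_ge0// sqrtr_sqr (gtr0_norm e0).
rewrite sgrM sgrX (gtr0_sg e0) expr1n mul1r /= !scalerA.
by do ![congr (_ :: _)]; congr (_ *: _); ring.
Qed.

End polygonal.

End horizontal_paths.

(** * The L^s estimate along a polygonal path *)

Section segment_estimate.
Context {R : realType} {n : nat}.
Local Notation H := (heis R n).
Local Notation mu := (@lebesgue_row R (n + n + 1)).
Variables (s : R) (Omega : set H) (F : H -> R) (G : H -> 'rV[R]_(n + n)).
Hypotheses (s1 : 1 <= s) (LF : F \in Lfun mu s%:E)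
  (LG : forall i, (fun p => G p ord0 i) \in Lfun mu s%:E).
Local Open Scope ereal_scope.
Hypothesis weakF : forall i phi, smooth phi -> test_function Omega phi ->
  \int[mu]_p (F p * 'D_(hframe i p) phi p)%:E = - \int[mu]_p (G p ord0 i * phi p)%:E.

Let s0 : (0 < s)%R. Proof. exact: lt_le_trans s1. Qed.

Lemma compact_sub_cbox (K : set H) : compact K -> exists a b, K `<=` cbox a b.
Proof.
move=> /compact_bounded[M [_ KM]].
exists (const_mx (- (`|M| + 1)))%R, (const_mx (`|M| + 1))%R => p Kp i.
rewrite !mxE -ler_norml (le_trans (norm_coord_le _ _))// KM//.
by rewrite ltr_pwDr// ler_norm.
Qed.

Let Gv v p : R := dotp (G p) v.

Lemma Lfun_dotp v : Gv v \in Lfun mu s%:E.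
Proof.
have s1' : 1 <= s%:E by rewrite lee_fin.
have [L0 LD] := Lfun_addr_closed mu s1'.
rewrite /Gv /dotp; elim: (index_enum _) => [|i t IH].
  by under eq_fun do rewrite big_nil.
under eq_fun do rewrite big_cons.
apply: (LD _ _ _ IH).
exact: (Lfun_scale (v ord0 i) s1 (LG i)).
Qed.

(** The field of [v] is a combination of the frame with constant coefficients; compact support gives
    the integrability that lets the sum leave the integral. *)
Lemma weak_dotp v phi : smooth phi -> test_function Omega phi ->
  \int[mu]_p (F p * hderive v phi p)%:E = - \int[mu]_p (Gv v p * phi p)%:E.
Proof.
move=> sphi tphi; have [_ cK _] := tphi; set K := closure _ in cK.
have clK : closed K by exact: closed_closure.
have phi_out p : ~ K p -> phi p = 0%R.
  by move=> nKp; apply: contrapT => /eqP pp; apply: nKp; exact: subset_closure.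
have [a [b Kab]] := compact_sub_cbox cK.
have mB : measurable (cbox a b) by exact: measurable_cbox.
have Bfin := lebesgue_row_cbox_lty a b.
have hout u p : ~ cbox a b p -> hderive u phi p = 0%R.
  by move=> nB; apply: (@hderive_out _ _ u phi p K clK phi_out) => /Kab.
have pout p : ~ cbox a b p -> phi p = 0%R by move=> nB; apply: phi_out => /Kab.
have I1 u : mu.-integrable setT (fun p => (F p * hderive u phi p)%:E).
  have cu := @continuous_hderive _ _ u phi sphi.
  have [M HM] := compact_support_bounded (@compact_cbox _ _ a b) cu (hout u).
  have := integrable_mul_bounded s1 0%R LF (continuous_measurable_row cu) mB Bfin HM (hout u).
  by under eq_fun do rewrite heis_mulr0.
have cphi := smooth_continuous sphi.
have [M HM] := compact_support_bounded (@compact_cbox _ _ a b) cphi pout.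
have I2 i : mu.-integrable setT (fun p => (G p ord0 i * phi p)%:E).
  have := integrable_mul_bounded s1 0%R (LG i) (continuous_measurable_row cphi) mB Bfin HM pout.
  by under eq_fun do rewrite heis_mulr0.
have hE p : hderive v phi p = (\sum_i v ord0 i * hderive (delta_mx ord0 i) phi p)%R.
  rewrite /hderive hvec_sum smooth_deriveD//; apply: eq_bigr => i _.
  by rewrite hframeE.
transitivity (\int[mu]_p \sum_i (v ord0 i)%:E * (F p * hderive (delta_mx ord0 i) phi p)%:E).
  apply: eq_integral => p _; rewrite hE mulr_sumr -sumEFin; apply: eq_bigr => i _.
  by rewrite -EFinM mulrCA.
rewrite integral_sum//; last by move=> i; exact: integrableZl.
transitivity (- \int[mu]_p \sum_i (v ord0 i)%:E * (G p ord0 i * phi p)%:E); last first.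
  congr (- _); apply: eq_integral => p _; rewrite /Gv /dotp mulr_suml -sumEFin.
  by apply: eq_bigr => i _; rewrite -EFinM; congr (_%:E); ring.
rewrite integral_sum//; last by move=> i; exact: integrableZl.
rewrite -fin_num_sumeN; last first.
  by move=> i _; apply: integrable_fin_num => //; exact: integrableZl.
apply: eq_bigr => i _; rewrite !integralZl// -muleN; congr (_ * _).
rewrite -(weakF i sphi tphi); apply: eq_integral => p _.
by rewrite /hderive hframeE.
Qed.

Variable A : set H.
Hypothesis oA : open A.
Let mA : measurable A. Proof. exact: open_measurable_row. Qed.

Lemma integral_indicM (f : H -> R) :
  \int[mu]_(p in A) (f p)%:E = \int[mu]_p (f p * \1_A p)%:E.
Proof.
rewrite integral_mkcond; apply: eq_integral => p _; rewrite patchE indicE.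
by case: ifP => _; rewrite ?mulr1 ?mulr0.
Qed.

(** The increment of [F] minus [g] is the average over [c] of [Gv] minus [g], the weights having
    total mass 1. Jensen's inequality moves the power inside the average, and Tonelli reduces the
    estimate to a fixed [c]. *)
Lemma integral_segment_le v (q : H) (g : H -> R) (C : R) :
  measurable_fun setT g -> (0 <= C)%R ->
  (forall p (c : R), A p -> (0 <= c <= 1)%R ->
     Omega (heis_mul (heis_mul p q) (hpt (c *: v)))) ->
  (forall c : R, (0 <= c <= 1)%R ->
     \int[mu]_(p in A)
       (`|Gv v (heis_mul (heis_mul p q) (hpt (c *: v))) - g p| `^ s)%:E <= C%:E) ->
  \int[mu]_(p in A)
     (`|F (heis_mul (heis_mul p q) (hpt v)) - F (heis_mul p q) - g p| `^ s)%:E <= C%:E.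
Proof.
move=> mg C0 AO GC.
have mF := Lfun_measurable LF; have mG := Lfun_measurable (Lfun_dotp v).
have mpow (d : measure_display) (T : measurableType d) (f : T -> R) :
    measurable_fun setT f -> measurable_fun setT (fun x => `|f x| `^ s)%R.
  by move=> mf; apply: (measurableT_comp (measurable_powR _)); exact: measurableT_comp.
have mind : measurable_fun setT (\1_A : H -> R) by exact: measurable_indic.
pose fl (z : H * measurableTypeR R) : H := heis_mul (heis_mul z.1 q) (hpt (z.2 *: v)).
have mfl : measurable_fun setT fl.
  apply: measurable_heis_mul.
    exact: (measurableT_comp (measurable_mulr q) measurable_fst).
  apply: measurable_hpt; apply: measurable_row_scale; first exact: measurable_snd.
  exact: measurable_cst.
pose h (z : H * measurableTypeR R) := (`|Gv v (fl z) - g z.1| `^ s * \1_A z.1)%R.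
have mh : measurable_fun setT h.
  apply: measurable_funM; last exact: (measurableT_comp mind measurable_fst).
  apply: mpow; apply: measurable_funB; first exact: (measurableT_comp mG mfl).
  exact: (measurableT_comp mg measurable_fst).
have mhE : measurable_fun setT (EFin \o h) by exact/measurable_EFinP.
have h0 z : 0 <= (EFin \o h) z by rewrite lee_fin mulr_ge0// powR_ge0.
(* [B] consists of the products of points of [A] with [q]; the flow identity on [B] is pulled back
   to [A] by translation. *)
pose B := (fun p => heis_mul p (- q)) @^-1` A.
have oB : open B by exact: open_mulr_preimage.
have BO p (c : R) : B p -> (0 <= c <= 1)%R -> Omega (heis_mul p (hpt (c *: v))).
  move=> Bp c01; have := AO _ _ Bp c01.
  by rewrite -(heis_mulA p) heis_mulNr heis_mulr0.
have ae1 := ae_mulr q (ae_flow s1 LF (Lfun_dotp v) (@weak_dotp v) oB BO).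
rewrite integral_indicM.
apply: (@le_trans _ _ (\int[mu]_p \int[unif]_c (EFin \o h) (p, c))); last first.
  rewrite (fubini_tonelli (EFin \o h))//.
  apply: integral_unif_le => //.
  - exact: (measurable_fun_fubini_tonelli_G (EFin \o h)).
  - by move=> c; apply: integral_ge0 => p _; exact: h0.
  - by move=> c c01; rewrite -integral_indicM; exact: GC.
apply: ae_ge0_le_integral => //.
- apply/measurable_EFinP; apply: measurable_funM => //; apply: mpow.
  apply: measurable_funB => //; apply: measurable_funB.
    apply: (measurableT_comp mF).
    exact: (measurableT_comp (measurable_mulr (hpt v)) (measurable_mulr q)).
  exact: (measurableT_comp mF (measurable_mulr q)).
- by move=> p _; apply: integral_ge0 => c _; exact: h0.
- exact: (measurable_fun_fubini_tonelli_F (EFin \o h)).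
apply: filterS ae1 => p Pp _.
have [Ap|nAp] := pselect (A p); last first.
  rewrite indicE memNset// mulr0; apply: integral_ge0 => c _; exact: h0.
have [|iG EG] := Pp; first by rewrite /B/= -heis_mulA heis_mulrN heis_mulr0.
rewrite scale1r in EG.
under eq_integral do rewrite /= /h /= indicE mem_set// mulr1.
rewrite indicE mem_set// mulr1 /fl /=.
have unifT : unif [set: measurableTypeR R] = 1 by exact: probability_setT unif.
have icst : unif.-integrable setT (fun c : measurableTypeR R => (g p)%:E).
  by apply: finite_measure_integrable_cst.
pose k (c : measurableTypeR R) := (Gv v (heis_mul (heis_mul p q) (hpt (c *: v))) - g p)%R.
have Ek : (F (heis_mul (heis_mul p q) (hpt v)) - F (heis_mul p q) - g p)%:E =
    \int[unif]_c (k c)%:E.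
  rewrite EFinB EG.
  transitivity (\int[unif]_c (Gv v (heis_mul (heis_mul p q) (hpt (c *: v))))%:E -
    \int[unif]_c (g p)%:E).
    by congr (_ - _); rewrite integral_cst//= unifT mule1.
  by rewrite -(integralB_EFin measurableT iG icst).
have mk : measurable_fun setT k.
  apply: measurable_funB; last exact: measurable_cst.
  exact: (measurableT_comp mG (measurableT_comp mfl (pair1_measurable p))).
apply: le_trans (powR_integral_unif_le s1 mk).
rewrite -poweR_EFin; apply: gt0_ler_poweR; first exact: ltW.
- by rewrite in_itv/= leey lee_fin normr_ge0.
- by rewrite in_itv/= leey integral_ge0.
rewrite -abse_EFin Ek.
by apply: le_abse_integral => //; exact/measurable_EFinP.
Qed.

Variable (cf : H -> 'rV[R]_(n + n)).
Hypothesis mcf : forall i, measurable_fun setT (fun p => cf p ord0 i).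

Lemma measurable_dotp d (T : measurableType d) (u w : T -> 'rV[R]_(n + n)) :
  (forall i, measurable_fun setT (fun p => u p ord0 i)) ->
  (forall i, measurable_fun setT (fun p => w p ord0 i)) ->
  measurable_fun setT (fun p => dotp (u p) (w p)).
Proof. by move=> mu' mw; apply: measurable_sum => i; exact: measurable_funM. Qed.

Lemma measurable_enorm d (T : measurableType d) (u : T -> 'rV[R]_(n + n)) :
  (forall i, measurable_fun setT (fun p => u p ord0 i)) ->
  measurable_fun setT (fun p => enorm (u p)).
Proof.
move=> mu'; apply: (@measurableT_comp _ _ _ _ _ _ (@Num.sqrt R)).
  by apply: continuous_measurable_fun; exact: sqrt_continuous.
exact: measurable_dotp.
Qed.

Let mG i : measurable_fun setT (fun p => G p ord0 i).
Proof. exact: Lfun_measurable (LG i). Qed.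

Let mdiff q i : measurable_fun setT (fun p : H => (G (heis_mul p q) - cf p)%R ord0 i).
Proof.
under eq_fun do rewrite !mxE.
by apply: measurable_funB => //; exact: (measurableT_comp (mG i) (measurable_mulr q)).
Qed.

(** With [dotp (cf p) v] for [g p], Cauchy-Schwarz extracts the factor [enorm v] at every time
    [c]. *)
Lemma Lsnorm_segment_le v (q : H) (M : R) : (0 <= M)%R ->
  (forall p (c : R), A p -> (0 <= c <= 1)%R ->
     Omega (heis_mul (heis_mul p q) (hpt (c *: v)))) ->
  (forall c : R, (0 <= c <= 1)%R ->
     Lsnorm s A (fun p => enorm (G (heis_mul p (heis_mul q (hpt (c *: v)))) - cf p))
       <= M%:E) ->
  Lsnorm s A (fun p => F (heis_mul p (heis_mul q (hpt v))) - F (heis_mul p q) -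
     dotp (cf p) v)%R <= (enorm v * M)%:E.
Proof.
move=> M0 AO GM; rewrite (Lsnorm_le_powR A s1) ?mulr_ge0 ?enorm_ge0//.
under eq_integral do rewrite heis_mulA.
apply: (@integral_segment_le v q (fun p => dotp (cf p) v)) => //.
- by apply: measurable_dotp => // i; exact: measurable_cst.
- exact: powR_ge0.
move=> c c01; have := GM c c01; rewrite (Lsnorm_le_powR A s1)// => GMc.
rewrite powRM ?enorm_ge0// EFinM.
apply: le_trans (lee_wpmul2l _ GMc); last by rewrite lee_fin powR_ge0.
set q' := heis_mul q _ in GMc *.
have me : measurable_fun setT (fun p : H => enorm (G (heis_mul p q') - cf p)).
  exact: measurable_enorm (mdiff q').
have mk : measurable_fun setT (fun p : H =>
    Gv v (heis_mul (heis_mul p q) (hpt (c *: v))) - dotp (cf p) v)%R.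
  apply: measurable_funB.
    apply: (measurableT_comp (Lfun_measurable (Lfun_dotp v))).
    exact: (measurableT_comp (measurable_mulr (hpt (c *: v))) (measurable_mulr q)).
  by apply: measurable_dotp => // i; exact: measurable_cst.
have me' := measurable_funTS (D := A) (measurable_norm_powR s me).
rewrite -(ge0_integralZl mu mA me'); first last.
- by rewrite lee_fin powR_ge0.
- by move=> p _; rewrite lee_fin powR_ge0.
apply: ge0_le_integral => //.
- apply: measurable_funTS; apply: (measurable_norm_powR s mk).
- apply: measurable_funTS; apply: measurable_funeM; exact: (measurable_norm_powR s me).
- move=> p Ap; rewrite -EFinM lee_fin -powRM ?enorm_ge0//.
  rewrite ge0_ler_powR ?nnegrE ?mulr_ge0 ?enorm_ge0// ?(ltW s0)//.
  rewrite /Gv -heis_mulA -/q' [X in (_ <= X)%R]mulrC.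
  rewrite (_ : dotp _ v - dotp _ v = dotp (G (heis_mul p q') - cf p) v)%R.
    by rewrite (ger0_norm (enorm_ge0 _)) dotp_le_enorm.
  by rewrite dotpDl -(scaleN1r (cf p)) dotpZl mulN1r.
Qed.

(** The increments telescope over the vertices and Minkowski's inequality adds the segment
    estimates, with the same [M] throughout. *)
Lemma Lsnorm_path_le (vs : seq 'rV[R]_(n + n)) (q : H) (M : R) : (0 <= M)%R ->
  hpath [set q' | (forall p, A p -> Omega (heis_mul p q')) /\
    Lsnorm s A (fun p => enorm (G (heis_mul p q') - cf p)) <= M%:E] q vs ->
  Lsnorm s A (fun p => F (heis_mul p (hend q vs)) - F (heis_mul p q) -
     dotp (cf p) (\sum_(v <- vs) v))%R <= ((\sum_(v <- vs) enorm v) * M)%:E.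
Proof.
move=> M0; elim: vs q => [|v vs IH] q /=.
  move=> _; rewrite !big_nil mul0r (_ : (fun _ => _) = cst 0%R) ?Lsnorm0//.
  by apply/funext => p; rewrite dotp0r !subrr.
move=> [Qv Qvs]; rewrite !big_cons mulrDl EFinD.
have mFr (r : H) : measurable_fun setT (fun p : H => F (heis_mul p r)).
  exact: (measurableT_comp (Lfun_measurable LF) (measurable_mulr r)).
have mcd (u : 'rV[R]_(n + n)) : measurable_fun setT (fun p : H => dotp (cf p) u).
  by apply: measurable_dotp => // i; exact: measurable_cst.
set q1 := heis_mul q (hpt v); rewrite -/q1 in Qvs.
have -> : (fun p => F (heis_mul p (hend q1 vs)) - F (heis_mul p q) -
      dotp (cf p) (v + \sum_(j <- vs) j))%R =
    (fun p => (F (heis_mul p q1) - F (heis_mul p q) - dotp (cf p) v) +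
      (F (heis_mul p (hend q1 vs)) - F (heis_mul p q1) -
       dotp (cf p) (\sum_(j <- vs) j)))%R.
  by apply/funext => p; rewrite dotpDr; ring.
apply: le_trans (LsnormD s1 mA _ _) _.
- by apply: measurable_funB => //; exact: measurable_funB.
- by apply: measurable_funB => //; exact: measurable_funB.
apply: leeD; last exact: IH.
apply: Lsnorm_segment_le => // [p c Ap c01|c c01].
  by rewrite -heis_mulA; have [+ _] := Qv c c01; exact.
by have [] := Qv c c01.
Qed.

End segment_estimate.

(** * The Carnot-Caratheodory distance *)

Lemma is_derive_comp_scale {R : realType} {V : normedModType R} (f : R -> V)
    (l t : R) (df : V) :
  is_derive (l * t) 1 f df -> is_derive t 1 (fun x => f (l * x)) (l *: df).
Proof.
move=> Df; have Dm : is_derive t (1 : R) (fun x : R => l * x) l.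
  have := is_deriveZ l (is_derive_id t (1 : R)).
  by rewrite /GRing.scale/= mulr1.
have df1 : differentiable f (l * t) by apply/derivable1_diffP; exact: ex_derive.
have dm1 : differentiable (fun x : R => l * x) t.
  by apply/derivable1_diffP; exact: ex_derive.
have dc : differentiable (f \o (fun x : R => l * x)) t by exact: differentiable_comp.
apply: DeriveDef; first exact/derivable1_diffP.
rewrite deriveE// [LHS](congr1 (fun g => g (1 : R)) (diff_comp dm1 df1))/=.
rewrite -(deriveE (1 : R) dm1) derive_val.
by rewrite -[X in 'd f _ X]mulr1 linearZ/= -(deriveE (1 : R) df1) derive_val.
Qed.

Lemma is_derive_line {R : realType} {V : normedModType R} (a v : V) (l t : R) :
  is_derive t 1 (fun x : R => a + (x - l) *: v) v.
Proof.
have D : is_derive t (1 : R) (fun x : R => x - l) 1.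
  by apply: is_derive_eq; rewrite subr0.
have dk : differentiable (fun x : R => x - l) t.
  by apply/derivable1_diffP; exact: ex_derive.
have Dv : is_derive t (1 : R) (fun x : R => (x - l) *: v) v.
  apply: DeriveDef; first exact/derivable1_diffP/differentiableZl.
  rewrite deriveE; last exact: differentiableZl.
  by rewrite diffZl//= -(deriveE (1 : R) dk) derive_val scale1r.
by have := is_deriveD (is_derive_cst a t (1 : R)) Dv; rewrite add0r.
Qed.

Section metric.
Context {R : realType} {n : nat}.
Local Notation H := (heis R n).

Lemma frame_vertical i (p : H) : frame (rshift (n + n) i) p = row_mx 0 1%:M.
Proof.
by rewrite /frame (unsplitK (inr i)) /heis_pt row_mx0.
Qed.

Lemma frame_coord_hvec h (p : H) : frame_coord p (hvec h p) = row_mx h 0.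
Proof.
set M := \matrix_i frame i p.
have ME : M = block_mx 1%:M (\col_i (2 * sympl (delta_mx ord0 i) p)) 0 1%:M.
  apply/matrixP => i k; rewrite [LHS]mxE.
  case: (split_ordP i) => {}i ->; case: (split_ordP k) => {}k ->.
  - rewrite -/(hframe i p) hframeE block_mxEul row_mxEl !mxE eqxx/=.
    by rewrite eq_sym.
  - by rewrite -/(hframe i p) hframeE block_mxEur row_mxEr (ord1 k) !mxE eqxx mulr1n.
  - by rewrite frame_vertical block_mxEdl row_mxEl !mxE.
  - by rewrite frame_vertical block_mxEdr row_mxEr (ord1 i) (ord1 k).
(* The matrix is unit triangular by blocks; [invmx] is a true inverse only for an invertible
   matrix. *)
have MU : M \in unitmx by rewrite unitmxE ME det_ublock !det1 mulr1 unitr1.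
rewrite /frame_coord -/M -[RHS](mulmxK MU); congr (_ *m _).
rewrite ME mul_row_block mulmx1 !mulmx0 mul0mx !addr0; congr row_mx.
apply/rowP => i; rewrite (ord1 i) !mxE eqxx mulr1n.
have := congr1 (fun z : H => z ord0 (rshift (n + n) ord0)) (hvec_sum h p).
rewrite /hvec row_mxEr mxE eqxx mulr1n => ->; rewrite summxE.
by apply: eq_bigr => k _; rewrite hframeE mxE row_mxEr !mxE eqxx mulr1n.
Qed.

Lemma metric_hvec h (p : H) : metric p (hvec h p) (hvec h p) = dotp h h.
Proof.
rewrite /metric frame_coord_hvec /dotp big_split_ord/= [X in _ + X]big1 ?addr0.
  by apply: eq_bigr => i _; rewrite row_mxEl.
by move=> i _; rewrite row_mxEr mxE mulr0.
Qed.

Lemma horizontal_hvec h (p : H) : horizontal p (hvec h p).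
Proof. by exists h; exact: hvec_sum. Qed.

End metric.

Section unit_curves.
Context {R : realType} {n : nat}.
Local Notation H := (heis R n).
Implicit Types (p q : H) (v : 'rV[R]_(n + n)).

(** A horizontal curve of length at most [l]: the speed is at most 1 on [0,l]. The Lipschitz bound
    supplies absolute continuity, and the exceptional set is finite so that a concatenation only
    adds a corner. *)
Definition unit_curve p q (l : R) : Prop :=
  exists (G : R -> H) (C : R) (S : seq R),
  [/\ G 0 = p, G l = q,
     forall a b, 0 <= a -> a <= b -> b <= l -> `|G b - G a| <= C * (b - a) &
     forall t, 0 < t < l -> t \notin S ->
       exists2 h, enorm h <= 1 & is_derive t 1 G (hvec h (G t))].

Lemma unit_curve0 p : unit_curve p p 0.
Proof.
exists (cst p), 0, [::]; split=> // [a b _ _ _|t /andP[t0 /(lt_trans t0)]].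
  by rewrite subrr normr0 mul0r.
by rewrite ltxx.
Qed.

(** The new segment is run at unit speed along [v] divided by its norm; a zero vector, which cannot
    be normalised, adds nothing. *)
Lemma unit_curve_extend p q l v : 0 <= l -> unit_curve p q l ->
  unit_curve p (heis_mul q (hpt v)) (l + enorm v).
Proof.
move=> l0 pq; have [v0|v0] := eqVneq (enorm v) 0.
  rewrite (enorm_eq0 v0) /hpt row_mx0 heis_mulr0.
  by rewrite -(enorm_eq0 v0) v0 addr0.
have {v0} N0 : 0 < enorm v by rewrite lt0r v0 enorm_ge0.
move: pq => [G [C [S [G0 Gl LG DG]]]].
set N := enorm v in N0 *; pose u := N^-1 *: v.
have u1 : enorm u = 1 by rewrite enormZ ger0_norm ?invr_ge0 ?(ltW N0)// mulVf ?gt_eqF.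
have vE : v = N *: u by rewrite scalerA divff ?gt_eqF// scale1r.
pose G' t := if t <= l then G t else q + (t - l) *: hvec u q.
exists G', (Num.max C `|hvec u q|), (l :: S); split.
- by rewrite /G' l0.
- rewrite /G' -subr_ge0 opprD addNKr oppr_ge0 leNgt N0/= addrAC subrr add0r.
  by rewrite vE heis_mul_hptZ.
- move=> a b a0 ab bl; rewrite /G'.
  have big c : 0 <= c -> C * c <= Num.max C `|hvec u q| * c.
    by move=> c0; rewrite ler_wpM2r// le_max lexx.
  have big' c : 0 <= c -> c * `|hvec u q| <= Num.max C `|hvec u q| * c.
    by move=> c0; rewrite mulrC ler_wpM2r// le_max lexx orbT.
  have [bl'|lb] := leP b l.
    rewrite (le_trans ab bl') (le_trans (LG _ _ a0 ab bl'))// big// subr_ge0//.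
  have [al|la] := leP a l.
    rewrite addrAC (le_trans (ler_normD _ _))//.
    rewrite (_ : b - a = (l - a) + (b - l)); last by ring.
    rewrite mulrDr lerD//.
      have := LG _ _ a0 al (lexx _); rewrite Gl => /le_trans; apply.
      by apply: big; rewrite subr_ge0.
    have bl0 : 0 <= b - l by rewrite subr_ge0 ltW.
    by rewrite normrZ (ger0_norm bl0) big'.
  rewrite opprD addrACA subrr add0r -scalerBl opprB addrA subrK normrZ.
  have ab0 : 0 <= b - a by rewrite subr_ge0.
  by rewrite (ger0_norm ab0) big'.
- move=> t /andP[t0 tl]; rewrite inE negb_or => /andP[tnl tS].
  have [lt|lt|/eqP] := ltgtP t l; last by rewrite (negbTE tnl).
    have [|h h1 Dh] := DG t _ tS; first by rewrite t0.
    exists h => //; rewrite {2}/G' (ltW lt).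
    apply: near_eq_is_derive Dh.
    by near=> x; rewrite /G' ifT//; apply/ltW; near: x; exact: lt_nbhsl.
  exists u; first by rewrite u1.
  rewrite {2}/G' leNgt lt/= hvec_line.
  apply: (@near_eq_is_derive _ _ _ (fun x : R => q + (x - l) *: hvec u q)).
    near=> x; rewrite /G' ifF//; apply/negbTE; rewrite -ltNge; near: x.
    exact: lt_nbhsr.
  exact: is_derive_line.
Unshelve. all: by end_near. Qed.

(** Rescaling the time to [0,1] multiplies the speed by [l]. *)
Lemma ccdist_le p q l : 0 < l -> unit_curve p q l -> (ccdist p q <= l%:E)%E.
Proof.
move=> l0 [G [C [S [G0 Gl LG DG]]]].
pose g t := G (l * t).
(* The end points join the exceptional set, since nothing is known of the curve beyond them. *)
pose N := [set` [:: 0, 1 & [seq x / l | x <- S]]].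
have cN : countable N by apply: finite_set_countable; exact: finite_seq.
have N0 : lebesgue_measure N = 0%E by exact: countable_lebesgue_measure0.
have Dg t : 0 <= t <= 1 -> ~ N t ->
    exists2 h, enorm h <= l & is_derive t 1 g (hvec h (g t)).
  move=> /andP[t0 t1] /negP; rewrite /= !inE !negb_or => /and3P[t0' t1' tS].
  have [|/=|h h1 Dh] := DG (l * t).
  - apply/andP; split; first by rewrite mulr_gt0// lt0r t0'.
    by rewrite -[ltRHS]mulr1 ltr_pM2l// lt_neqAle t1'.
  - apply: contra tS => tS; apply/mapP; exists (l * t) => //.
    by rewrite mulrAC divff ?mul1r// gt_eqF.
  exists (l *: h); first by rewrite enormZ gtr0_norm// ger_pMr.
  by rewrite hvecZ; exact: is_derive_comp_scale.
apply: (@le_trans _ _ (curve_length g)); last first.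
  rewrite /curve_length integral_mkcond.
  set f := _ \_ _.
  have f0 t : (0 <= f t)%E by rewrite /f patchE; case: ifP => // _; rewrite lee_fin sqrtr_ge0.
  have fl t : ~ N t -> (f t <= ((cst l%:E) \_ `[0%R, 1%R]) t)%E.
    move=> Nt; rewrite /f !patchE; case: ifPn => // /set_mem/=.
    rewrite in_itv/= => t01; have [h h1 Dh] := Dg t t01 Nt.
    by rewrite derive1E derive_val metric_hvec lee_fin.
  (* The speed is not known to be measurable, so its integral is bounded through the simple
     functions below it, each at most the constant [l] almost everywhere. *)
  rewrite (ge0_integralTE _ f0); apply/ereal_supP => _ [h hf <-].
  rewrite -integralT_nnsfun.
  apply: (@le_trans _ _ (\int[lebesgue_measure]_x ((cst l%:E) \_ `[0%R, 1%R]) x)%E).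
    apply: ae_ge0_le_integral => //.
    - by move=> x _; rewrite lee_fin; exact: fun_ge0.
    - by apply/measurable_EFinP; exact: measurable_funPT.
    - by move=> x _; rewrite patchE; case: ifP => // _; rewrite lee_fin ltW.
    - apply/(measurable_restrictT _ (measurable_itv `[0%R, 1%R])).
      exact: (@measurable_cst _ _ _ _ _ l%:E).
    exists N; split => //; first exact: countable_measurable cN.
    move=> x /= nx; apply: contrapT => Nx; apply: nx => _.
    exact: le_trans (hf x) (fl x Nx).
  rewrite -integral_mkcond integral_cst//= lebesgue_measure_itv/= lte_fin ltr01.
  by rewrite oppr0 adde0 mule1.
apply: ereal_inf_lbound; exists g => //; split.
- move=> e e0; pose d := e / (l * (`|C| + 1)).
  have C1 : 0 < `|C| + 1 by rewrite ltr_wpDl.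
  exists d; first by rewrite divr_gt0// mulr_gt0.
  move=> k a b ab _; rewrite ltr_pdivlMr ?mulr_gt0// => /(le_lt_trans _); apply.
  rewrite mulr_suml ler_sum// => i _; have [ai aibi bi] := ab i.
  rewrite /g (le_trans (LG _ _ _ _ _))//.
  - by rewrite mulr_ge0// ltW.
  - by rewrite ler_pM2l.
  - by rewrite ger_pMr.
  rewrite -mulrBr mulrC -mulrA [leRHS]mulrCA ler_wpM2l ?(ltW l0)//.
  rewrite ler_wpM2l ?subr_ge0// (le_trans (ler_norm _))// lerDl//.
- by rewrite /g mulr0.
- by rewrite /g mulr1.
- exists N; split => //; first exact: countable_measurable cN.
  move=> t /= nt; apply: contrapT => Nt; apply: nt => t01.
  have [h h1 Dh] := Dg t t01 Nt; split; first exact: ex_derive.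
  by rewrite derive1E derive_val; exact: horizontal_hvec.
Qed.

(** The times spent in [Omega] are nonempty and open in [0,1], and closed because a limit outside
    [Omega] would be a boundary point; connectedness concludes. *)
Lemma segment_boundary (Omega : set H) (phi : R -> H) : open Omega ->
  continuous phi -> Omega (phi 0) ->
  (forall c, 0 <= c <= 1 -> ~ boundary Omega (phi c)) ->
  forall c, 0 <= c <= 1 -> Omega (phi c).
Proof.
move=> oO cphi O0 nb.
have [B1 B2] : `[0, 1]%classic `&` phi @^-1` Omega = `[0, 1]%classic /\ True.
  split=> //; apply: (@segment_connected R 0 1).
  - by exists 0; split => //=; rewrite in_itv/= lexx ler01.
  - by exists (phi @^-1` Omega) => //; apply: open_comp => // x _; exact: cphi.
  - exists (phi @^-1` closure Omega).
      exact: (preimage_closed (fun x _ => cphi x) (@closed_closure _ Omega)).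
    apply/seteqP; split=> c [c01 Oc]; split=> //; first exact: subset_closure.
    apply: contrapT => nO; apply: (nb c); first by rewrite /= in_itv in c01.
    by split => //= /interior_subset.
move=> c c01; have : `[0, 1]%classic c by rewrite /= in_itv.
by rewrite -B1 => -[].
Qed.

(** [l] records the length already travelled from [p]: the induction moves each segment from the sum
    into [l], and the total does not change. *)
Lemma hpath_set_dist (Omega A : set H) p q vs l : open Omega -> A p ->
  0 <= l -> unit_curve p q l -> Omega q ->
  ((l + \sum_(v <- vs) enorm v)%:E < set_dist A (boundary Omega))%E ->
  hpath Omega q vs.
Proof.
move=> oO Ap; elim: vs q l => [//|v vs IH] q l l0 pq Oq; rewrite big_cons addrA => ld.
have sum0 : 0 <= \sum_(v <- vs) enorm v by apply: sumr_ge0 => *; exact: enorm_ge0.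
have Ov c : 0 <= c <= 1 -> Omega (heis_mul q (hpt (c *: v))).
  apply: (@segment_boundary Omega (fun c => heis_mul q (hpt (c *: v)))) => //.
  - by move=> x; apply: continuous_comp; [exact: continuous_hptZ|exact: continuous_mull].
  - by rewrite scale0r /hpt row_mx0 heis_mulr0.
  move=> {}c /andP[c0 c1] bc.
  (* A segment of length 0 stays at [q], an interior point; otherwise the length is positive, as
     [ccdist_le] requires. *)
  have [v0|v0] := eqVneq (enorm (c *: v)) 0.
    move: bc; rewrite (enorm_eq0 v0) /hpt row_mx0 heis_mulr0 => -[_]; apply.
    by apply: open_nbhs_nbhs; split.
  have lc : 0 < l + enorm (c *: v) by rewrite ltr_wpDl// lt0r v0 enorm_ge0.
  have := ccdist_le lc (unit_curve_extend (c *: v) l0 pq).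
  apply/negP; rewrite -ltNge; apply: lt_le_trans (_ : set_dist A (boundary Omega) <= _)%E.
    apply: le_lt_trans ld; rewrite lee_fin -addrA lerD2l enormZ ger0_norm//.
    by rewrite (le_trans (ler_piMl (enorm_ge0 _) c1))// lerDl.
  by apply: ereal_inf_lbound; exists (p, heis_mul q (hpt (c *: v))).
split => //; apply: (IH _ (l + enorm v)) => //.
- by rewrite addr_ge0 ?enorm_ge0.
- exact: unit_curve_extend.
- by have := Ov 1; rewrite scale1r; apply; rewrite ler01 lexx.
Qed.

End unit_curves.

(** * Difference quotients *)

Section Lsnorm_enorm.
Context {R : realType} {n : nat}.
Local Notation H := (heis R n).
Local Notation mu := (@lebesgue_row R (n + n + 1)).
Variables (s : R) (A : set H).
Hypotheses (s1 : 1 <= s) (mA : measurable A).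

Lemma Lsnorm_le_Lnorm (u : H -> R) : measurable_fun setT u ->
  (Lsnorm s A u <= 'N[mu]_s%:E[EFin \o u])%E.
Proof.
move=> mu'; apply: (ge0_Lnorm_le s1) => //; first exact: measurable_patch.
by move=> p; rewrite patchE; case: ifP => // _; rewrite normr0.
Qed.

Lemma Lsnorm_enorm_le (u : H -> 'rV[R]_(n + n)) :
  (forall i, measurable_fun setT (fun p => u p ord0 i)) ->
  (Lsnorm s A (fun p => enorm (u p)) <=
   \sum_i 'N[mu]_s%:E[EFin \o (fun p => u p ord0 i)])%E.
Proof.
move=> mu'; have mn i : measurable_fun setT (fun p : H => `|u p ord0 i|%R).
  exact: measurableT_comp.
apply: (@le_trans _ _ (Lsnorm s A (fun p => \sum_i `|u p ord0 i|)%R)).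
  apply: (Lsnorm_le s1 mA); first exact: measurable_enorm.
    exact: measurable_sum.
  move=> p _; rewrite !ger0_norm ?enorm_ge0 ?sumr_ge0//.
  exact: enorm_le_sum.
elim: (index_enum _) => [|i t IH].
  under (eq_Lsnorm s) do rewrite big_nil.
  by rewrite big_nil (Lsnorm0 A s1).
rewrite big_cons; under (eq_Lsnorm s) do rewrite big_cons.
apply: le_trans (LsnormD s1 mA _ _) _ => //; first exact: measurable_sum.
rewrite leeD// (le_trans (Lsnorm_le_Lnorm (mn i)))// (ge0_Lnorm_le s1)//.
by move=> p; rewrite normr_id.
Qed.

End Lsnorm_enorm.

Section difference_quotient.
Context {R : realType} {n : nat}.
Local Notation H := (heis R n).
Local Notation mu := (@lebesgue_row R (n + n + 1)).
Variables (j : 'I_n) (s : R) (Omega : set H) (f : H -> R).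
Variables (gradf : H -> 'rV[R]_(n + n)) (A : set H).
Hypotheses (s1 : 1 <= s) (oO : open Omega) (Lf : inL s Omega f).
Hypotheses (hgradf : is_hgrad s Omega f gradf).
Hypotheses (oA : open A) (AO : A `<=` Omega).

Let mA : measurable A. Proof. exact: open_measurable_row. Qed.
Let mO : measurable Omega. Proof. exact: open_measurable_row. Qed.

(** Extension by 0 yields functions in L^s of the whole space. [G] need not be a gradient of [F]
    across the boundary, but test functions supported in [Omega] do not see this. *)
Let F : H -> R := f \_ Omega.
Let G (p : H) : 'rV[R]_(n + n) := \row_i ((fun q => gradf q ord0 i) \_ Omega) p.

Let GE p : Omega p -> G p = gradf p.
Proof. by move=> Op; apply/rowP => i; rewrite mxE patchE mem_set. Qed.

Let G0 p : ~ Omega p -> G p = 0.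
Proof. by move=> Op; apply/rowP => i; rewrite !mxE patchE memNset. Qed.

Let LG i : (fun p => G p ord0 i) \in Lfun mu s%:E.
Proof. by under eq_fun do rewrite mxE; have [] := hgradf i. Qed.

Let mG i : measurable_fun setT (fun p => G p ord0 i).
Proof. exact: Lfun_measurable (LG i). Qed.

Let mF : measurable_fun setT F. Proof. exact: Lfun_measurable Lf. Qed.

Let weakF i (phi : H -> R) : smooth phi -> test_function Omega phi ->
  (\int[mu]_p (F p * 'D_(hframe i p) phi p)%:E = - \int[mu]_p (G p ord0 i * phi p)%:E)%E.
Proof.
move=> _ tphi; have [_ /(_ phi tphi)] := hgradf i.
rewrite integral_mkcond [in RHS]integral_mkcond => E.
transitivity (\int[mu]_x ((fun p => (f p * 'D_(hframe i p) phi p)%:E) \_ Omega) x)%E.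
  apply: eq_integral => p _; rewrite /F !patchE.
  by case: ifP => // _; rewrite mul0r.
rewrite E; congr (- _)%E; apply: eq_integral => p _; rewrite /G mxE !patchE.
by case: ifP => // _; rewrite mul0r.
Qed.

Let kappa (w : H) := enorm (hpart w) + 2 * Num.sqrt `|tpart w|.

Let kappa_ge0 w : 0 <= kappa w.
Proof. by rewrite addr_ge0 ?enorm_ge0// mulr_ge0 ?sqrtr_ge0. Qed.

Let sum_enorm_polygonal eps w : 0 < eps ->
  \sum_(v <- polygonal j (dilation eps w)) enorm v <= eps * kappa w.
Proof.
move=> e0; rewrite polygonal_dilation// big_map.
under eq_bigr do rewrite enormZ gtr0_norm//.
by rewrite -mulr_sumr ler_pM2l// enorm_polygonal.
Qed.

Let hpath_polygonal eps w : 0 < eps ->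
  ((eps * kappa w)%:E < set_dist A (boundary Omega))%E ->
  hpath [set q' | forall p, A p -> Omega (heis_mul p q')] 0
    (polygonal j (dilation eps w)).
Proof.
move=> e0 ek; apply: hpath_mull => p Ap; rewrite heis_mulr0.
apply: (hpath_set_dist oO Ap (lexx 0) (unit_curve0 p) (AO Ap)).
by apply: le_lt_trans ek; rewrite lee_fin add0r sum_enorm_polygonal.
Qed.

(** The path estimate divided by [eps]: the length of the path is at most [eps * kappa w], so [eps]
    cancels. *)
Let diff_quotient_le (cf : H -> 'rV[R]_(n + n)) eps w M :
  (forall i, measurable_fun setT (fun p => cf p ord0 i)) ->
  0 < eps -> 0 <= M ->
  ((eps * kappa w)%:E < set_dist A (boundary Omega))%E ->
  hpath [set q' | (Lsnorm s A (fun p => enorm (G (heis_mul p q') - cf p)) <= M%:E)%E]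
    0 (polygonal j (dilation eps w)) ->
  (Lsnorm s A (fun p => diff_quotient f w eps p - dotp (cf p) (hpart w))%R <=
   (kappa w * M)%:E)%E.
Proof.
move=> mcf e0 M0 ek hM; have hO := hpath_polygonal e0 ek.
have := Lsnorm_path_le s1 Lf LG weakF oA mcf M0 (hpathI hO hM).
rewrite hend_polygonal sum_polygonal => hle.
set u := (fun p => _) in hle.
have mu' : measurable_fun setT u.
  apply: measurable_funB.
    by apply: measurable_funB; exact: (measurableT_comp mF (measurable_mulr _)).
  by apply: measurable_dotp => // i; exact: measurable_cst.
have Oend p : A p -> Omega (heis_mul p (dilation eps w)).
  have := hpath_hend _ hO; rewrite hend_polygonal; apply => q Aq.
  by rewrite heis_mulr0; exact: AO.
rewrite (@eq_Lsnorm _ _ s A _ (fun p => eps^-1 * u p)%R); last first.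
  move=> p Ap; rewrite /u /F !patchE mem_set; last exact: Oend.
  rewrite heis_mulr0 mem_set; last exact: AO.
  rewrite dilationE hpart_row dotpZr /diff_quotient -dilationE.
  by field; rewrite gt_eqF.
rewrite Lsnorm_scale// gtr0_norm ?invr_gt0//.
apply: (@le_trans _ _ ((eps^-1)%:E * ((eps * kappa w) * M)%:E)%E).
  rewrite lee_wpmul2l ?lee_fin ?invr_ge0 ?(ltW e0)//; apply: le_trans hle _.
  by rewrite lee_fin ler_wpM2r// sum_enorm_polygonal.
by rewrite -EFinM lee_fin -mulrA mulKf// gt_eqF.
Qed.

Let enormG_patch : (fun p => enorm (G p)) = (fun p => enorm (gradf p)) \_ Omega.
Proof.
apply/funext => p; rewrite patchE; case: ifPn => [/set_mem/GE ->//|].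
by move=> /negP nO; rewrite G0 /enorm ?dotp0r ?sqrtr0// => Op; apply/nO/mem_set.
Qed.

Let N := Lsnorm s Omega (fun p => enorm (gradf p)).

Let NE : N = 'N[mu]_s%:E[EFin \o (fun p => enorm (G p))]%E.
Proof. by rewrite enormG_patch. Qed.

Let N_fin : N \is a fin_num.
Proof.
rewrite ge0_fin_numE ?Lnorm_ge0//.
have -> : N = Lsnorm s setT (fun p => enorm (G p)).
  by rewrite NE; apply: eq_Lnorm => p /=; rewrite patchE mem_set.
apply: le_lt_trans (Lsnorm_enorm_le s1 measurableT mG) _.
apply: lte_sum_pinfty => i _; rewrite LnormE; apply: poweR_lty.
exact: Lfun_powR_lty.
Qed.

(** With comparison field 0 the norm of the gradient serves as [M]: by invariance of the measure no
    translate of [G] has a larger norm on [A]. *)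
Lemma Lsnorm_diff_quotient_le eps w : 0 < eps ->
  ((eps * kappa w)%:E < set_dist A (boundary Omega))%E ->
  (Lsnorm s A (diff_quotient f w eps) <= (kappa w)%:E * N)%E.
Proof.
move=> e0 ek; rewrite -(fineK N_fin) -EFinM.
rewrite (@eq_Lsnorm _ _ s A _
    (fun p => diff_quotient f w eps p - dotp 0 (hpart w))%R); last first.
  by move=> p _; rewrite dotpC dotp0r subr0.
apply: (diff_quotient_le (cf := fun=> 0)) => //.
  by rewrite fine_ge0// Lnorm_ge0.
apply: hpathT => q /=; rewrite fineK// NE.
have mGq : measurable_fun setT (fun p : H => enorm (G (heis_mul p q))).
  apply: measurable_enorm => i.
  exact: (measurableT_comp (mG i) (measurable_mulr q)).
rewrite -(@Lnorm_mulr _ _ s (fun p => enorm (G p)) q); last exact: measurable_enorm.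
under (eq_Lsnorm s) do rewrite subr0.
exact: Lsnorm_le_Lnorm.
Qed.

Let translation e : 0 < e -> exists2 d, 0 < d & forall q : H, `|q| < d ->
  (Lsnorm s A (fun p => enorm (G (heis_mul p q) - G p)) <= e%:E)%E.
Proof.
(* One share for each of the [2n] components; the successor keeps the denominator positive. *)
move=> e0; pose e' := e / (n + n).+1%:R.
have e'0 : 0 < e' by rewrite divr_gt0.
have : \forall q \near (0 : H), forall i : 'I_(n + n),
    ('N[mu]_s%:E[EFin \o (fun p => (G (heis_mul p q) ord0 i - G p ord0 i)%R)] <= e'%:E)%E.
  apply: (@filter_forall _ _ (fun i (q : H) =>
    'N[mu]_s%:E[EFin \o (fun p => (G (heis_mul p q) ord0 i - G p ord0 i)%R)]
      <= e'%:E)%E _ (nbhs_filter (0 : H))) => i.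
  exact: (Lfun_translation_continuous s1 (LG i) e'0).
move=> /nbhs_norm0P[d d0 dP]; exists d => // q qd.
have diffE p i : (G (heis_mul p q) - G p) ord0 i = G (heis_mul p q) ord0 i - G p ord0 i.
  by rewrite [LHS]mxE [X in _ + X = _]mxE.
have mdiff i : measurable_fun setT (fun p : H => (G (heis_mul p q) - G p) ord0 i).
  under eq_fun do rewrite diffE.
  by apply: measurable_funB => //; exact: (measurableT_comp (mG i) (measurable_mulr q)).
apply: le_trans (Lsnorm_enorm_le s1 mA mdiff) _.
apply: (@le_trans _ _ (\sum_(i < n + n) e'%:E)%E).
  apply: lee_sum => i _; apply: le_trans (dP q qd i).
  by rewrite le_eqVlt; apply/orP; left; apply/eqP; apply: eq_Lnorm => p /=; rewrite diffE.
rewrite sumEFin lee_fin sumr_const card_ord -mulr_natr /e' mulrAC ler_pdivrMr//.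
by rewrite ler_pM2l// ler_nat.
Qed.

Lemma cvg_Lsnorm_diff_quotient w : (0 < set_dist A (boundary Omega))%E ->
  Lsnorm s A (fun p => diff_quotient f w eps p - dotp (gradf p) (hpart w))
    @[eps --> 0^'+] --> 0%E.
Proof.
move=> dist0.
(* The distance may be infinite, so a positive real number below it is fixed. *)
have [r r0 rd] : exists2 r : R, 0 < r & (r%:E < set_dist A (boundary Omega))%E.
  case: (set_dist _ _) dist0 => [x|_|//]; last by exists 1; rewrite ?ltry.
  rewrite lte_fin => x0; exists (x / 2); first by rewrite divr_gt0.
  by rewrite lte_fin ltr_pdivrMr// ltr_pMr// ltr1n.
have [B hB] := hpath_bounded (0 : H) (polygonal j w).
have main e : 0 < e -> \forall eps \near 0^'+,
    (Lsnorm s A (fun p => diff_quotient f w eps p - dotp (gradf p) (hpart w))%R <= e%:E)%E.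
  (* Adding 1 avoids a zero denominator when [kappa w] vanishes, and [kappa w * M] is still at most
     [e]. *)
  move=> e0; pose M := e / (kappa w + 1).
  have k1 : 0 < kappa w + 1 by rewrite ltr_wpDl.
  have M0 : 0 < M by rewrite divr_gt0.
  have [d d0 dP] := translation M0.
  have B1 : 0 < `|B| + 1 by rewrite ltr_wpDl.
  near=> eps.
  have eps0 : 0 < eps by near: eps; exact: nbhs_right_gt.
  have eps1 : eps < 1 by near: eps; exact: nbhs_right_lt.
  have epsd : eps < d / (`|B| + 1) by near: eps; apply: nbhs_right_lt; rewrite divr_gt0.
  have epsr : eps < r / (kappa w + 1) by near: eps; apply: nbhs_right_lt; rewrite divr_gt0.
  rewrite (@eq_Lsnorm _ _ s A _
    (fun p => diff_quotient f w eps p - dotp (G p) (hpart w))%R); last first.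
    by move=> p Ap; rewrite GE//; exact: AO.
  apply: (@le_trans _ _ (kappa w * M)%:E); last first.
    rewrite lee_fin /M mulrA ler_pdivrMr// mulrC ler_pM2l// lerDl//.
  apply: (diff_quotient_le mG eps0 (ltW M0)).
    apply: lt_trans rd; rewrite lte_fin.
    rewrite ltr_pdivlMr// in epsr; apply: le_lt_trans epsr.
    by rewrite ler_pM2l// lerDl.
  rewrite polygonal_dilation//.
  have -> : (0 : H) = dilation eps 0.
    by rewrite dilationE tpartE mxE mulr0 raddf0 /hpart linear0 scaler0 row_mx0.
  (* The dilated path stays within [eps * B] of the origin, inside the ball where translating [G]
     changes it by at most [M] in norm. *)
  apply: sub_hpath (hpath_dilation eps hB) => _ [q qB <-]; apply: dP.
  apply: le_lt_trans (norm_dilation_le _ _) _; first by rewrite !ltW.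
  rewrite ltr_pdivlMr// in epsd; apply: le_lt_trans epsd.
  by rewrite ler_pM2l// (le_trans qB)// (le_trans (ler_norm _))// lerDl.
apply/fine_cvgP; split.
  near=> eps; rewrite ge0_fin_numE ?Lnorm_ge0//.
  by apply: (@le_lt_trans _ _ 1%:E); [near: eps; exact: main|exact: ltry].
apply/cvgrPdist_le => e e0; near=> eps; rewrite /= sub0r normrN.
have le : (Lsnorm s A (fun p => diff_quotient f w eps p - dotp (gradf p) (hpart w))%R <= e%:E)%E.
  by near: eps; exact: main.
rewrite ger0_norm ?fine_ge0 ?Lnorm_ge0// -lee_fin fineK//.
by rewrite ge0_fin_numE ?Lnorm_ge0// (le_lt_trans le)// ltry.
Unshelve. all: by end_near. Qed.

End difference_quotient.
Theorem theorem3p3 (R : realType) (n : nat) (hn : (1 <= n)%N)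
    (s : R) (hs : 1 <= s)
    (Omega : set (heis R n)) (openOmega : open Omega)
    (f : heis R n -> R) (hf : horizontal_sobolev s Omega f)
    (gradf : heis R n -> 'rV[R]_(n + n)) (hgradf : is_hgrad s Omega f gradf)
    (A : set (heis R n)) (openA : open A) (AOmega : A `<=` Omega)
    (hdist : (0 < set_dist A (boundary Omega))%E) :
  (forall w : heis R n,
     Lsnorm s A (fun p => diff_quotient f w eps p - dotp (gradf p) (hpart w))
       @[eps --> 0^'+] --> 0%E)
  /\
  (forall (eps : R) (w : heis R n), 0 < eps ->
     ((eps * (enorm (hpart w) + 2 * Num.sqrt `|tpart w|))%:E
        < set_dist A (boundary Omega))%E ->
     (Lsnorm s A (diff_quotient f w eps)
        <= (enorm (hpart w) + 2 * Num.sqrt `|tpart w|)%:E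
           * Lsnorm s Omega (fun p => enorm (gradf p)))%E).

Proof.
(* Since [n >= 1] there is a pair of fields X_j, Y_j, whose commutator produces the vertical
   direction. *)
have j : 'I_n := Ordinal hn; have [Lf _] := hf.
split=> [w|eps w e0 ew].
  exact: (cvg_Lsnorm_diff_quotient j hs openOmega Lf hgradf openA AOmega).
exact: (Lsnorm_diff_quotient_le j hs openOmega Lf hgradf openA AOmega).
Qed.
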